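(* Let $K$ be an algebraically closed field and let $\Lambda=KQ/I$ be a basic and connected finite dimensional $K$-algebra ($Q$ a finite quiver, $I$ an admissible ideal). Then $\Lambda$ is a right $3$-Nakayama algebra if and only if $\Lambda$ is a special biserial algebra of finite type such that $(Q,I)$ satisfies the following conditions: (i) If there exist a walk $w$ and two different arrows $w_1$ and $w_2$ with the same target such that $w_1^{+1}w_2^{-1}$ is a subwalk of $w$, then $w=w_1^{+1}w_2^{-1}$. (ii) If there exist a walk $w$ and two different arrows $w_1$ and $w_2$ with the same source such that $w_1^{-1}w_2^{+1}$ is a subwalk of $w$, then $\mathrm{length}(w)\leq 3$. (iii) If there exist two paths $p$ and $q$ with the same target and the same source such that $p-q\in I$, then $\mathrm{length}(p)=\mathrm{length}(q)=2$. (iv) At least one of the following conditions holds: (a) there exists a vertex $a\in Q_0$ such that $|a^-|=2$; (b) there exist a walk $w$ of length $3$ and two different arrows $w_1$ and $w_2$ with the same source such that $w_1^{-1}w_2^{+1}$ is a subwalk of $w$; (c) there exist two paths $p$ and $q$ with the same target and the same source such that $p-q\in I$ and $\mathrm{length}(p)=\mathrm{length}(q)=2$.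
   Context: All modules are finitely generated right modules. Put $\mathrm{rad}^0(M)=M$. A module is uniserial ($1$-factor serial) if it has a unique composition series (the zero module counts as uniserial). For $n>1$, a non-uniserial module $M$ of length $l\geq n$ is $n$-factor serial if $M/\mathrm{rad}^{l-n}(M)$ is uniserial and $M/\mathrm{rad}^{l-n+1}(M)$ is not uniserial. An algebra $\Lambda$ is right $n$-Nakayama if every indecomposable right $\Lambda$-module is $i$-factor serial for some $1\leq i\leq n$ and there exists at least one indecomposable $n$-factor serial right $\Lambda$-module. $Q=(Q_0,Q_1,s,t)$, with $Q_0$ the vertices, $Q_1$ the arrows, and $s,t$ the source and target maps. Paths are composed from left to right. For a vertex $a$, $a^+$ and $a^-$ denote the sets of arrows starting, respectively ending, at $a$, and $|X|$ is the number of elements of a set $X$. $\Lambda=KQ/I$ is special biserial if: (1) $|a^+|\leq 2$ and $|a^-|\leq 2$ for every vertex $a$; (2) for every arrow $\alpha$ there is at most one arrow $\beta$ and at most one arrow $\gamma$ such that $\alpha\beta$ and $\gamma\alpha$ are not in $I$. Finite type means that there are only finitely many isomorphism classes of indecomposable finitely generated modules. An edge is an arrow $\alpha=\alpha^{+1}$ or its formal inverse $\alpha^{-1}$, with $s(\alpha^{-1})=t(\alpha)$ and $t(\alpha^{-1})=s(\alpha)$. A non-trivial walk in $Q$ is a sequence $w=c_1c_2\cdots c_n$ of edges with $t(c_i)=s(c_{i+1})$ for all $i$; its length is $n$. To each vertex there is also a trivial walk, of length $0$. A subwalk of $w$ is a consecutive subsequence $c_ic_{i+1}\cdots c_j$.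
   Formalization: In (i), (ii), (iv)(b) a walk has no edge followed by its inverse and no subpath, or inverse of one, v with v∈I or v−ku∈I for a path u≠v, k∈K; in (iii), (iv)(c) p≠q and p,q∉I. Read literally the claim fails: for 1→2←3 the walk w1w2^{-1}w2 violates (i). *)

(* Defs.v *)
From HB Require Import structures.
From mathcomp Require Import all_boot all_algebra all_field.
From mathcomp Require Import finmap.
From mathcomp Require Import monalg.
From mathcomp Require Import boolp classical_sets functions.

Set Implicit Arguments.
Unset Strict Implicit.
Unset Printing Implicit Defensive.

Import GRing.Theory.
Local Open Scope ring_scope.

Record quiver := Quiver {
  vert : finType;
  arr : finType;
  src : arr -> vert;
  tgt : arr -> vert
}.

Section Paths.
Variable Q : quiver.

Fixpoint chain (a : vert Q) (l : seq (arr Q)) : bool :=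
  if l is x :: l' then (src x == a) && chain (tgt x) l' else true.

Definition chain_end (a : vert Q) (l : seq (arr Q)) : vert Q :=
  last a (map (@tgt Q) l).

(* A path is given by its source and its sequence of arrows, read from left to
   right; the source is only informative for the trivial paths. *)
Record qpath := QPath {
  qpath_val : vert Q * seq (arr Q);
  _ : chain qpath_val.1 qpath_val.2
}.

HB.instance Definition _ := [isSub for qpath_val].
HB.instance Definition _ := [Choice of qpath by <:].

Definition psrc (p : qpath) : vert Q := (val p).1.
Definition parr (p : qpath) : seq (arr Q) := (val p).2.
Definition ptgt (p : qpath) : vert Q := chain_end (psrc p) (parr p).
Definition plength (p : qpath) : nat := size (parr p).

Definition triv_path (a : vert Q) : qpath := @QPath (a, [::]) isT.

Lemma arrow_path_subproof (x : arr Q) : chain (src x) [:: x].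
Proof. by rewrite /= eqxx. Qed.

Definition arrow_path (x : arr Q) : qpath :=
  @QPath (src x, [:: x]) (arrow_path_subproof x).

Definition pcat (p q : qpath) : option qpath :=
  if ptgt p == psrc q then insub (psrc p, parr p ++ parr q) else None.

Lemma chain_cat a l m : chain a (l ++ m) = chain a l && chain (chain_end a l) m.
Proof. by elim: l a => //= x l IH a; rewrite IH -andbA. Qed.

Lemma qpathP (p : qpath) : chain (psrc p) (parr p).
Proof. exact: (valP p). Qed.

Lemma pcatE p q : ptgt p = psrc q ->
  exists2 r, pcat p q = Some r & val r = (psrc p, parr p ++ parr q).
Proof.
move=> pq; rewrite /pcat pq eqxx; case: insubP => [r _ rE|]; first by exists r.
by case/negP; rewrite chain_cat qpathP; move: pq; rewrite /ptgt => ->; exact: qpathP.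
Qed.

Lemma pcatN p q : ptgt p != psrc q -> pcat p q = None.
Proof. by rewrite /pcat => /negbTE ->. Qed.

Lemma pcat_tgt p q r : val r = (psrc p, parr p ++ parr q) ->
  ptgt p = psrc q -> ptgt r = ptgt q.
Proof.
move=> rE pq; rewrite {1}/ptgt {1}/psrc {1}/parr rE /= /chain_end map_cat.
by rewrite last_cat [last (psrc p) _]pq.
Qed.

Lemma pcatA p q r :
  obind (pcat^~ r) (pcat p q) = obind (pcat p) (pcat q r).
Proof.
case: (eqVneq (ptgt p) (psrc q)) => [pq|pq]; last first.
  rewrite (pcatN pq) /=; case: (eqVneq (ptgt q) (psrc r)) => [qr|qr].
    have [s -> sE] := pcatE qr; rewrite /= pcatN //.
    by rewrite /psrc sE.
  by rewrite (pcatN qr).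
have [s sS sE] := pcatE pq; rewrite sS /=; have st := pcat_tgt sE pq.
case: (eqVneq (ptgt q) (psrc r)) => [qr|qr]; last first.
  by rewrite (pcatN qr) pcatN // st.
have [t tS tE] := pcatE qr; rewrite tS /=.
have [u -> uE] := pcatE (etrans st qr).
have pt : ptgt p = psrc t by rewrite /psrc tE.
have [v -> vE] := pcatE pt; congr Some; apply: val_inj; rewrite uE vE.
by rewrite /psrc /parr sE tE /= catA.
Qed.

Lemma pcat_trivl a p :
  pcat (triv_path a) p = if a == psrc p then Some p else None.
Proof.
case: (eqVneq a (psrc p)) => [ap|ap]; last by rewrite pcatN.
have [r -> rE] := @pcatE (triv_path a) p ap.
by congr Some; apply: val_inj; rewrite rE /= ap [RHS]surjective_pairing.
Qed.

Lemma pcat_trivr a p :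
  pcat p (triv_path a) = if a == ptgt p then Some p else None.
Proof.
case: (eqVneq a (ptgt p)) => [ap|ap]; last by rewrite pcatN // eq_sym.
have [r -> rE] := @pcatE p (triv_path a) (esym ap).
by congr Some; apply: val_inj; rewrite rE /= cats0 [RHS]surjective_pairing.
Qed.

End Paths.

(* The quiver obtained from [Q] by adding formal inverses of the arrows: the
   edge [x^{+1}] is [(x, true)], the edge [x^{-1}] is [(x, false)]. *)
Definition double (Q : quiver) : quiver :=
  @Quiver (vert Q) (arr Q * bool)%type
    (fun c => if c.2 then src c.1 else tgt c.1)
    (fun c => if c.2 then tgt c.1 else src c.1).

Definition edge (Q : quiver) : finType := arr (double Q).
Definition fwd (Q : quiver) (x : arr Q) : edge Q := (x, true).
Definition bwd (Q : quiver) (x : arr Q) : edge Q := (x, false).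
Definition edge_inv (Q : quiver) (c : edge Q) : edge Q := (c.1, ~~ c.2).

Definition walk (Q : quiver) : Type := qpath (double Q).
Definition edges (Q : quiver) (w : walk Q) : seq (edge Q) := parr w.
Definition walk_length (Q : quiver) (w : walk Q) : nat := plength w.

(* [v] is the sequence of edges of a subwalk of [w]. *)
Definition has_subwalk (Q : quiver) (v : seq (edge Q)) (w : walk Q) : bool :=
  infix v (edges w).

(* The edges of a path and of its formal inverse. *)
Definition fwd_edges (Q : quiver) (p : qpath Q) : seq (edge Q) :=
  map (@fwd Q) (parr p).
Definition bwd_edges (Q : quiver) (p : qpath Q) : seq (edge Q) :=
  rev (map (@bwd Q) (parr p)).

(* [K Q]: the vector space with basis the paths of [Q]. *)
Definition path_algebra (K : fieldType) (Q : quiver) : Type := {malg K[qpath Q]}.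

HB.instance Definition _ (K : fieldType) (Q : quiver) :=
  GRing.Zmodule.copy (path_algebra K Q) {malg K[qpath Q]}.

(* The operations are locked, lest unification unfolds the representation of
   [{malg K[_]}]. *)
HB.lock Definition pa_scale (K : fieldType) (Q : quiver) (c : K)
  (x : path_algebra K Q) : path_algebra K Q := (c *: (x : {malg K[qpath Q]})).

Section PathAlgebraScale.
Variables (K : fieldType) (Q : quiver).
Local Notation pa_scale := (@pa_scale K Q).

Lemma pa_scaleA a b x : pa_scale a (pa_scale b x) = pa_scale (a * b) x.
Proof. by rewrite pa_scale.unlock; exact: scalerA. Qed.

Lemma pa_scale1 : left_id 1 pa_scale.
Proof. by move=> x; rewrite pa_scale.unlock; exact: scale1r. Qed.

Lemma pa_scaleDr : right_distributive pa_scale +%R.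
Proof. by move=> c x y; rewrite pa_scale.unlock; exact: scalerDr. Qed.

Lemma pa_scaleDl x : {morph pa_scale^~ x : a b / a + b}.
Proof. by move=> a b; rewrite pa_scale.unlock; exact: scalerDl. Qed.

HB.instance Definition _ := GRing.Zmodule_isLmodule.Build K (path_algebra K Q)
  pa_scaleA pa_scale1 pa_scaleDr pa_scaleDl.

Lemma pa_scaleE (c : K) (x : path_algebra K Q) :
  c *: x = (c *: (x : {malg K[qpath Q]}) : {malg K[qpath Q]}).
Proof. by rewrite -[LHS]/(pa_scale c x) pa_scale.unlock. Qed.

Lemma mcoeff_pa_scale p (c : K) (x : path_algebra K Q) :
  mcoeff p (c *: x) = c * mcoeff p x.
Proof. by rewrite pa_scaleE mcoeffZ. Qed.

Lemma msupp_pa_scale (c : K) (x : path_algebra K Q) :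
  fsubset (msupp (c *: x)) (msupp x).
Proof. by rewrite pa_scaleE msuppZ_le. Qed.

End PathAlgebraScale.

HB.lock Definition path_elt (K : fieldType) (Q : quiver) (p : qpath Q) :
  path_algebra K Q := << p >>.

Definition opath_elt (K : fieldType) (Q : quiver) (o : option (qpath Q)) :
  path_algebra K Q := if o is Some p then path_elt K p else 0.

HB.lock Definition pa_mul (K : fieldType) (Q : quiver) (x y : path_algebra K Q) :
  path_algebra K Q :=
  \sum_(p <- msupp x) \sum_(q <- msupp y)
    (mcoeff p x * mcoeff q y) *: opath_elt K (pcat p q).

HB.lock Definition pa_one (K : fieldType) (Q : quiver) : path_algebra K Q :=
  \sum_(a : vert Q) path_elt K (triv_path a).

Section PathAlgebra.
Variables (K : fieldType) (Q : quiver).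
Local Notation KQ := (path_algebra K Q).
Implicit Types (x y z : KQ) (p q r : qpath Q).

Local Notation path_elt := (@path_elt K Q).
Local Notation opath_elt := (@opath_elt K Q).
Local Notation pa_mul := (@pa_mul K Q).
Local Notation pa_one := (@pa_one K Q).

Lemma pa_mulw (d1 d2 : {fset qpath Q}) x y :
  fsubset (msupp x) d1 -> fsubset (msupp y) d2 ->
  pa_mul x y = \sum_(p <- d1) \sum_(q <- d2)
    (mcoeff p x * mcoeff q y) *: opath_elt (pcat p q).
Proof.
move=> le1 le2; rewrite pa_mul.unlock (big_fset_incl _ le1) /=; last first.
  move=> p _ /mcoeff_outdom xp; rewrite big1 // => q _.
  by rewrite xp mul0r scale0r.
apply: eq_bigr => p _; apply: big_fset_incl => // q _ /mcoeff_outdom ->.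
by rewrite mulr0 scale0r.
Qed.

Lemma pa_mulDl : left_distributive pa_mul +%R.
Proof.
move=> x y z.
rewrite (pa_mulw (msuppD_le x y) (fsubset_refl _)).
rewrite (pa_mulw (fsubsetUl (msupp x) (msupp y)) (fsubset_refl (msupp z))).
rewrite (pa_mulw (fsubsetUr (msupp x) (msupp y)) (fsubset_refl (msupp z))).
rewrite -big_split /=; apply: eq_bigr => p _.
rewrite -big_split /=; apply: eq_bigr => q _.
by rewrite mcoeffD mulrDl scalerDl.
Qed.

Lemma pa_mulDr : right_distributive pa_mul +%R.
Proof.
move=> z x y.
rewrite (pa_mulw (fsubset_refl _) (msuppD_le x y)).
rewrite (pa_mulw (fsubset_refl (msupp z)) (fsubsetUl (msupp x) (msupp y))).
rewrite (pa_mulw (fsubset_refl (msupp z)) (fsubsetUr (msupp x) (msupp y))).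
rewrite -big_split /=; apply: eq_bigr => p _.
rewrite -big_split /=; apply: eq_bigr => q _.
by rewrite mcoeffD mulrDr scalerDl.
Qed.

Lemma pa_mul0l : left_zero 0 pa_mul.
Proof. by move=> x; apply: (addrI (pa_mul 0 x)); rewrite -pa_mulDl !addr0. Qed.

Lemma pa_mul0r : right_zero 0 pa_mul.
Proof. by move=> x; apply: (addrI (pa_mul x 0)); rewrite -pa_mulDr !addr0. Qed.

Lemma pa_mulZl c x y : pa_mul (c *: x) y = c *: pa_mul x y.
Proof.
rewrite (pa_mulw (msupp_pa_scale c x) (fsubset_refl _)) pa_mul.unlock scaler_sumr.
apply: eq_bigr => p _; rewrite scaler_sumr; apply: eq_bigr => q _.
by rewrite scalerA mcoeff_pa_scale mulrA.
Qed.

Lemma pa_mulZr c x y : pa_mul x (c *: y) = c *: pa_mul x y.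
Proof.
rewrite (pa_mulw (fsubset_refl _) (msupp_pa_scale c y)) pa_mul.unlock scaler_sumr.
apply: eq_bigr => p _; rewrite scaler_sumr; apply: eq_bigr => q _.
by rewrite scalerA mcoeff_pa_scale mulrCA.
Qed.

Lemma pa_mulUU p q : pa_mul (path_elt p) (path_elt q) = opath_elt (pcat p q).
Proof.
rewrite (@pa_mulw [fset p] [fset q])%fset; try by rewrite path_elt.unlock msuppU_le.
by rewrite !big_seq_fset1 path_elt.unlock !mcoeffUU mulr1 scale1r.
Qed.

Lemma pa_expand x : x = \sum_(p <- msupp x) mcoeff p x *: path_elt p.
Proof.
rewrite {1}[x]monalgE; apply: eq_bigr => p _; apply/malgP => q.
rewrite path_elt.unlock mcoeffU mcoeff_pa_scale mcoeffU.
by rewrite mulrnAr mulr1.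
Qed.

Lemma pa_ind (P : KQ -> Prop) :
  P 0 -> (forall x y, P x -> P y -> P (x + y)) ->
  (forall c x, P x -> P (c *: x)) -> (forall p, P (path_elt p)) ->
  forall x, P x.
Proof.
move=> P0 PD PZ Pp x; rewrite [x]pa_expand.
by elim/big_ind: _ => // p _; apply: PZ.
Qed.

Lemma pa_mul_sumr I (s : seq I) (F : I -> KQ) y :
  pa_mul y (\sum_(i <- s) F i) = \sum_(i <- s) pa_mul y (F i).
Proof. exact: (big_morph (pa_mul y) (pa_mulDr y) (pa_mul0r y)). Qed.

Lemma pa_mul_suml I (s : seq I) (F : I -> KQ) y :
  pa_mul (\sum_(i <- s) F i) y = \sum_(i <- s) pa_mul (F i) y.
Proof.
exact: (big_morph (pa_mul^~ y) (fun a b => pa_mulDl a b y) (pa_mul0l y)).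
Qed.

Lemma pa_mul1l : left_id pa_one pa_mul.
Proof.
elim/pa_ind => [|x y IHx IHy|c x IH|p].
- by rewrite pa_mul0r.
- by rewrite pa_mulDr IHx IHy.
- by rewrite pa_mulZr IH.
rewrite pa_one.unlock pa_mul_suml (bigD1 (psrc p)) //= pa_mulUU pcat_trivl eqxx /=.
by rewrite big1 ?addr0 // => a ap; rewrite pa_mulUU pcat_trivl (negbTE ap).
Qed.

Lemma pa_mul1r : right_id pa_one pa_mul.
Proof.
elim/pa_ind => [|x y IHx IHy|c x IH|p].
- by rewrite pa_mul0l.
- by rewrite pa_mulDl IHx IHy.
- by rewrite pa_mulZl IH.
rewrite pa_one.unlock pa_mul_sumr (bigD1 (ptgt p)) //= pa_mulUU pcat_trivr eqxx /=.
by rewrite big1 ?addr0 // => a ap; rewrite pa_mulUU pcat_trivr (negbTE ap).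
Qed.

Lemma pa_mulA : associative pa_mul.
Proof.
move=> + y z; elim/pa_ind => [|x x' IH IH'|c x IH|p].
- by rewrite !pa_mul0l.
- by rewrite !pa_mulDl IH IH'.
- by rewrite !pa_mulZl IH.
move: y; elim/pa_ind => [|x x' IH IH'|c x IH|q].
- by rewrite pa_mul0l pa_mul0r pa_mul0l.
- by rewrite pa_mulDl !pa_mulDr pa_mulDl IH IH'.
- by rewrite pa_mulZl !pa_mulZr pa_mulZl IH.
move: z; elim/pa_ind => [|x x' IH IH'|c x IH|r].
- by rewrite !pa_mul0r.
- by rewrite !pa_mulDr IH IH'.
- by rewrite !pa_mulZr IH.
rewrite !pa_mulUU; have := pcatA p q r.
case: (pcat p q) => [s|]; case: (pcat q r) => [t|] //=.
- by rewrite !pa_mulUU => ->.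
- by rewrite pa_mulUU pa_mul0r => ->.
- by rewrite pa_mulUU pa_mul0l => <-.
by rewrite pa_mul0l pa_mul0r.
Qed.

HB.instance Definition _ := GRing.Zmodule_isPzRing.Build KQ
  pa_mulA pa_mul1l pa_mul1r pa_mulDl pa_mulDr.

Definition arrow_elt (x : arr Q) : KQ := path_elt (arrow_path x).

Definition two_sided_ideal (I : set KQ) : Prop :=
  [/\ I 0, forall x y, I x -> I y -> I (x + y),
      forall x y, I x -> I (y * x) & forall x y, I x -> I (x * y)].

(* The [m]-th power of the arrow ideal of [K Q], that is, the linear span of
   the paths of length at least [m]. *)
Definition arrow_ideal_pow (m : nat) : set KQ :=
  [set x | forall p, p \in msupp x -> (m <= plength p)%N].

Definition admissible (I : set KQ) : Prop :=
  two_sided_ideal I /\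
  exists m, [/\ (2 <= m)%N, (arrow_ideal_pow m `<=` I)%classic
              & (I `<=` arrow_ideal_pow 2)%classic].

End PathAlgebra.

(* [A] is the bound quiver algebra [K Q / I], with canonical projection [pi]. *)
Definition is_bound_quiver_algebra (K : fieldType) (Q : quiver)
    (I : set (path_algebra K Q)) (A : falgType K)
    (pi : {rmorphism path_algebra K Q -> A}) : Prop :=
  [/\ scalable pi, forall a : A, exists x, pi x = a
    & forall x, pi x = 0 <-> I x].

(* Right modules over [R] are left modules over the converse ring [R^c]; this
   section only depends on the ring [R] acting from the left. *)
Section Modules.
Variable R : pzRingType.

Definition finitely_generated (M : lmodType R) : Prop :=
  exists (n : nat) (g : 'I_n -> M),
    forall x, exists c : 'I_n -> R, x = \sum_(i < n) c i *: g i.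

Definition module_iso (M N : lmodType R) : Prop :=
  exists f : {linear M -> N}, bijective f.

Definition submodule_iso (M M' : lmodType R) (N : set M) (N' : set M') : Prop :=
  exists f : M -> M',
    [/\ set_bij N N' f, forall x y, N x -> N y -> f (x + y) = f x + f y
      & forall (a : R) x, N x -> f (a *: x) = a *: f x].

Section Submodules.
Variable M : lmodType R.
Implicit Types N P L : set M.
Local Open Scope classical_set_scope.

Definition submodule N : Prop :=
  [/\ N 0, forall x y, N x -> N y -> N (x + y)
    & forall (a : R) x, N x -> N (a *: x)].

Definition maximal_submodule P N : Prop :=
  [/\ submodule P, submodule N, P `<` N
    & forall L, submodule L -> P `<=` L -> L `<=` N -> L = P \/ L = N].

(* [c = [:: N_1; ..; N_r]] with [N = N_0 < N_1 < .. < N_r = P] and every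
   [N_i] maximal in [N_(i+1)]. By the correspondence theorem, these are the
   composition series of the factor module [P / N]. *)
Fixpoint composition_series N P (c : seq (set M)) : Prop :=
  if c is L :: c' then maximal_submodule N L /\ composition_series L P c'
  else N = P.

Definition has_length (l : nat) : Prop :=
  exists2 c, composition_series [set 0] setT c & size c = l.

(* The factor module [M / N] is uniserial. *)
Definition uniserial_quotient N : Prop :=
  exists! c, composition_series N setT c.

Definition uniserial : Prop := uniserial_quotient [set 0].

(* The intersection of the maximal submodules of [N]. *)
Definition radical N : set M :=
  [set x | N x /\ forall P, maximal_submodule P N -> P x].

(* The submodule [rad^i(M)] of [M]. *)
Definition radical_pow (i : nat) : set M := iter i radical setT.

Definition indecomposable : Prop :=
  (exists x : M, x != 0) /\
  forall N P, submodule N -> submodule P -> N `&` P = [set 0] ->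
    (forall x, exists y z, [/\ N y, P z & x = y + z]) ->
    N = [set 0] \/ P = [set 0].

Definition factor_serial (n : nat) : Prop :=
  match n with
  | 0 => False
  | 1 => uniserial
  | _ => ~ uniserial /\
         exists l, [/\ has_length l, (n <= l)%N,
           uniserial_quotient (radical_pow (l - n)%N)
         & ~ uniserial_quotient (radical_pow (l - n + 1)%N)]
  end.

End Submodules.
End Modules.

Section Algebras.
Variables (K : fieldType) (A : falgType K).

Definition right_nakayama (n : nat) : Prop :=
  (forall M : lmodType A^c, finitely_generated M -> indecomposable M ->
     exists i, [/\ (1 <= i)%N, (i <= n)%N & factor_serial M i]) /\
  (exists M : lmodType A^c,
     [/\ finitely_generated M, indecomposable M & factor_serial M n]).

Definition finite_type : Prop :=
  exists (n : nat) (F : 'I_n -> lmodType A^c),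
    forall M : lmodType A^c, finitely_generated M -> indecomposable M ->
      exists i, module_iso M (F i).

Definition connected_algebra : Prop :=
  forall e : A, e * e = e -> (forall x, e * x = x * e) -> e = 0 \/ e = 1.

Definition primitive_idempotent (e : A) : Prop :=
  [/\ e != 0, e * e = e
    & forall f g : A, f * f = f -> g * g = g -> f * g = 0 -> g * f = 0 ->
        e = f + g -> f = 0 \/ g = 0].

(* The right ideal [e A], as a submodule of the right regular module. *)
Definition right_ideal (e : A) : set (A^c)^o := [set x | exists a : A, x = e * a].

Definition basic_algebra : Prop :=
  exists (n : nat) (e : 'I_n -> A),
    [/\ forall i, primitive_idempotent (e i),
        forall i j, i != j -> e i * e j = 0,
        \sum_(i < n) e i = 1
      & forall i j, i != j ->
          ~ submodule_iso (right_ideal (e i)) (right_ideal (e j))].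

End Algebras.

Section BoundQuiver.
Variables (K : fieldType) (Q : quiver) (I : set (path_algebra K Q)).

(* A product of two non-composable arrows is zero, hence in [I]. *)
Definition special_biserial : Prop :=
  [/\ forall a : vert Q, (#|[set x : arr Q | src x == a]%SET| <= 2)%N,
      forall a : vert Q, (#|[set x : arr Q | tgt x == a]%SET| <= 2)%N,
      forall x y y' : arr Q, ~ I (arrow_elt K x * arrow_elt K y) ->
        ~ I (arrow_elt K x * arrow_elt K y') -> y = y'
    & forall x z z' : arr Q, ~ I (arrow_elt K z * arrow_elt K x) ->
        ~ I (arrow_elt K z' * arrow_elt K x) -> z = z'].

(* The walks which carry indecomposable modules over [K Q / I]: no edge is
   followed by its inverse, and no subwalk is (inverse to) a path occurring in
   a zero relation or in a commutativity relation of [I]. The conditions on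
   walks stated below concern these walks only: an arbitrary walk
   [w_1 w_2^{-1}] extends to the walk [w_1 w_2^{-1} w_2], so that [condition_i]
   would fail already for the quiver [1 -> 2 <- 3], and, for the commutative
   square [a b = c d], it would fail for the walk [a b d^{-1}]. *)
Definition string (w : walk Q) : Prop :=
  sorted (fun c d => d != edge_inv c) (edges w) /\
  forall p : qpath Q,
    has_subwalk (fwd_edges p) w \/ has_subwalk (bwd_edges p) w ->
    ~ I (path_elt K p) /\
    forall (q : qpath Q) (k : K), q != p -> ~ I (path_elt K p - k *: path_elt K q).

(* [p - q] is a genuine commutativity relation: the differences of two equal
   paths or of two paths in [I] are discarded. *)
Definition commutativity_relation (p q : qpath Q) : Prop :=
  [/\ psrc p = psrc q, ptgt p = ptgt q, p != q
    & [/\ ~ I (path_elt K p), ~ I (path_elt K q)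
        & I (path_elt K p - path_elt K q)]].

Definition condition_i : Prop :=
  forall (w : walk Q) (w1 w2 : arr Q),
    string w -> w1 != w2 -> tgt w1 = tgt w2 ->
    has_subwalk [:: fwd w1; bwd w2] w -> edges w = [:: fwd w1; bwd w2].

Definition condition_ii : Prop :=
  forall (w : walk Q) (w1 w2 : arr Q),
    string w -> w1 != w2 -> src w1 = src w2 ->
    has_subwalk [:: bwd w1; fwd w2] w -> (walk_length w <= 3)%N.

Definition condition_iii : Prop :=
  forall p q : qpath Q, commutativity_relation p q ->
    plength p = 2%N /\ plength q = 2%N.

Definition condition_iv_a : Prop :=
  exists a : vert Q, #|[set x : arr Q | tgt x == a]%SET| = 2%N.

Definition condition_iv_b : Prop :=
  exists (w : walk Q) (w1 w2 : arr Q),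
    [/\ string w, walk_length w = 3%N, w1 != w2, src w1 = src w2
      & has_subwalk [:: bwd w1; fwd w2] w].

Definition condition_iv_c : Prop :=
  exists p q : qpath Q,
    [/\ commutativity_relation p q, plength p = 2%N & plength q = 2%N].

End BoundQuiver.

(* Main.v *)
(* Diagrams describe small modules by a basis and the arrows between its vectors.

   Under the conditions, an indecomposable module is given by one of five
   diagrams: a commutative square, two arrows with a common target, a path of
   length two and an arrow with a common source, two arrows with a common source,
   or a path. Indeed, a vector on which the corresponding paths act non-trivially
   spans a submodule of this shape, and linear forms dual to its basis, chosen in
   this order, cut out a complementary submodule. There are finitely many such
   diagrams, and their factor serial type is read off from the basis.

   Conversely, over a right 3-Nakayama algebra an indecomposable module has length
   at most three if its top is not simple, and at most four if its radical has a
   non-simple top. If one of the conditions fails, then either a diagram with four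
   or five vertices gives an indecomposable module contradicting the first bound,
   or there are long paths out of a vertex [b] where two arrows start, and [e_b A]
   contradicts the second bound. *)

Require Import Defs.
From HB Require Import structures.
From mathcomp Require Import all_boot all_algebra all_field.
From mathcomp Require Import finmap monalg.
From mathcomp Require Import boolp classical_sets.

Set Implicit Arguments.
Unset Strict Implicit.
Unset Printing Implicit Defensive.

Import GRing.Theory.
Local Open Scope ring_scope.

(** * Linear algebra *)

Section LinearAlgebra.
Variables (K : fieldType) (V : lmodType K).
Implicit Types (U N : set V) (u v w : V) (s t : seq V).

(** The order of the five diagrams matters because the kernel of the chosen forms must be a
    submodule: its stability for a later diagram rests on the vanishing that the absence of the
    earlier ones brings.

    Realizing a diagram meets an obstacle: a relation in [I] may be a combination of many paths. A
    diagram therefore becomes a module once no three links compose and each path of length two along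
    its links has coefficient zero in every element of [I]. To verify this, parallel paths are shown
    to vanish, to be absent, or to be proper right multiples, which nilpotency of the arrow ideal
    disposes of.

    The bounds three and four come from the definition of type [i]. A non-simple top makes
    [M / rad^k(M)] non-uniserial for all [k >= 1], so the length is [i]; a non-simple top of the
    radical does so for [k >= 2], so the length is at most [i + 1]. In [e_b A] the bound four is
    used up by [e_b], two arrows and one longer path, so that any two longer paths from [b] are
    proportional. *)

Definition subspace U : Prop :=
  [/\ U 0, forall u v, U u -> U v -> U (u + v) & forall k u, U u -> U (k *: u)].

Lemma subspaceB U u v : subspace U -> U u -> U v -> U (u - v).
Proof. by case=> _ UD UZ Uu Uv; rewrite -scaleN1r; apply/UD/UZ. Qed.

Lemma subspaceK U u v : subspace U -> U v -> U (u - v) -> U u.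
Proof. by case=> _ UD _ Uv Uuv; rewrite -(subrK v u); apply: UD. Qed.

Lemma subspace_sum U (J : Type) (r : seq J) (P : pred J) (F : J -> V) :
  subspace U -> (forall i, P i -> U (F i)) -> U (\sum_(i <- r | P i) F i).
Proof. by case=> U0 UD _ UF; apply: big_ind. Qed.

Lemma subspaceZ U k u : subspace U -> k != 0 -> U (k *: u) -> U u.
Proof.
by case=> _ _ UZ k0 /(UZ k^-1); rewrite scalerA mulVf // scale1r.
Qed.

(** The sum of [U] and the line [K u]. *)
Definition line_add U u : set V := [set v | exists k, U (v - k *: u)].

Lemma line_add_sub U u v : U v -> line_add U u v.
Proof. by exists 0; rewrite scale0r subr0. Qed.

Lemma line_add_mem U u : subspace U -> line_add U u u.
Proof. by case=> U0 _ _; exists 1; rewrite scale1r subrr. Qed.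

Lemma subspace_line_add U u : subspace U -> subspace (line_add U u).
Proof.
move=> sU; have [U0 UD UZ] := sU; split; first exact: line_add_sub.
- move=> v w [k kP] [l lP]; exists (k + l).
  by rewrite scalerDl opprD addrACA; apply: UD.
- by move=> l v [k kP]; exists (l * k); rewrite -scalerA -scalerBr; apply: UZ.
Qed.

(* A subspace maximal among those that contain [U] but not [x] is a hyperplane
   complementary to [x]. *)
Lemma separating_form U x : subspace U -> ~ U x ->
  exists f : {scalar V}, (forall u, U u -> f u = 0) /\ f x = 1.
Proof.
move=> sU Ux.
pose P (W : set V) := (W = set0) \/ [/\ subspace W, (U `<=` W)%classic & ~ W x].
have [F FP Ftot|W [WP Wmax]] := @Zorn_bigcup V P.
  have [F0|/existsNP[X /not_implyP[FX X0]]] :=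
    pselect (forall X, F X -> X = set0).
    by left; rewrite -subset0 => y [X FX]; rewrite (F0 _ FX).
  right; have [//|[sX UX Xx]] := FP _ FX.
  have chain Y Z u v : F Y -> F Z -> Y u -> Z v ->
      exists T, [/\ F T, T u & T v].
    move=> FY FZ Yu Zv; have [YZ|ZY] := Ftot _ _ FY FZ.
      by exists Z; split=> //; apply: YZ.
    by exists Y; split=> //; apply: ZY.
  have subF Y u : F Y -> Y u -> subspace Y.
    by move=> FY Yu; have [Y0|[]//] := FP _ FY; rewrite Y0 in Yu.
  split; [split|by move=> y /UX Xy; exists X|].
  - by exists X => //; case: sX.
  - move=> u v [Y FY Yu] [Z FZ Zv]; have [T [FT Tu Tv]] := chain _ _ _ _ FY FZ Yu Zv.
    by exists T => //; have [_ TD _] := subF _ _ FT Tu; apply: TD.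
  - by move=> k u [Y FY Yu]; exists Y => //; have [_ _ YZ] := subF _ _ FY Yu; apply: YZ.
  - by case=> Y FY Yx; have [Y0|[]//] := FP _ FY; rewrite Y0 in Yx.
have [sW UW Wx] : [/\ subspace W, (U `<=` W)%classic & ~ W x].
  case: WP => // W0; case: (Wmax U); last by right; split.
  by rewrite W0; split=> [//|/(_ 0)]; case: sU => U0 _ _ /(_ U0).
(* Unless [v] already lies in [W], maximality puts [x] into [W + K v]; either way [v] is a multiple
   of [x] modulo [W]. *)
have dec v : exists k, W (v - k *: x).
  apply: contrapT => vN; case: (Wmax (line_add W v)).
    split; first exact: line_add_sub.
    move=> /(_ v (line_add_mem v sW)) Wv; apply: vN; exists 0.
    by rewrite scale0r subr0.
  right; split; [exact: subspace_line_add|by move=> u /UW; exact: line_add_sub|].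
  case=> k xk; have [k0|k0] := eqVneq k 0.
    by move: xk; rewrite k0 scale0r subr0.
  apply: vN; exists k^-1; rewrite -opprB.
  have -> : k^-1 *: x - v = k^-1 *: (x - k *: v).
    by rewrite scalerBr scalerA mulVf // scale1r.
  by rewrite -[- (_ *: _)]scaleNr; case: sW => _ _; apply.
have uniq k l v : W (v - k *: x) -> W (v - l *: x) -> k = l.
  move=> Wk Wl; apply: contrapT => /eqP kl; apply: Wx.
  apply: (@subspaceZ _ (l - k)) => //; first by rewrite subr_eq0 eq_sym.
  have -> : (l - k) *: x = (v - k *: x) - (v - l *: x).
    by rewrite scalerBl opprB [RHS]addrC addrA subrK.
  exact: subspaceB.
pose f v := sval (cid (dec v)).
have fP v : W (v - f v *: x) by rewrite /f; case: cid.
have [W0 WD WZ] := sW.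
have fD u v : f (u + v) = f u + f v.
  apply: (uniq _ _ (u + v)); first exact: fP.
  by rewrite scalerDl opprD addrACA; apply: WD; apply: fP.
have fZ k v : f (k *: v) = k * f v.
  apply: (uniq _ _ (k *: v)); first exact: fP.
  by rewrite -scalerA -scalerBr; apply/WZ/fP.
have fL : linear_for *%R f by move=> k u v; rewrite fD fZ.
pose fl : {scalar V} := HB.pack f (GRing.isLinear.Build K V K _ f fL).
exists fl; split=> [u /UW Wu|] /=; apply: uniq (fP _) _.
  by rewrite scale0r subr0.
by rewrite scale1r subrr.
Qed.

(** The sum of [N] and the span of [s]. Working relative to [N] lets a basis grow along a
    composition series. *)
Fixpoint spanN N s v : Prop :=
  if s is u :: s' then exists k, spanN N s' (v - k *: u) else N v.

Fixpoint freeN N s : Prop :=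
  if s is u :: s' then ~ N u /\ freeN (line_add N u) s' else True.

Lemma subspace_spanN N s : subspace N -> subspace (spanN N s).
Proof.
by move=> sN; elim: s => //= u s /(subspace_line_add u).
Qed.

Lemma spanN_sub N s v : N v -> spanN N s v.
Proof. by move=> Nv; elim: s => //= u s IH; exists 0; rewrite scale0r subr0. Qed.

Lemma spanN_mono N N' s v : (N `<=` N')%classic -> spanN N s v -> spanN N' s v.
Proof.
move=> NN'; elim: s v => [v /NN'//|u s IH v /= [k kP]]; exists k; exact: IH.
Qed.

Lemma spanN_mem N s v : subspace N -> v \in s -> spanN N s v.
Proof.
move=> sN; elim: s => //= u s IH; rewrite inE => /predU1P[->|/IH vs].
  by exists 1; rewrite scale1r subrr; apply: spanN_sub; case: sN.
by exists 0; rewrite scale0r subr0.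
Qed.

Lemma spanN_min N s U : subspace U -> (N `<=` U)%classic ->
  (forall u, u \in s -> U u) -> (spanN N s `<=` U)%classic.
Proof.
move=> sU NU; elim: s => [_|u s IH sP v /= [k]]; first exact: NU.
move=> /IH vk; apply: (@subspaceK _ _ (k *: u)) => //.
  by case: sU => _ _; apply; apply: sP; rewrite mem_head.
by apply: vk => w ws; apply: sP; rewrite inE ws orbT.
Qed.

Lemma spanN_line N u s v : subspace N ->
  spanN (line_add N u) s v <-> spanN N (u :: s) v.
Proof.
move=> sN; split.
  apply: spanN_min; first exact: subspace_spanN.
    by move=> w [k kP]; exists k; apply: spanN_sub.
  by move=> w ws; apply: spanN_mem => //; rewrite inE ws orbT.
apply: (@spanN_min N (u :: s)).
- exact/subspace_spanN/subspace_line_add.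
- by move=> w Nw; apply/spanN_sub/line_add_sub.
- move=> w; rewrite inE => /predU1P[->|ws]; first exact/spanN_sub/line_add_mem.
  by apply: spanN_mem => //; apply: subspace_line_add.
Qed.

(** Steinitz exchange modulo [N]: [u] takes the place of the first vector of [s] with a nonzero
    coefficient in it. *)
Lemma spanN_exchange N s u : subspace N -> spanN N s u -> ~ N u ->
  exists2 s', (size s').+1 = size s &
    forall v, spanN N s v -> spanN (line_add N u) s' v.
Proof.
move=> sN; elim: s => [//|w s IH] /= [k uk] Nu.
have [k0|k0] := eqVneq k 0.
  rewrite k0 scale0r subr0 in uk.
  have [s' <- sP] := IH uk Nu; exists (w :: s') => // v [l /sP vl].
  by exists l.
exists s => // v [l vl]; apply/spanN_line => //; exists (l / k).
have -> : v - l / k *: u = (v - l *: w) - l / k *: (u - k *: w).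
  by rewrite scalerBr scalerA divfK // opprB addrA subrK.
apply: subspaceB => //; first exact: subspace_spanN.
by have [_ _ ] := subspace_spanN s sN; apply.
Qed.

Lemma free_le_span N s t : subspace N -> freeN N t ->
  (forall v, v \in t -> spanN N s v) -> (size t <= size s)%N.
Proof.
elim: t N s => [//|u t IH] N s sN /= [Nu Ft] ts.
have [s' <- sP] := spanN_exchange sN (ts u (mem_head _ _)) Nu.
rewrite ltnS; apply: IH Ft _; first exact: subspace_line_add.
by move=> v vt; apply/sP/ts; rewrite inE vt orbT.
Qed.

(** The values of [fs] on [s] form a triangular matrix with invertible diagonal. This suffices for
    the span of [s] and the common kernel of [fs] to be complementary, and only half of the values
    has to be computed. *)
Fixpoint triangular s (fs : seq {scalar V}) : Prop :=
  match s, fs with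
  | u :: s', f :: fs' =>
      [/\ f u != 0, forall v, v \in s' -> f v = 0 & triangular s' fs']
  | [::], [::] => True
  | _, _ => False
  end.

Lemma subspace_ker (f : {scalar V}) : subspace [set v | f v = 0].
Proof.
split=> [|u v|k u] /=; first exact: raddf0.
  by move=> u0 v0; rewrite raddfD /= u0 v0 addr0.
by move=> u0; rewrite linearZ /= u0 mulr0.
Qed.

Lemma subspace_bigker (fs : nat -> {scalar V}) (P : nat -> Prop) :
  subspace [set v | forall i, P i -> fs i v = 0].
Proof.
split=> [i _|u v u0 v0 i Pi|k u u0 i Pi] /=; first exact: raddf0.
  by rewrite raddfD /= u0 // v0 // addr0.
by rewrite linearZ /= u0 // mulr0.
Qed.

Lemma subspace0 : subspace [set 0 : V].
Proof.
by split=> [//|u v -> -> /=|k u -> /=]; rewrite ?addr0 ?scaler0.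
Qed.

Definition lspan s : set V := spanN [set 0] s.

Definition vanish (fs : seq {scalar V}) v : bool :=
  all (fun f : {scalar V} => f v == 0) fs.

Lemma lspan_ker s (f : {scalar V}) u :
  (forall v, v \in s -> f v = 0) -> lspan s u -> f u = 0.
Proof.
move=> fs0 su; apply: (@spanN_min [set 0] s [set x | f x = 0]) => //.
  exact: subspace_ker.
by move=> _ ->; exact: raddf0.
Qed.

Lemma triangular_decomp s fs v : triangular s fs ->
  exists2 u, lspan s u & vanish fs (v - u).
Proof.
elim: s fs v => [|w s IH] [|f fs] // v /=.
  by move=> _; exists 0.
move=> [fw fs0 /IH sP]; have [u su uP] := sP (v - (f v / f w) *: w).
exists ((f v / f w) *: w + u).
  by exists (f v / f w); rewrite addrAC subrr add0r.
rewrite opprD addrA uP andbT !raddfB /= (lspan_ker fs0 su) subr0 linearZ /= divfK //.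
by rewrite subrr.
Qed.

Lemma triangular_free s fs u : triangular s fs -> lspan s u ->
  vanish fs u -> u = 0.
Proof.
elim: s fs u => [|w s IH] [|f fs] //= u [fw fs0 tri] [k sk] /andP[/eqP fu ufs].
have k0 : k = 0.
  have := lspan_ker fs0 sk.
  rewrite raddfB /= linearZ /= fu sub0r => /eqP.
  by rewrite oppr_eq0 mulf_eq0 (negPf fw) orbF => /eqP.
rewrite k0 scale0r subr0 in sk.
exact: IH tri sk ufs.
Qed.

Lemma form_comb (f g : {scalar V}) k l :
  exists h : {scalar V}, forall v, h v = k * f v + l * g v.
Proof.
pose h v := k * f v + l * g v.
have hL : linear_for *%R h.
  move=> a u v; rewrite /h !linearP /= !mulrDr addrACA.
  by congr (_ + _ + _); rewrite mulrCA.
pose hl : {scalar V} := HB.pack h (GRing.isLinear.Build K V K _ h hL).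
by exists hl.
Qed.

(** Gaussian elimination: [f] is normalized at [u], and multiples of it are subtracted from the
    forms dual to the tail so that they vanish at [u]. *)
Lemma triangular_dual s fs : triangular s fs ->
  exists c : nat -> {scalar V}, forall i j, (i < size s)%N -> (j < size s)%N ->
    c i s`_j = (i == j)%:R.
Proof.
elim: s fs => [|u s IH] [|f fs] //; first by exists (fun=> \0).
move=> [fu fs0 /IH[c cP]].
have [g gP] := form_comb f f (f u)^-1 0.
have gE v : g v = (f u)^-1 * f v by rewrite gP mul0r addr0.
have /choice[d dP] i : exists h : {scalar V},
    forall v, h v = 1 * c i v + - c i u * g v by exact: form_comb.
exists (fun i => if i is i'.+1 then d i' else g) => -[|i] [|j] //= si sj.
- by rewrite gE mulVf.
- by rewrite gE (fs0 _ (mem_nth 0 sj)) mulr0.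
- by rewrite dP mul1r gE mulVf // mulr1 subrr.
by rewrite dP gE (fs0 _ (mem_nth 0 sj)) !mulr0 addr0 mul1r cP.
Qed.

Lemma lspanE s v : lspan s v <-> exists c : nat -> K, v = \sum_(i < size s) c i *: s`_i.
Proof.
split.
  elim: s v => [|u s IH] v /=; first by move=> ->; exists (fun=> 0); rewrite big_ord0.
  move=> [k /IH[c cE]]; exists (fun i => if i is i'.+1 then c i' else k).
  by rewrite big_ord_recl /= -cE addrC subrK.
move=> [c ->]; have sub := subspace_spanN s subspace0.
apply: subspace_sum => // i _; case: (sub) => _ _; apply.
by apply: spanN_mem; [exact: subspace0|exact: mem_nth].
Qed.

End LinearAlgebra.

(** A form that kills [g (ker theta)] and is 1 at [g m1], where [theta m1 = 1], agrees with [theta]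
    along [g]. *)
Lemma form_factor (K : fieldType) (V W : lmodType K) (g : {linear V -> W})
    (theta : {scalar V}) :
  (forall v, g v = 0 -> theta v = 0) ->
  exists phi : {scalar W}, forall v, phi (g v) = theta v.
Proof.
move=> ker; have [t0|/existsNP[m /eqP tm]] := pselect (forall v, theta v = 0).
  by exists \0 => v; rewrite t0.
pose U : set W := [set w | exists2 v, theta v = 0 & w = g v]%classic.
have sU : subspace U.
  split=> [|_ _ [u u0 ->] [v v0 ->]|k _ [u u0 ->]].
  - by exists 0; rewrite raddf0.
  - by exists (u + v); rewrite !raddfD //= u0 v0 addr0.
  - by exists (k *: u); rewrite !linearZ //= u0 mulr0.
have [m1 tm1] : exists m1, theta m1 = 1.
  by exists ((theta m)^-1 *: m); rewrite linearZ /= mulVf.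
have [|phi [phi0 phi1]] := @separating_form _ _ U (g m1) sU.
  move=> [v v0 gv]; have := ker (m1 - v).
  by rewrite !raddfB /= gv subrr v0 subr0 tm1 => /(_ erefl)/eqP; rewrite oner_eq0.
exists phi => v; have -> : g v = g (v - theta v *: m1) + theta v *: g m1.
  by rewrite linearB linearZ /= subrK.
rewrite [phi (_ + _)]linearD [phi (_ *: _)]linearZ /= phi1 mulr1 phi0 ?add0r //; exists (v - theta v *: m1) => //.
by rewrite linearB linearZ /= tm1 mulr1 subrr.
Qed.

Section TriangularSequences.
Variables (K : fieldType) (V : lmodType K).

Lemma triangular_mkseq (n : nat) (s : nat -> V) (f : nat -> {scalar V}) :
  (forall i, (i < n)%N -> f i (s i) != 0) ->
  (forall i j, (i < j < n)%N -> f i (s j) = 0) ->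
  triangular (mkseq s n) (mkseq f n).
Proof.
elim: n s f => [//|n IH] s f fs fs0.
rewrite /mkseq /= -[1%N]/(1 + 0)%N iotaDl -!map_comp; split.
- exact: fs.
- move=> v /mapP[j]; rewrite mem_iota => /andP[_ jn] ->.
  by rewrite /= fs0 // ltnS.
by apply: (IH (s \o succn) (f \o succn)) => [i ?|i j ?]; [apply: fs|apply: fs0].
Qed.

Lemma vanish_mkseq (n : nat) (f : nat -> {scalar V}) v :
  vanish (mkseq f n) v <-> forall i, (i < n)%N -> f i v = 0.
Proof.
rewrite /vanish /mkseq all_map; split=> [/allP H i ltin|H].
  by apply/eqP/H; rewrite mem_iota.
by apply/allP => i; rewrite mem_iota => /andP[_ ltin]; apply/eqP/H.
Qed.

End TriangularSequences.

Section Forms.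
Variables (K : fieldType) (V : lmodType K) (f : {scalar V}).

Lemma sformD u v : f (u + v) = f u + f v. Proof. exact: raddfD. Qed.
Lemma sformB u v : f (u - v) = f u - f v. Proof. exact: raddfB. Qed.
Lemma sformZ k u : f (k *: u) = k * f u. Proof. exact: linearZ. Qed.
Lemma sform0 : f 0 = 0. Proof. exact: raddf0. Qed.
Lemma sform_sum (J : Type) (r : seq J) (P : pred J) F :
  f (\sum_(i <- r | P i) F i) = \sum_(i <- r | P i) f (F i).
Proof. exact: raddf_sum. Qed.

End Forms.

(** * Modules over a bound quiver algebra *)

(** A copy of [M] that carries the [K]-vector space structure, while [M] keeps its structure over
    [A^c]. *)
Definition kmod (K : fieldType) (A : falgType K) (M : lmodType A^c) : Type := M.
HB.instance Definition _ (K : fieldType) (A : falgType K) (M : lmodType A^c) := GRing.Zmodule.on (@kmod K A M).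

Section KMod.
Variables (K : fieldType) (A : falgType K) (M : lmodType A^c).
Local Notation V := (kmod M).

Definition ract (a : A) (m : V) : V := (a : A^c) *: (m : M).
Local Notation "m <* a" := (ract a m) (at level 40, left associativity).

Definition kscale (k : K) (m : V) : V := m <* k%:A.

Lemma ractM m a b : m <* a <* b = m <* (a * b).
Proof. exact: scalerA. Qed.

Lemma ract1 m : m <* 1 = m. Proof. exact: scale1r. Qed.

Lemma ractDr m a b : m <* (a + b) = m <* a + m <* b.
Proof. exact: scalerDl. Qed.

Lemma ractDl m n a : (m + n) <* a = m <* a + n <* a.
Proof. exact: scalerDr. Qed.

Lemma kscaleA a b x : kscale a (kscale b x) = kscale (a * b) x.
Proof. by rewrite /kscale ractM -scalerAl mul1r scalerA mulrC. Qed.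

Lemma kscale1 : left_id 1 kscale.
Proof. by move=> x; rewrite /kscale scale1r ract1. Qed.

Lemma kscaleDr : right_distributive kscale +%R.
Proof. by move=> c x y; exact: ractDl. Qed.

Lemma kscaleDl x : {morph kscale^~ x : a b / a + b}.
Proof. by move=> a b; rewrite /kscale scalerDl ractDr. Qed.

End KMod.

HB.instance Definition _ (K : fieldType) (A : falgType K) (M : lmodType A^c) := GRing.Zmodule_isLmodule.Build K (@kmod K A M)
  (@kscaleA K A M) (@kscale1 K A M) (@kscaleDr K A M) (@kscaleDl K A M).

Notation "m <* a" := (ract a m) (at level 40, left associativity).

Section KModTheory.
Variables (K : fieldType) (A : falgType K) (M : lmodType A^c).
Local Notation V := (kmod M).
Implicit Types (m n : V) (a b : A) (k : K).

Lemma kscaleE k m : k *: m = m <* k%:A. Proof. by []. Qed.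

Lemma ractZl k m a : (k *: m) <* a = k *: (m <* a).
Proof. by rewrite !kscaleE !ractM -scalerAl mul1r -scalerAr mulr1. Qed.

Lemma ractZr k m a : m <* (k *: a) = k *: (m <* a).
Proof. by rewrite kscaleE ractM -scalerAr mulr1. Qed.

Lemma ract_linear a : linear (@ract K A M a : V -> V).
Proof. by move=> k m n; rewrite ractDl ractZl. Qed.

HB.instance Definition _ a :=
  GRing.isLinear.Build K V V *:%R (@ract K A M a) (ract_linear a).

Lemma ract0l a : (0 : V) <* a = 0. Proof. exact: raddf0. Qed.
Lemma ract0r m : m <* 0 = 0. Proof. exact: (@scale0r A^c M m). Qed.
Lemma ractBl m n a : (m - n) <* a = m <* a - n <* a. Proof. exact: raddfB. Qed.

Lemma ract_suml (J : Type) (r : seq J) (P : pred J) (F : J -> V) a :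
  (\sum_(i <- r | P i) F i) <* a = \sum_(i <- r | P i) F i <* a.
Proof. exact: raddf_sum. Qed.

Lemma ract_sumr (J : Type) (r : seq J) (P : pred J) (F : J -> A) m :
  m <* (\sum_(i <- r | P i) F i) = \sum_(i <- r | P i) m <* F i.
Proof. exact: (big_morph (fun a => m <* a) (ractDr m) (ract0r m)). Qed.

Definition rform (f : {scalar V}) (a : A) : {scalar V} := f \o @ract K A M a.

Lemma rformE f a m : rform f a m = f (m <* a). Proof. by []. Qed.

End KModTheory.

Section BoundQuiverAlgebra.
Variables (K : fieldType) (Q : quiver) (I : set (path_algebra K Q)).
Variables (A : falgType K) (pi : {rmorphism path_algebra K Q -> A}).
Hypotheses (adm : admissible I) (bqa : is_bound_quiver_algebra I pi).

Local Notation KQ := (path_algebra K Q).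

Definition vx (a : vert Q) : A := pi (path_elt K (triv_path a)).
Definition ar (x : arr Q) : A := pi (arrow_elt K x).
(** Defined for arbitrary sequences: the product vanishes unless consecutive arrows compose, so no
    chain condition has to be carried along. *)
Definition mon (l : seq (arr Q)) : A := \prod_(x <- l) ar x.

Lemma piZ k f : pi (k *: f) = k *: pi f.
Proof. by case: bqa => + _ _; apply. Qed.

Lemma piI f : pi f = 0 <-> I f. Proof. by case: bqa. Qed.

Lemma pi_surj a : exists f, pi f = a. Proof. by case: bqa. Qed.

Lemma path_mul (p q : qpath Q) :
  path_elt K p * path_elt K q = opath_elt K (pcat p q).
Proof. exact: pa_mulUU. Qed.

Lemma path_elt_arrows (p : qpath Q) :
  path_elt K p = path_elt K (triv_path (psrc p)) * \prod_(x <- parr p) arrow_elt K x.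
Proof.
case: p => -[a l] pl; rewrite /psrc /parr /=.
elim/last_ind: l pl => [|l x IH] pl.
  rewrite big_nil mulr1; congr path_elt; exact: val_inj.
have pl' : chain a l by move: pl; rewrite -cats1 chain_cat => /andP[].
have la : chain_end a l = src x.
  by move: pl; rewrite -cats1 chain_cat /= andbT => /andP[_ /eqP].
have -> : \prod_(y <- rcons l x) arrow_elt K y =
    \prod_(y <- l) arrow_elt K y * arrow_elt K x.
  by rewrite -cats1 big_cat big_seq1.
rewrite mulrA -(IH pl') path_mul.
have [r -> rE] := @pcatE _ (@QPath _ (a, l) pl') (arrow_path x) la.
by congr path_elt; apply: val_inj; rewrite rE /= cats1.
Qed.

Lemma pi_path p : pi (path_elt K p) = vx (psrc p) * mon (parr p).
Proof. by rewrite path_elt_arrows rmorphM rmorph_prod. Qed.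

Lemma mon_nil : mon [::] = 1. Proof. exact: big_nil. Qed.
Lemma mon_cons x l : mon (x :: l) = ar x * mon l. Proof. exact: big_cons. Qed.
Lemma mon_cat l l' : mon (l ++ l') = mon l * mon l'. Proof. exact: big_cat. Qed.
Lemma mon1 x : mon [:: x] = ar x. Proof. exact: big_seq1. Qed.
Lemma mon2 x y : mon [:: x; y] = ar x * ar y.
Proof. by rewrite mon_cons mon1. Qed.
Lemma mon_rcons l x : mon (rcons l x) = mon l * ar x.
Proof. by rewrite -cats1 mon_cat mon1. Qed.

Lemma vxM a b : vx a * vx b = if a == b then vx a else 0.
Proof.
rewrite /vx -rmorphM path_mul pcat_trivl /psrc /=.
by case: eqP => [->//|_]; rewrite rmorph0.
Qed.

Lemma vxx a : vx a * vx a = vx a. Proof. by rewrite vxM eqxx. Qed.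

Lemma sum_vx : \sum_a vx a = 1.
Proof.
rewrite /vx -rmorph_sum -[RHS](rmorph1 pi); congr (pi _).
by rewrite -[RHS]/(pa_one K Q) pa_one.unlock.
Qed.

Lemma vx_ar a x : vx a * ar x = if a == src x then ar x else 0.
Proof.
rewrite /vx /ar -rmorphM path_mul pcat_trivl /psrc /=.
by case: eqP => // _; rewrite rmorph0.
Qed.

Lemma ar_vx x a : ar x * vx a = if a == tgt x then ar x else 0.
Proof.
rewrite /vx /ar -rmorphM path_mul pcat_trivr /ptgt /chain_end /=.
by case: eqP => // _; rewrite rmorph0.
Qed.

Lemma src_ar x : vx (src x) * ar x = ar x. Proof. by rewrite vx_ar eqxx. Qed.
Lemma tgt_ar x : ar x * vx (tgt x) = ar x. Proof. by rewrite ar_vx eqxx. Qed.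

Lemma ar_ar0 x y : tgt x != src y -> ar x * ar y = 0.
Proof. by move=> xy; rewrite -(src_ar y) mulrA ar_vx eq_sym (negPf xy) mul0r. Qed.

Lemma ar2_neq0 x y : ar x * ar y != 0 -> tgt x = src y.
Proof. by move=> xy0; apply/eqP; apply: contraNT xy0 => /ar_ar0 ->. Qed.

Lemma I_arrows x y : I (arrow_elt K x * arrow_elt K y) <-> ar x * ar y = 0.
Proof. by rewrite -piI rmorphM. Qed.

Lemma piPE p q k : I (path_elt K p - k *: path_elt K q) <->
  pi (path_elt K p) = k *: pi (path_elt K q).
Proof.
by rewrite -piI rmorphB /= piZ; split=> [/subr0_eq|->//]; rewrite ?subrr.
Qed.

Lemma short_coef p f : (plength p <= 1)%N -> I f -> mcoeff p f = 0.
Proof.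
move=> p1 If; have [_ [m [_ _ I2]]] := adm; have := I2 f If p.
by case: (boolP (p \in msupp f)) => [_ /(_ isT)|/mcoeff_outdom//]; rewrite leqNgt ltnS p1.
Qed.

(** Long paths lie in [I] by admissibility, and a sequence that is not a path has a zero product
    anyway. *)
Lemma mon_nilp : exists m, forall l, (m <= size l)%N -> mon l = 0.
Proof.
have [_ [m [m2 Im _]]] := adm; exists m => -[|x l] lm.
  by move: (leq_trans m2 lm).
have [lc|lN] := boolP (chain (src x) (x :: l)).
  have -> : mon (x :: l) = pi (path_elt K (@QPath _ (src x, x :: l) lc)).
    by rewrite pi_path /psrc /parr /= mon_cons mulrA src_ar.
  apply/piI/Im => p; rewrite path_elt.unlock => /(fsubsetP msuppU_le).
  by rewrite inE => /eqP ->.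
elim: l x lN {lm} => [x|y l IH x] /=; first by rewrite eqxx.
rewrite eqxx /= negb_and mon_cons => /orP[yx|lN].
  by rewrite mon_cons mulrA ar_ar0 ?mul0r // eq_sym.
by rewrite IH ?mulr0 //= eqxx.
Qed.

Lemma mon_path x l : mon (x :: l) != 0 -> exists2 p : qpath Q,
  val p = (src x, x :: l) & pi (path_elt K p) = mon (x :: l).
Proof.
move=> nz; suff lc : chain (src x) (x :: l).
  by exists (@QPath _ (src x, x :: l) lc) => //; rewrite pi_path /psrc /parr /= mon_cons mulrA src_ar.
elim: l x nz => [|y l IH] x nz /=; first by rewrite eqxx.
rewrite eqxx /=; move: nz; rewrite mon_cons => nz.
have : mon (y :: l) != 0 by apply: contraNneq nz => ->; rewrite mulr0.
move=> /IH /= /andP[_ ->]; rewrite andbT eq_sym; apply: contraNT nz => xy.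
by rewrite mon_cons mulrA ar_ar0 ?mul0r.
Qed.

Lemma alg_ind (P : A -> Prop) :
  (forall a b, P a -> P b -> P (a + b)) -> (forall k a, P a -> P (k *: a)) ->
  (forall a b, P a -> P b -> P (a * b)) -> (forall v, P (vx v)) ->
  (forall x, P (ar x)) -> forall a, P a.
Proof.
move=> PD PZ PM Pv Px a; have [f <-] := pi_surj a.
elim/pa_ind: f => [|f g Pf Pg|k f Pf|p].
(* [P 0] is obtained as [P (0 *: vx v)]; a vertex exists because the [vx v] add up to [1], which is
   not zero. *)
- have [v] : exists v : vert Q, True.
    have [//|nov] := pselect (exists v : vert Q, True).
    have : (1 : A) = 0.
      by rewrite -sum_vx big1 // => v; case: nov; exists v.
    by move/eqP; rewrite oner_eq0.
  by rewrite rmorph0 -(scale0r (vx v)) => _; apply/PZ/Pv.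
- by rewrite rmorphD; apply: PD.
- by rewrite piZ; apply: PZ.
rewrite pi_path; elim/last_ind: (parr p) => [|l x IH]; first by rewrite mon_nil mulr1.
by rewrite mon_rcons mulrA; apply: PM.
Qed.

End BoundQuiverAlgebra.

(** * Radicals and composition series *)

Section ModuleTheory.
Variables (K : fieldType) (Q : quiver) (I : set (path_algebra K Q)).
Variables (A : falgType K) (pi : {rmorphism path_algebra K Q -> A}).
Hypotheses (adm : admissible I) (bqa : is_bound_quiver_algebra I pi).
Variable M : lmodType A^c.

Local Notation V := (kmod M).
Local Notation e := (vx pi).
Local Notation ar := (ar pi).
Local Notation mon := (mon pi).
Implicit Types (N P L : set V) (u v w : V).

Lemma ract_vx_sum v : \sum_a v <* e a = v.
Proof. by rewrite -ract_sumr (sum_vx pi) ract1. Qed.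

Lemma ract_mon_cons v x l : v <* mon (x :: l) = v <* ar x <* mon l.
Proof. by rewrite mon_cons ractM. Qed.

Lemma vx_ar_act v a x : v <* e a <* ar x = if a == src x then v <* ar x else 0.
Proof. by rewrite ractM vx_ar; case: eqP => // _; rewrite ract0r. Qed.

Lemma ar_vx_act v x a : v <* ar x <* e a = if a == tgt x then v <* ar x else 0.
Proof. by rewrite ractM ar_vx; case: eqP => // _; rewrite ract0r. Qed.

Lemma vx_vx_act v a b : v <* e a <* e b = if a == b then v <* e a else 0.
Proof. by rewrite ractM vxM; case: eqP => // _; rewrite ract0r. Qed.

Definition stable N : Prop :=
  (forall a v, N v -> N (v <* e a)) /\ (forall x v, N v -> N (v <* ar x)).

Lemma submoduleP N : submodule (N : set M) <-> subspace N /\ stable N.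
Proof.
split=> [[N0 ND NZ]|[[N0 ND NZ] [Ne Nx]]]; split=> //.
- by split=> // k u Nu; exact: NZ.
- by split=> a v Nv; exact: NZ.
move=> a x; change (N x -> N ((x : V) <* a)); move: a x.
apply: (alg_ind bqa) => [a b Na Nb|k a Na|a b Na Nb|a|a] x Nx'.
- by rewrite ractDr; apply: ND; [apply: Na|apply: Nb].
- by rewrite ractZr; apply/NZ/Na.
- by rewrite -ractM; apply/Nb/Na.
- exact: Ne.
- exact: Nx.
Qed.

Lemma submodule_subspace N : submodule (N : set M) -> subspace N.
Proof. by case/submoduleP. Qed.

Lemma submodule_vx N a v : submodule (N : set M) -> N v -> N (v <* e a).
Proof. by case/submoduleP=> _ [+ _]; apply. Qed.

Lemma submodule_ar N x v : submodule (N : set M) -> N v -> N (v <* ar x).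
Proof. by case/submoduleP=> _ [_]; apply. Qed.

Lemma submoduleT : submodule (setT : set M).
Proof. by []. Qed.

Lemma submodule0 : submodule ([set 0] : set M).
Proof. by split=> [//|x y -> ->|a x ->] /=; rewrite ?addr0 ?scaler0. Qed.

Definition addset N P : set V := [set v | exists2 n, N n & P (v - n)]%classic.

Lemma submodule_addset N P : submodule (N : set M) -> submodule (P : set M) ->
  submodule (addset N P : set M).
Proof.
move=> /submoduleP[[N0 ND NZ] [Ne Nx]] /submoduleP[[P0 PD PZ] [Pe Px]].
apply/submoduleP; split; split.
- by exists 0; rewrite ?subr0.
- move=> u v [n Nn Pu] [m Nm Pv]; exists (n + m); first exact: ND.
  by rewrite opprD addrACA; apply: PD.
- by move=> k u [n Nn Pu]; exists (k *: n); [exact: NZ|rewrite -scalerBr; exact: PZ].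
- by move=> a u [n Nn Pu]; exists (n <* e a); [exact: Ne|rewrite -ractBl; exact: Pe].
- by move=> x u [n Nn Pu]; exists (n <* ar x); [exact: Nx|rewrite -ractBl; exact: Px].
Qed.

Lemma sub_addsetl N P : submodule (P : set M) -> (N `<=` addset N P)%classic.
Proof. by case=> P0 _ _ n Nn; exists n => //; rewrite subrr. Qed.

Lemma sub_addsetr N P : submodule (N : set M) -> (P `<=` addset N P)%classic.
Proof. by case=> N0 _ _ p Pp; exists 0 => //; rewrite subr0. Qed.

(* [N J], where [J] is the ideal of [A] generated by the arrows. *)
Definition rad1 N : set V :=
  [set u | exists2 g : arr Q -> V, forall x, N (g x) & u = \sum_x g x <* ar x]%classic.

Lemma rad1_mem N x v : submodule (N : set M) -> N v -> rad1 N (v <* ar x).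
Proof.
move=> sN Nv; exists (fun y => if y == x then v else 0).
  by move=> y; case: ifP => // _; case: sN.
rewrite (bigD1 x) //= eqxx big1 ?addr0 // => y yx.
by rewrite (negPf yx) ract0l.
Qed.

Lemma rad1_min N P : submodule (P : set M) ->
  (forall x v, N v -> P (v <* ar x)) -> (rad1 N `<=` P)%classic.
Proof.
move=> /submodule_subspace sP NP _ [g Ng ->].
by apply: subspace_sum => // x _; apply: NP.
Qed.

Lemma rad1_sub N : submodule (N : set M) -> (rad1 N `<=` N)%classic.
Proof. by move=> sN; apply: rad1_min => // x v; apply: submodule_ar. Qed.

Lemma submodule_rad1 N : submodule (N : set M) -> submodule (rad1 N : set M).
Proof.
move=> sN; have [[N0 ND NZ] _] := (submoduleP N).1 sN.
have sR : subspace (rad1 N).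
  split=> [|_ _ [g Ng ->] [h Nh ->]|k _ [g Ng ->]].
  - by exists (fun=> 0) => //; rewrite big1 // => x _; rewrite ract0l.
  - exists (fun x => g x + h x); first by move=> x; apply: ND.
    by rewrite -big_split /=; apply: eq_bigr => x _; rewrite ractDl.
  - exists (fun x => k *: g x); first by move=> x; apply: NZ.
    by rewrite scaler_sumr; apply: eq_bigr => x _; rewrite ractZl.
apply/submoduleP; split=> //; split=> [a _ [g Ng ->]|x v Rv]; last first.
  by apply: rad1_mem => //; apply: rad1_sub.
rewrite ract_suml; apply: subspace_sum => // x _.
rewrite ar_vx_act; case: ifP => _; first exact: rad1_mem.
by case: sR.
Qed.

Lemma submodule_rad1_iter k N : submodule (N : set M) ->
  submodule (iter k rad1 N : set M).
Proof. by move=> sN; elim: k => //= k; apply: submodule_rad1. Qed.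

(** Vectors of [N J^k] are killed by all paths of length [m - k]; at [k = m] this is the empty path,
    which acts as the identity. *)
Lemma rad1_nilp : exists m, forall N u, iter m rad1 N u -> u = 0.
Proof.
have [m mP] := mon_nilp adm bqa; exists m => N.
have step k u : (k <= m)%N -> iter k rad1 N u ->
    forall l, size l = (m - k)%N -> u <* mon l = 0.
  elim: k u => [|k IH] u km /=.
    by move=> _ l; rewrite subn0 => lm; rewrite mP ?lm // ract0r.
  move=> [g Ng ->] l lE; rewrite ract_suml big1 // => x _.
  rewrite -ract_mon_cons (IH _ (ltnW km) (Ng x)) //=.
  by rewrite lE subnSK.
move=> u um; have := step m u (leqnn _) um [::].
by rewrite subnn mon_nil ract1; apply.
Qed.

(** Nakayama's lemma for the nilpotent ideal [J]: substituting the inclusion into itself puts [P]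
    inside [N + P J^k] for every [k]. *)
Lemma nakayama N P : submodule (N : set M) -> submodule (P : set M) ->
  (P `<=` addset N (rad1 P))%classic -> (P `<=` N)%classic.
Proof.
move=> sN sP PN; have [m mP] := rad1_nilp.
have step k : (P `<=` addset N (iter k rad1 P))%classic.
  elim: k => [|k IH] p Pp /=.
    by exists 0; [case: sN|rewrite subr0].
  have [n Nn [g Pg pE]] := PN _ Pp.
  have /choice[h hP] x : exists n', N n' /\ iter k rad1 P (g x - n').
    by have [n' ? ?] := IH _ (Pg x); exists n'.
  exists (n + \sum_x h x <* ar x).
    have sN' := submodule_subspace sN; case: (sN') => _ ND _; apply: ND => //.
    by apply: subspace_sum => // x _; apply: submodule_ar => //; case: (hP x).
  exists (fun x => g x - h x); first by move=> x; case: (hP x).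
  rewrite opprD addrA pE -sumrB; apply: eq_bigr => x _.
  by rewrite ractBl.
by move=> p Pp; have [n Nn /mP/subr0_eq->] := step m p Pp.
Qed.

Lemma maximal_rad1 P N :
  maximal_submodule (P : set M) (N : set M) -> (rad1 N `<=` P)%classic.
Proof.
move=> [sP sN [PN NP] max].
have sR := submodule_rad1 sN.
have LN : (addset P (rad1 N) `<=` N)%classic.
  move=> u [p Pp /(rad1_sub sN) up].
  by apply: (@subspaceK _ _ _ _ p) => //; [apply: submodule_subspace|apply: PN].
have [LP|LE] := max _ (submodule_addset sP sR) (sub_addsetl (P := rad1 N) sR) LN.
  by move=> u Ru; rewrite -LP; apply: sub_addsetr.
by case: NP; apply: nakayama => // u; rewrite -{1}LE.
Qed.

Lemma submodule_line P w a : submodule (P : set M) -> w <* e a = w ->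
  (forall x, P (w <* ar x)) -> submodule (line_add P w : set M).
Proof.
move=> sP wa wx; have sP' := submodule_subspace sP.
apply/submoduleP; split; first exact: subspace_line_add.
split=> [b|x] v [k vP].
  exists (if a == b then k else 0).
  have -> : v <* e b - (if a == b then k else 0) *: w = (v - k *: w) <* e b.
    rewrite ractBl ractZl -wa vx_vx_act.
    by case: eqP => // _; rewrite scale0r scaler0.
  exact: submodule_vx.
apply: line_add_sub; apply: (@subspaceK _ _ _ _ (k *: (w <* ar x))) => //.
  by case: sP' => _ _; apply.
by rewrite -ractZl -ractBl; apply: submodule_ar.
Qed.

Lemma exists_vx N v : subspace N -> ~ N v -> exists a, ~ N (v <* e a).
Proof.
move=> sN Nv; apply: contrapT => /forallNP all; apply: Nv.
rewrite -(ract_vx_sum v); apply: subspace_sum => // a _.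
by apply: contrapT; apply: all.
Qed.

Lemma sub_line P w : (P `<=` line_add P w)%classic.
Proof. by move=> v; exact: line_add_sub. Qed.

Lemma line_sub P N w : submodule (N : set M) -> (P `<=` N)%classic -> N w ->
  (line_add P w `<=` N)%classic.
Proof.
move=> /submodule_subspace sN PN Nw v [k /PN vk].
by apply: (subspaceK sN) vk; case: sN => _ _; apply.
Qed.

(** Simple modules are one-dimensional: [N J] lies in [P], so [P] and a single vector at one vertex
    already span a submodule above [P]. *)
Lemma maximal_line P N : maximal_submodule (P : set M) (N : set M) ->
  exists2 w, ~ P w & N = line_add P w.
Proof.
move=> mPN; have R := maximal_rad1 mPN; have [sP sN [PN NP] max] := mPN.
have /existsNP[v /not_implyP[Nv Pv]] := NP.
have [a Pa] := exists_vx (submodule_subspace sP) Pv.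
exists (v <* e a) => //.
have sL : submodule (line_add P (v <* e a) : set M).
  apply: (@submodule_line _ _ a) => //; first by rewrite vx_vx_act eqxx.
  move=> x; rewrite vx_ar_act; case: eqP => _; last by case: sP.
  by apply/R/rad1_mem.
have LN := line_sub sN PN (submodule_vx a sN Nv).
have [LP|->//] := max _ sL (@sub_line _ _) LN.
by case: Pa; rewrite -{1}LP; apply: line_add_mem; apply: submodule_subspace.
Qed.

Lemma line_maximal P w a : submodule (P : set M) -> w <* e a = w -> ~ P w ->
  (forall x, P (w <* ar x)) -> maximal_submodule (P : set M) (line_add P w).
Proof.
move=> sP wa Pw wx; have sP' := submodule_subspace sP.
have sL := submodule_line sP wa wx; split=> //.
  split; first exact: sub_line.
  by move=> /(_ w (line_add_mem w sP')).
move=> L sL' PL LP; have [LP'|/existsNP[v /not_implyP[Lv Pv]]] :=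
  pselect (L `<=` P)%classic; [by left; apply/seteqP|right].
apply/seteqP; split=> //; apply: line_sub => //.
have [k vk] := LP _ Lv; have [k0|k0] := eqVneq k 0.
  by move: vk; rewrite k0 scale0r subr0.
have sL1 := submodule_subspace sL'.
apply: (subspaceZ sL1 k0); have -> : k *: w = v - (v - k *: w) by rewrite subKr.
by apply: (@subspaceB K V L) => //; apply: PL.
Qed.

Lemma ker_maximal N (f : {scalar V}) : submodule (N : set M) ->
  submodule (N `&` [set v | f v = 0] : set M)%classic ->
  (exists2 v, N v & f v <> 0) ->
  maximal_submodule (N `&` [set v | f v = 0] : set M)%classic (N : set M).
Proof.
move=> sN sF [v Nv /eqP fv]; split=> //.
  by split=> [w []//|/(_ v Nv)[_ /eqP]]; rewrite (negPf fv).
move=> L sL FL LN.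
have [LF|/existsNP[w /not_implyP[Lw /eqP fw]]] :=
    pselect (forall w, L w -> f w = 0).
  left; apply/seteqP; split=> // w Lw; split; [exact: LN|exact: LF].
right; suff NL : forall u : V, N u -> L u by apply/seteqP.
move=> u Nu; have [_ _ LZ] := submodule_subspace sL.
have [_ _ NZ] := submodule_subspace sN.
apply: (subspaceK (submodule_subspace sL) (LZ (f u / f w) _ Lw)).
apply: FL; split; last by rewrite /= sformB sformZ divfK // subrr.
by apply: (subspaceB (submodule_subspace sN)) => //; apply/NZ/LN.
Qed.

(** For [x] outside [N J], some component [x e_a] is outside too. A form that sees only this vertex,
    kills [N J] and is 1 at [x] cuts out a maximal submodule that misses [x]. *)
Lemma radicalE N : submodule (N : set M) -> radical (N : set M) = rad1 N.
Proof.
move=> sN; apply/seteqP; split=> [x [Nx xP]|x Rx]; last first.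
  split; first exact: rad1_sub.
  by move=> P /maximal_rad1; apply.
apply: contrapT => Rx; have sR := submodule_rad1 sN.
have [a xa] := exists_vx (submodule_subspace sR) Rx.
pose U : set V := (fun u => rad1 N (u <* e a)).
have [R0 RD RZ] := submodule_subspace sR.
have sU : subspace U.
  split=> [|u v Uu Uv|k u Uu]; rewrite /U.
  - by rewrite ract0l.
  - by rewrite ractDl; apply: RD.
  - by rewrite ractZl; apply: RZ.
have [f [fU fx]] := separating_form sU xa.
have fa u : f (u <* e a) = f u.
  apply/eqP; rewrite eq_sym -subr_eq0 -sformB fU // /U ractBl vx_vx_act eqxx.
  by rewrite subrr.
suff mx : maximal_submodule (N `&` [set v | f v = 0] : set M)%classic (N : set M).
  by have [_ /=] := xP _ mx; rewrite fx => /eqP; rewrite oner_eq0.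
apply: ker_maximal => //; last first.
  by exists x => //; rewrite fx; apply/eqP/oner_neq0.
apply/submoduleP; have [[N0 ND NZ] [Ne Nx']] := (submoduleP N).1 sN.
split; first split=> [|u v [Nu fu] [Nv fv]|k u [Nu fu]].
- by split=> //=; exact: sform0.
- by split; [apply: ND|rewrite /= sformD fu fv addr0].
- by split; [apply: NZ|rewrite /= sformZ fu mulr0].
split=> [b u [Nu fu]|y u [Nu fu]]; split.
- exact: Ne.
- rewrite /= -fa vx_vx_act; case: eqP => [->|_]; [by rewrite fa|exact: sform0].
- exact: Nx'.
- by apply: fU; rewrite /U; apply: submodule_vx => //; apply: rad1_mem.
Qed.

Lemma radical_powE k : @radical_pow A^c M k = iter k rad1 setT.
Proof.
elim: k => //= k; rewrite /radical_pow /= => ->.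
exact/radicalE/submodule_rad1_iter.
Qed.

Lemma rad1_iter_le k l : (k <= l)%N ->
  (iter l rad1 (setT : set V) `<=` iter k rad1 setT)%classic.
Proof.
elim: l => [|l IH]; first by rewrite leqn0 => /eqP ->.
rewrite leq_eqVlt => /predU1P[-> //|]; rewrite ltnS => /IH kl v /= Rv.
by apply: kl; apply: (rad1_sub (submodule_rad1_iter l submoduleT)).
Qed.

Definition fdim : Prop := exists s : seq V, forall v, lspan s v.

Lemma composition_sub N P c : composition_series (N : set M) (P : set M) c ->
  (N `<=` P)%classic.
Proof.
elim: c N => [N -> //|L c IH] N /= [[_ _ [NL _] _] /IH]; exact: subset_trans.
Qed.

Lemma composition_cat N P L c d :
  composition_series (N : set M) (P : set M) c ->
  composition_series (P : set M) (L : set M) d ->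
  composition_series (N : set M) (L : set M) (c ++ d).
Proof. by elim: c N => [N ->//|X c IH] N /= [? ?] ?; split=> //; apply: IH. Qed.

Lemma composition_last N P c :
  composition_series (N : set M) (P : set M) c -> P = last N c.
Proof. by elim: c N => [N ->//|X c IH] N /= [_ /IH]. Qed.

Lemma composition_split N L c d :
  composition_series (N : set M) (L : set M) (c ++ d) ->
  composition_series (last N c : set M) (L : set M) d.
Proof. by elim: c N => [//|X c IH] N /= [_ /IH]. Qed.

(** The factors are one-dimensional, so a composition series amounts to a basis of [P] modulo [N],
    and length is dimension. *)
Lemma composition_span N P c : subspace N ->
  composition_series (N : set M) (P : set M) c ->
  exists s : seq V, [/\ size s = size c, freeN N s & P = spanN N s].
Proof.
elim: c N => [|L c IH] N sN /=; first by move=> ->; exists [::].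
move=> [/maximal_line[w Nw ->] cs].
have [s [sc Fs ->]] := IH _ (subspace_line_add w sN) cs.
exists (w :: s); split=> //=; first by rewrite sc.
by apply/seteqP; split=> v /(spanN_line w s v sN).
Qed.

(** Follow arrows from [v] as long as the image stays outside [N]; nilpotency ends this at a vector
    that is simple modulo [N]. *)
Lemma exists_simple N P : submodule (N : set M) -> submodule (P : set M) ->
  ~ (P `<=` N)%classic ->
  exists w a, [/\ P w, ~ N w, w <* e a = w & forall x, N (w <* ar x)].
Proof.
move=> sN sP /existsNP[v /not_implyP[Pv Nv]].
have [m mP] := mon_nilp adm bqa.
have : forall l, size l = m -> N (v <* mon l).
  by move=> l lm; rewrite mP ?lm // ract0r; case: sN.
elim: m {mP} v Pv Nv => [|m IH] v Pv Nv vm.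
  by case: Nv; rewrite -(ract1 v) -(mon_nil pi); apply: vm.
have [vx|/existsNP[x vx]] := pselect (forall x, N (v <* ar x)); last first.
  apply: (IH (v <* ar x)) => //; first exact: submodule_ar.
  by move=> l lm; rewrite -ract_mon_cons; apply: vm; rewrite /= lm.
have [a va] := exists_vx (submodule_subspace sN) Nv.
exists (v <* e a), a; split=> //; first exact: submodule_vx.
  by rewrite vx_vx_act eqxx.
by move=> x; rewrite vx_ar_act; case: eqP => // _; case: sN.
Qed.

Lemma composition_exists N P : fdim ->
  submodule (N : set M) -> submodule (P : set M) -> (N `<=` P)%classic ->
  exists c, composition_series (N : set M) (P : set M) c.
Proof.
move=> [s sP] sN sP' NP.
(* After [k] simple steps up from [N], either [P] is reached or [k] vectors independent modulo [N]
   have been found; [k = (size s).+1] is too many. *)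
suff [//|[t ts Ft]] : (exists c, composition_series (N : set M) (P : set M) c) \/
    exists2 t : seq V, size t = (size s).+1 & freeN N t.
  have : (size t <= size s)%N.
    apply: (free_le_span (submodule_subspace sN) Ft) => v _.
    apply: spanN_mono (sP v) => _ ->; by case: sN.
  by rewrite ts ltnn.
elim: (size s).+1 N sN NP => [|k IH] N sN NP; first by right; exists [::].
have [PN|PN] := pselect (P `<=` N)%classic.
  by left; exists [::]; apply/seteqP.
have [w [a [Pw Nw wa wx]]] := exists_simple sN sP' PN.
have mx := line_maximal sN wa Nw wx.
have sL : submodule (line_add N w : set M) by case: mx.
have [||[c cP]|[t ts Ft]] := IH (line_add N w).
- exact: sL.
- exact: line_sub.
- by left; exists (line_add N w :: c).
- by right; exists (w :: t) => //=; rewrite ts.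
Qed.

(** A series refined through [P] and one refined through [L] must coincide, so one of the two occurs
    before the other in it. *)
Lemma uniserial_comparable N P L : fdim ->
  submodule (N : set M) -> submodule (P : set M) -> submodule (L : set M) ->
  (N `<=` P)%classic -> (N `<=` L)%classic -> uniserial_quotient (N : set M) ->
  (P `<=` L)%classic \/ (L `<=` P)%classic.
Proof.
move=> fd sN sP sL NP NL [c [_ uc]].
have [c1 c1P] := composition_exists fd sN sP NP.
have [c2 c2P] := composition_exists fd sP submoduleT (@subsetT _ P).
have [d1 d1P] := composition_exists fd sN sL NL.
have [d2 d2P] := composition_exists fd sL submoduleT (@subsetT _ L).
have E : c1 ++ c2 = d1 ++ d2.
  rewrite -(uc _ (composition_cat c1P c2P)); exact: uc (composition_cat d1P d2P).
wlog le : c1 c2 d1 d2 P L sP sL NP NL c1P c2P d1P d2P E / (size c1 <= size d1)%N.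
  move=> H; have [le|/ltnW le] := leqP (size c1) (size d1).
    exact: (H c1 c2 d1 d2).
  by apply/or_comm; apply: (H d1 d2 c1 c2).
left; have d1E : d1 = c1 ++ drop (size c1) d1.
  rewrite -{1}(cat_take_drop (size c1) d1); congr (_ ++ _).
  by have := congr1 (take (size c1)) E; rewrite take_size_cat // takel_cat.
move: d1P; rewrite d1E => /composition_split/composition_sub.
by rewrite -(composition_last c1P).
Qed.

(** Two series start with minimal submodules above [N]; being comparable, these are equal, and
    induction continues from there. *)
Lemma comparable_uniserial N : fdim -> submodule (N : set M) ->
  (forall P L : set V, submodule (P : set M) -> submodule (L : set M) ->
    (N `<=` P)%classic -> (N `<=` L)%classic ->
    (P `<=` L)%classic \/ (L `<=` P)%classic) ->
  uniserial_quotient (N : set M).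
Proof.
move=> fd sN cmp.
have [c cP] := composition_exists fd sN submoduleT (@subsetT _ N).
exists c; split=> // d; elim: c d N sN cmp cP => [|L c IH] [|P d] N sN cmp //=.
- by move=> NT [[_ _ [_ +] _] _]; rewrite NT => /(_ (@subsetT _ P)).
- by move=> [[_ _ [_ NL] _] _] NT; case: NL; rewrite NT; exact: subsetT.
move=> [mL cL] [mP dP]; have LP : L = P.
  have [_ sL [NL NL'] mxL] := mL; have [_ sP [NP NP'] mxP] := mP.
  have [LP|PL] := cmp L P sL sP NL NP.
    by have [LN|//] := mxP _ sL NL LP; case: NL'; rewrite LN.
  by have [PN|->//] := mxL _ sP NP PL; case: NP'; rewrite PN.
rewrite -{}LP in dP *; congr (_ :: _).
have [_ sL [NL _] _] := mL; apply: IH sL _ cL dP => X Y sX sY LX LY.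
by apply: cmp => //; apply: subset_trans NL _.
Qed.

End ModuleTheory.

(** * Criteria for indecomposability and against uniseriality *)

Section Indecomposable.
Variables (K : fieldType) (Q : quiver) (I : set (path_algebra K Q)).
Variables (A : falgType K) (pi : {rmorphism path_algebra K Q -> A}).
Hypotheses (adm : admissible I) (bqa : is_bound_quiver_algebra I pi).
Variable M : lmodType A^c.

Local Notation V := (kmod M).
Local Notation e := (vx pi).
Local Notation ar := (ar pi).
Local Notation mon := (mon pi).
Local Notation stable := (stable pi).
Implicit Types (N P L : set V) (u v w : V) (f g : {scalar V}).

(** The span of [ns] and the common kernel of [fs] are complementary submodules, and the first is
    not zero. *)
Lemma split_span ns fs : indecomposable M -> (0 < size ns)%N ->
  triangular ns fs ->
  (forall a v, v \in ns -> lspan ns (v <* e a)) ->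
  (forall x v, v \in ns -> lspan ns (v <* ar x)) ->
  (forall a v, vanish fs v -> vanish fs (v <* e a)) ->
  (forall x v, vanish fs v -> vanish fs (v <* ar x)) ->
  forall v, lspan ns v.
Proof.
move=> [_ ind] ns0 tri Ne Nx Fe Fx.
have sN : subspace (lspan ns) by exact/subspace_spanN/subspace0.
have stN (g : {linear V -> V}) :
    (forall v, v \in ns -> lspan ns (g v)) -> forall v, lspan ns v -> lspan ns (g v).
  move=> gN; apply: (@spanN_min _ _ _ _ [set v | lspan ns (g v)]%classic).
  - have [N0 ND NZ] := sN; split=> [|u v|k u] /=; first by rewrite raddf0.
      by rewrite raddfD; apply: ND.
    by rewrite linearZ; apply: NZ.
  - by move=> _ -> /=; rewrite raddf0; case: sN.
  - exact: gN.
have mN : submodule (lspan ns : set M).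
  apply/(submoduleP bqa); split=> //; split=> [a|x] v.
    by apply: (stN (@ract K A M (e a))) => u; apply: Ne.
  by apply: (stN (@ract K A M (ar x))) => u; apply: Nx.
have mX : submodule ([set v | vanish fs v] : set M)%classic.
  apply/(submoduleP bqa); split; last by split.
  split=> [|u v|k u] /=.
  - by elim: fs {tri Fe Fx} => //= f fs ->; rewrite sform0 eqxx.
  - elim: fs {tri Fe Fx} => //= f fs IH /andP[/eqP fu us] /andP[/eqP fv vs].
    by rewrite sformD fu fv addr0 eqxx IH.
  - elim: fs {tri Fe Fx} => //= f fs IH /andP[/eqP fu us].
    by rewrite sformZ fu mulr0 eqxx IH.
have [||N0|X0] := ind _ _ mN mX.
- apply/seteqP; split=> [u [/= Nu Xu]|_ ->]; first exact: triangular_free tri Nu Xu.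
  by split; [case: mN|case: mX].
- move=> v; have [u Nu uX] := triangular_decomp (v : V) tri.
  by exists u, ((v : V) - u); split=> //; rewrite [LHS](_ : _ = u + (v - u)) // addrC subrK.
- case: ns fs ns0 tri {Ne Nx Fe Fx sN stN mN mX} N0 => [//|n ns] [//|f fs] _ [fn _ _] N0.
  have : lspan (n :: ns) n by apply: spanN_mem; [exact: subspace0|exact: mem_head].
  by rewrite N0 => n0; rewrite n0 sform0 eqxx in fn.
move=> v; have [u Nu uX] := triangular_decomp v tri.
suff -> : v = u by [].
by apply: subr0_eq; rewrite -[LHS]/((v - u : V) : M); move: uX; rewrite -[is_true _]/([set v | vanish fs v]%classic (v - u)) X0.
Qed.

Lemma simple_socle_indecomposable u : u != 0 ->
  (forall N v, submodule (N : set M) -> N v -> v != 0 -> N u) -> indecomposable M.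
Proof.
move=> u0 soc; split; first by exists u.
move=> N P sN sP NP0 _.
have [[v [Nv v0]]|Nn] := pselect (exists v : V, N v /\ v != 0); last first.
  left; apply/seteqP; split=> v; last by move=> ->; case: sN.
  by move=> Nv; apply: contrapT => /eqP v0; apply: Nn; exists v.
right; apply/seteqP; split=> w; last by move=> ->; case: sP.
move=> Pw; apply: contrapT => /eqP w0; move/eqP: u0; apply.
suff : (N `&` P)%classic u by rewrite NP0.
by split; [apply: soc Nv v0|apply: (soc P w)].
Qed.

(** One of the two components of [m] lies outside the kernel of [f]; the summand that holds it is
    all of [M], and the other one is zero. *)
Lemma local_indecomposable f m : f m <> 0 ->
  (forall N v, submodule (N : set M) -> N v -> f v <> 0 -> forall w, N w) ->
  indecomposable M.
Proof.
move=> fm loc; split; first by exists m; apply/eqP => m0; apply: fm; rewrite m0 sform0.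
move=> N P sN sP NP0 NP; have [y [z [Ny Pz mE]]] := NP m.
have [fy|fy] := pselect (f y = 0).
  left; have PT : forall w, P w.
    apply: (loc P z) => // fz; apply: fm; rewrite [m]mE.
    by rewrite -[LHS]/(f ((y : V) + (z : V))) sformD fy fz addr0.
  by rewrite -NP0; apply/seteqP; split=> [x Nx|x []].
right; have NT : forall w, N w by apply: (loc N y).
by rewrite -NP0; apply/seteqP; split=> [x Px|x []].
Qed.

(* The top of [M] has length at least two. *)
Definition wide_top : Prop := exists f g u w,
  [/\ forall x v, f (v <* ar x) = 0 /\ g (v <* ar x) = 0,
      forall a v, (f v = 0 -> f (v <* e a) = 0) /\ (g v = 0 -> g (v <* e a) = 0),
      f u = 0 /\ g u <> 0 & f w <> 0 /\ g w = 0].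

(* The top of the radical of [M] has length at least two. *)
Definition wide_radical : Prop := exists (h : {scalar V}) f g u w,
  [/\ forall x v, h (v <* ar x) = 0,
      forall x v, h v = 0 -> f (v <* ar x) = 0 /\ g (v <* ar x) = 0,
      forall a v, [/\ h v = 0 -> h (v <* e a) = 0, f v = 0 -> f (v <* e a) = 0
                     & g v = 0 -> g (v <* e a) = 0],
      [/\ h u = 0, f u = 0 & g u <> 0] & [/\ h w = 0, f w <> 0 & g w = 0]].

Lemma submodule_form (P : V -> Prop) f :
  (forall u v, P u -> P v -> P (u + v)) -> (forall k u, P u -> P (k *: u)) ->
  P 0 -> (forall x v, P v -> P (v <* ar x)) -> (forall a v, P v -> P (v <* e a)) ->
  (forall x v, P v -> f (v <* ar x) = 0) ->
  (forall a v, f v = 0 -> f (v <* e a) = 0) ->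
  submodule ([set v : V | P v /\ f v = 0] : set M)%classic.
Proof.
move=> PD PZ P0 Px Pe fx fe; apply/(submoduleP bqa); split; split.
- by split=> //; exact: sform0.
- move=> u v [Pu fu] [Pv fv]; split; first exact: PD.
  by rewrite sformD fu fv addr0.
- by move=> k u [Pu fu]; split; [exact: PZ|rewrite sformZ fu mulr0].
- by move=> a v [Pv fv]; split; [exact: Pe|exact: fe].
- by move=> x v [Pv fv]; split; [exact: Px|exact: fx].
Qed.

Lemma submodule_ker f : (forall x v, f (v <* ar x) = 0) ->
  (forall a v, f v = 0 -> f (v <* e a) = 0) ->
  submodule ([set v : V | f v = 0] : set M)%classic.
Proof.
move=> fx fe.
have -> : [set v | f v = 0]%classic = [set v | True /\ f v = 0]%classic.
  by apply/seteqP; split=> v //= [].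
by apply: submodule_form => // x v _; apply: fx.
Qed.

Lemma incomparable_not_uniserial N P L u w : fdim M ->
  submodule (N : set M) -> submodule (P : set M) -> submodule (L : set M) ->
  (N `<=` P)%classic -> (N `<=` L)%classic ->
  P u -> ~ L u -> L w -> ~ P w -> ~ uniserial_quotient (N : set M).
Proof.
move=> fd sN sP sL NP NL Pu Lu Lw Pw uni.
have [PL|LP] := uniserial_comparable adm bqa fd sN sP sL NP NL uni.
  by case: Lu; apply: PL.
by case: Pw; apply: LP.
Qed.

Lemma submodule_radical_pow k : submodule (@radical_pow A^c M k).
Proof.
by rewrite (radical_powE adm bqa); apply: (submodule_rad1_iter bqa k (submoduleT M)).
Qed.

(** The kernels of [f] and [g] are incomparable, and both contain the radical, hence all its powers
    [rad^(k+1)]. *)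
Lemma wide_top_not_uniserial k : fdim M -> wide_top ->
  ~ uniserial_quotient (@radical_pow A^c M k.+1).
Proof.
move=> fd [f [g [u [w [fgx fge [fu gu] [fw gw]]]]]].
have sf : submodule ([set v : V | f v = 0] : set M)%classic.
  apply: submodule_ker => [x v|a v fv]; first by case: (fgx x v).
  by case: (fge a v) => + _; apply.
have sg : submodule ([set v : V | g v = 0] : set M)%classic.
  apply: submodule_ker => [x v|a v fv]; first by case: (fgx x v).
  by case: (fge a v) => _; apply.
have rad N : submodule (N : set M) -> (forall x v, N (v <* ar x)) ->
    (@radical_pow A^c M k.+1 `<=` N)%classic.
  move=> sN Nx; rewrite (radical_powE adm bqa).
  by apply: (rad1_min bqa) => // x v _; apply: Nx.
apply: (incomparable_not_uniserial fd _ sf sg (rad _ sf _) (rad _ sg _) fu gu gw fw).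
- exact: submodule_radical_pow.
- by move=> x v; case: (fgx x v).
- by move=> x v; case: (fgx x v).
Qed.

(** Inside the kernel of [h], the kernels of [f] and [g] are incomparable submodules, and both
    contain [rad^2]. *)
Lemma wide_radical_not_uniserial k : fdim M -> wide_radical ->
  ~ uniserial_quotient (@radical_pow A^c M k.+2).
Proof.
move=> fd [h [f [g [u [w [hx fgx hfge [hu fu gu] [hw fw gw]]]]]]].
have sh : submodule ([set v : V | h v = 0] : set M)%classic.
  by apply: submodule_ker => [x v|a v hv]; [apply: hx|case: (hfge a v) => + _ _; apply].
have sP (r : {scalar V}) : (forall x v, h v = 0 -> r (v <* ar x) = 0) ->
    (forall a v, r v = 0 -> r (v <* e a) = 0) ->
    submodule ([set v : V | h v = 0 /\ r v = 0] : set M)%classic.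
  move=> rx re; apply: submodule_form => //.
  - by move=> x y hx' hy; rewrite sformD hx' hy addr0.
  - by move=> l x hx'; rewrite sformZ hx' mulr0.
  - exact: sform0.
  - by move=> a v hv; case: (hfge a v) => + _ _; apply.
have sf := sP f (fun x v hv => (fgx x v hv).1) (fun a v => let: And3 _ p _ := hfge a v in p).
have sg := sP g (fun x v hv => (fgx x v hv).2) (fun a v => let: And3 _ _ p := hfge a v in p).
have rad N : submodule (N : set M) -> (forall x v, h v = 0 -> N (v <* ar x)) ->
    (@radical_pow A^c M k.+2 `<=` N)%classic.
  move=> sN Nx; rewrite (radical_powE adm bqa).
  apply: (rad1_min bqa) => // x v Rv; apply: Nx.
  exact: (rad1_min bqa sh (fun x v _ => hx x v) Rv).
apply: (incomparable_not_uniserial (u := u) (w := w) fd _ sf sg (rad _ sf _) (rad _ sg _)).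
- exact: submodule_radical_pow.
- by move=> x v hv; split; [exact: hx|case: (fgx x v hv)].
- by move=> x v hv; split; [exact: hx|case: (fgx x v hv)].
- by [].
- by case.
- by [].
- by case.
Qed.

Lemma wide_top_nonzero : fdim M -> wide_top -> ~ uniserial M.
Proof.
move=> fd [f [g [u [w [fgx fge [fu gu] [fw gw]]]]]].
apply: (@incomparable_not_uniserial [set 0] [set v : V | f v = 0]%classic
  [set v : V | g v = 0]%classic u w) => //.
- exact: submodule0.
- apply: submodule_ker => [x v|a v fv]; first by case: (fgx x v).
  by case: (fge a v) => + _; apply.
- apply: submodule_ker => [x v|a v fv]; first by case: (fgx x v).
  by case: (fge a v) => _; apply.
- by move=> _ ->; exact: sform0.
- by move=> _ ->; exact: sform0.
Qed.

Lemma wide_radical_nonzero : fdim M -> wide_radical -> ~ uniserial M.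
Proof.
move=> fd wr; suff [k R0] : exists k, @radical_pow A^c M k.+2 = [set 0]%classic.
  by rewrite /uniserial -R0; apply: wide_radical_not_uniserial.
have [m mP] := rad1_nilp adm bqa M; exists m.
apply/seteqP; split=> [v|_ ->]; last first.
  by case: (submodule_radical_pow m.+2).
rewrite (radical_powE adm bqa) => Rv; apply: mP.
by apply: (rad1_iter_le bqa (k := m)) Rv; rewrite -addn2 leq_addr.
Qed.

Lemma uniserial_quotientT : uniserial_quotient (setT : set M).
Proof.
exists [::]; split=> // -[//|L c] /= [[_ _ [_ NL] _] _].
by case: NL.
Qed.

(** Type equals length: the quotient by [rad^0(M) = M] is zero, hence uniserial, and the quotient by
    [rad^1] is not uniserial. *)
Lemma top2_factor_serial l : fdim M -> has_length M l.+2 -> wide_top ->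
  factor_serial M l.+2.
Proof.
move=> fd len wt; split; first exact: wide_top_nonzero.
exists l.+2; split=> //; rewrite subnn; first exact: uniserial_quotientT.
exact: wide_top_not_uniserial.
Qed.

(** Type is length minus one: the quotient by [rad^1] is uniserial, the quotient by [rad^2] is
    not. *)
Lemma rad2_factor_serial l : fdim M -> has_length M l.+3 -> wide_radical ->
  uniserial_quotient (@radical_pow A^c M 1) -> factor_serial M l.+2.
Proof.
move=> fd len wr uni; split; first exact: wide_radical_nonzero.
exists l.+3; split=> //; rewrite subSnn //.
exact: wide_radical_not_uniserial.
Qed.

Lemma local_uniserial_radical f m : fdim M -> f m <> 0 ->
  (forall x v, f (v <* ar x) = 0) ->
  (forall v, f v = 0 -> @radical_pow A^c M 1 v) ->
  uniserial_quotient (@radical_pow A^c M 1).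
Proof.
move=> fd /eqP fm fx fR; apply: (comparable_uniserial adm bqa) => //.
  exact: submodule_radical_pow.
have all P : submodule (P : set M) -> (@radical_pow A^c M 1 `<=` P)%classic ->
    (exists2 v, P v & f v <> 0) -> forall w, P w.
  move=> sP RP [v Pv /eqP fv] w; have sP' := submodule_subspace bqa sP.
  apply: (subspaceK sP' (v := (f w / f v) *: v)); first by case: sP' => _ _; apply.
  by apply/RP/fR; rewrite sformB sformZ divfK // subrr.
move=> P L sP sL RP RL.
have [nP|/existsNP[v /not_implyP[Pv fv]]] := pselect (forall v, P v -> f v = 0).
  by left=> v /nP/fR/RL.
by right=> w _; apply: (all P) => //; exists v.
Qed.

End Indecomposable.

(** * Diagrams *)

(* [(i, x, k, j)] records that the arrow [x] adds [k] times the [j]-th basis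
   vector to the image of the [i]-th one. *)
Definition link (K : fieldType) (Q : quiver) : Type := (nat * arr Q * K * nat)%type.

Record diagram (K : fieldType) (Q : quiver) := Diagram {
  sdim : nat;
  slab : nat -> vert Q;
  slinks : seq (link K Q)
}.

Section Shapes.
Variables (K : fieldType) (Q : quiver) (I : set (path_algebra K Q)).
Variables (A : falgType K) (pi : {rmorphism path_algebra K Q -> A}).
Hypotheses (adm : admissible I) (bqa : is_bound_quiver_algebra I pi).

Local Notation e := (vx pi).
Local Notation ar := (ar pi).
Local Notation mon := (mon pi).
Local Notation link := (link K Q).
Local Notation diagram := (diagram K Q).
Implicit Types (S : diagram) (t : link).

Definition lsrc t : nat := t.1.1.1.
Definition larr t : arr Q := t.1.1.2.
Definition lcoef t : K := t.1.2.
Definition ltgt t : nat := t.2.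

Section Basis.
Variable M : lmodType A^c.
Local Notation V := (kmod M).
Implicit Types (u v w : V).

(** [b] is a basis with dual basis [c]. The links are read on the coordinates, since submodules are
    cut out by forms and equalities are tested by them. *)
Record shaped S (b : nat -> V) (c : nat -> {scalar V}) : Prop := Shaped {
  shaped_dual : forall i j, (i < sdim S)%N -> (j < sdim S)%N -> c i (b j) = (i == j)%:R;
  shaped_sum : forall v, v = \sum_(i < sdim S) c i v *: b i;
  shaped_vx : forall i v a, (i < sdim S)%N ->
    c i (v <* e a) = if a == slab S i then c i v else 0;
  shaped_ar : forall i v x, (i < sdim S)%N ->
    c i (v <* ar x) =
    \sum_(t <- slinks S | (larr t == x) && (ltgt t == i)) lcoef t * c (lsrc t) v
}.

Definition wf_diagram S : Prop := forall t, t \in slinks S ->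
  [/\ (lsrc t < sdim S)%N, (ltgt t < sdim S)%N,
      slab S (lsrc t) = src (larr t) & slab S (ltgt t) = tgt (larr t)].

Section Shaped.
Variables (S : diagram) (b : nat -> V) (c : nat -> {scalar V}).
Hypothesis Sbc : shaped S b c.

Lemma shaped_ext u v : (forall i, (i < sdim S)%N -> c i u = c i v) -> u = v.
Proof.
move=> uv; rewrite (shaped_sum Sbc u) (shaped_sum Sbc v).
by apply: eq_bigr => i _; rewrite uv.
Qed.

Lemma shaped_span v : lspan (mkseq b (sdim S)) v.
Proof.
apply/lspanE; exists (fun i => c i v); rewrite size_mkseq [LHS](shaped_sum Sbc).
by apply: eq_bigr => i _; rewrite nth_mkseq.
Qed.

Lemma shaped_fdim : fdim M.
Proof. by exists (mkseq b (sdim S)); apply: shaped_span. Qed.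

Lemma shaped_fg : finitely_generated M.
Proof.
exists (sdim S), (fun i => b i) => v.
by exists (fun i => (c i (v : V))%:A); exact: (shaped_sum Sbc v).
Qed.

Lemma dual_free (N : set V) (s : seq V) (d : nat -> {scalar V}) :
  (forall i j, (i < size s)%N -> (j < size s)%N -> d i s`_j = (i == j)%:R) ->
  (forall i u, (i < size s)%N -> N u -> d i u = 0) -> freeN N s.
Proof.
elim: s N d => [//|v s IH] N d ds dN /=; split.
  move=> Nv; have := ds 0%N 0%N isT isT; rewrite dN //= => /esym/eqP.
  by rewrite oner_eq0.
apply: (IH _ (fun i => d i.+1)) => [i j si sj|i u si [k Nu]].
  by rewrite (ds i.+1 j.+1).
have := dN i.+1 _ si Nu; rewrite sformB sformZ -[v]/((v :: s)`_0).
by rewrite (ds i.+1 0%N) // mulr0 subr0.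
Qed.

Lemma shaped_free : freeN [set 0] (mkseq b (sdim S)).
Proof.
apply: (dual_free (d := c)) => [i j|i _ _ ->]; last exact: sform0.
by rewrite size_mkseq => si sj; rewrite nth_mkseq // (shaped_dual Sbc).
Qed.

Lemma shaped_dim_le (s : seq V) : (forall v, lspan s v) -> (sdim S <= size s)%N.
Proof.
move=> sP; rewrite -(size_mkseq b (sdim S)).
by apply: (free_le_span (@subspace0 K V) shaped_free) => v _; exact: sP.
Qed.

Lemma shaped_length l : has_length M l -> l = sdim S.
Proof.
case=> cs csP <-; have [s [<- Fs sT]] := composition_span adm bqa (@subspace0 K V) csP.
have sP v : lspan s v by rewrite /lspan -sT.
apply/eqP; rewrite eqn_leq shaped_dim_le // andbT -(size_mkseq b (sdim S)).
by apply: (free_le_span (@subspace0 K V) Fs) => v _; apply: shaped_span.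
Qed.

Lemma shaped_b_ar i x : (i < sdim S)%N -> wf_diagram S ->
  b i <* ar x = \sum_(t <- slinks S | (larr t == x) && (lsrc t == i)) lcoef t *: b (ltgt t).
Proof.
move=> si wf; apply: shaped_ext => j sj; rewrite (shaped_ar Sbc) // sform_sum.
rewrite [LHS]big_mkcond [RHS]big_mkcond; apply: eq_big_seq => t /wf[lt rt _ _].
case: eqP => _ //=; rewrite !sformZ !(shaped_dual Sbc) // [j == _]eq_sym.
case: (eqVneq (ltgt t) j) => _; case: (eqVneq (lsrc t) i) => _ //;
by rewrite ?mulr0.
Qed.

(** Links increase the index, so the vectors whose first [n - r] coordinates vanish form a submodule
    [F r]; each [F r] has codimension one in [F r.+1]. *)
Lemma shaped_has_length :
  (forall t, t \in slinks S -> (lsrc t < ltgt t)%N) -> has_length M (sdim S).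
Proof.
move=> up; pose n := sdim S.
pose F r : set V := (fun v => forall i, (i < n - r)%N -> c i v = 0).
have sF r : submodule (F r : set M).
  have lt i : (i < n - r)%N -> (i < n)%N by move=> /leq_trans; apply; apply: leq_subr.
  apply/(submoduleP bqa); split; first exact: (subspace_bigker c).
  split=> [a|x] v Fv i ir.
    by rewrite (shaped_vx Sbc) ?lt // Fv // if_same.
  rewrite (shaped_ar Sbc) ?lt // big_seq_cond big1 // => t.
  move=> /andP[/up ts /andP[_ /eqP ti]]; rewrite Fv ?mulr0 // (ltn_trans ts) //.
  by rewrite ti.
have step r : (r < n)%N -> maximal_submodule (F r : set M) (F r.+1 : set M).
  move=> rn; have lt : (n - r.+1 < n)%N by rewrite ltn_subrL (leq_trans _ rn).
  have FE : F r = (F r.+1 `&` [set v | c (n - r.+1)%N v = 0])%classic.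
    apply/seteqP; split=> v.
      move=> Fv; split=> [i ir|] /=; apply: Fv; last by rewrite ltn_sub2l.
      by apply: leq_trans ir _; rewrite leq_sub2l.
    move=> [Fv /= cv] i; rewrite -(subnSK rn) ltnS leq_eqVlt.
    by move=> /predU1P[->|]; [exact: cv|exact: Fv].
  rewrite FE; apply: (ker_maximal bqa) => //; first by rewrite -FE.
  exists (b (n - r.+1)%N); last first.
    by rewrite (shaped_dual Sbc) // eqxx; apply/eqP/oner_neq0.
  move=> i ir; rewrite (shaped_dual Sbc) ?(ltn_trans ir) //.
  by rewrite (ltn_eqF ir).
have comp r : (r <= n)%N ->
    composition_series (F r : set M) (setT : set M)
      [seq (F i : set M) | i <- iota r.+1 (n - r)].
  move=> rn; rewrite -(subKn rn); elim: (n - r)%N (leq_subr r n) => {r rn}[|r IH] rn.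
    by rewrite subn0 subnn /=; apply/seteqP; split=> // v _ i; rewrite subnn.
  have E : (n - r.+1).+1 = (n - r)%N by rewrite subnSK.
  rewrite (subKn rn) /= E; split.
    by rewrite -E; apply: step; rewrite ltn_subrL (leq_trans _ rn).
  by have := IH (ltnW rn); rewrite (subKn (ltnW rn)) -E.
exists [seq (F i : set M) | i <- iota 1 n]; last by rewrite size_map size_iota.
have -> : [set 0 : M]%classic = F 0.
  apply/seteqP; split=> [_ -> i _|v Fv]; first exact: sform0.
  by apply: shaped_ext => i si; rewrite sform0 Fv // subn0.
by have := comp 0%N isT; rewrite subn0.
Qed.

End Shaped.

Definition has_diagram S : Prop := exists b c, shaped S b c.

Lemma triangular_shaped S (s : seq V) fs : size s = sdim S -> wf_diagram S ->
  triangular s fs -> (forall v, lspan s v) ->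
  (forall i a, (i < sdim S)%N -> s`_i <* e a = if a == slab S i then s`_i else 0) ->
  (forall i x, (i < sdim S)%N -> s`_i <* ar x =
     \sum_(t <- slinks S | (larr t == x) && (lsrc t == i)) lcoef t *: s`_(ltgt t)) ->
  exists c, shaped S (fun i => s`_i) c.
Proof.
move=> sS wf tri sP sv sa; have [c cP] := triangular_dual tri.
rewrite sS in cP.
have sumE v : v = \sum_(i < sdim S) c i v *: s`_i.
  have [d dE] := (lspanE s v).1 (sP v); rewrite sS in dE.
  rewrite {1}dE; apply: eq_bigr => i _; congr (_ *: _).
  rewrite dE sform_sum (bigD1 i) //= sformZ cP // eqxx mulr1 big1 ?addr0 //.
  by move=> j ji; rewrite sformZ cP // [i == j :> nat]eq_sym [j == i :> nat](negPf ji) mulr0.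
exists c; split=> // [i v a si|i v x si].
  rewrite {1}(sumE v) ract_suml sform_sum.
  rewrite (bigD1 (Ordinal si)) //= big1 ?addr0 => [|j ji].
    by rewrite ractZl sv // sformZ; case: ifP => _; rewrite ?sform0 ?mulr0 // cP // eqxx mulr1.
  rewrite ractZl sformZ sv //; case: ifP => _; last by rewrite sform0 mulr0.
  rewrite cP // [i == j :> nat](_ : _ = false) ?mulr0 //.
  by apply: contraNF ji => /eqP ij; apply/eqP/val_inj.
rewrite {1}(sumE v) ract_suml sform_sum.
under eq_bigr => j _.
  rewrite ractZl sformZ sa // sform_sum mulr_sumr big_mkcond /=.
  under eq_bigr => t _ do rewrite sformZ.
  over.
rewrite exchange_big /= [RHS]big_mkcond /=; apply: eq_big_seq => t /wf[lt rt _ _].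
case: eqP => _ /=; last by rewrite big1.
rewrite -big_mkcond /= (big_pred1 (Ordinal lt)) => [|j]; last first.
  by rewrite /= -val_eqE /= eq_sym.
rewrite /= cP // [i == _]eq_sym; case: eqP => _; last by rewrite !mulr0.
by rewrite mulr1 mulrC.
Qed.

End Basis.

(** The map that preserves coordinates commutes with vertices and arrows, because the diagram
    prescribes their action, and these generate the algebra. *)
Lemma diagram_iso S (M N : lmodType A^c) : wf_diagram S ->
  has_diagram M S -> has_diagram N S -> module_iso M N.
Proof.
move=> wf [b [c Sbc]] [b' [c' Sbc']].
have trans (M1 N1 : lmodType A^c) b1 c1 b2 c2 : shaped (M := M1) S b1 c1 ->
    shaped (M := N1) S b2 c2 ->
    exists f : kmod M1 -> kmod N1,
      [/\ forall v i, (i < sdim S)%N -> c2 i (f v) = c1 i v,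
          forall u v, f (u + v) = f u + f v & forall a v, f (v <* a) = f v <* a].
  move=> S1 S2; pose f (v : kmod M1) : kmod N1 := \sum_(i < sdim S) c1 i v *: b2 i.
  have cf v i : (i < sdim S)%N -> c2 i (f v) = c1 i v.
    move=> si; rewrite sform_sum (bigD1 (Ordinal si)) //= sformZ (shaped_dual S2) //.
    rewrite eqxx mulr1 big1 ?addr0 // => j ji.
    rewrite sformZ (shaped_dual S2) // [i == j :> nat](_ : _ = false) ?mulr0 //.
    by apply: contraNF ji => /eqP ij; apply/eqP/val_inj.
  exists f; split=> // [u v|]; first by
    apply: (shaped_ext S2) => i si; rewrite sformD !cf // sformD.
  apply: (alg_ind bqa) => [a a' Pa Pa' v|k a Pa v|a a' Pa Pa' v|a v|x v].
  - rewrite !ractDr -Pa -Pa'; apply: (shaped_ext S2) => i si.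
    by rewrite sformD !cf // sformD.
  - rewrite !ractZr -Pa; apply: (shaped_ext S2) => i si.
    by rewrite sformZ !cf // sformZ.
  - by rewrite -!ractM Pa' Pa.
  - by apply: (shaped_ext S2) => i si; rewrite cf // (shaped_vx S1) // (shaped_vx S2) // cf.
  - apply: (shaped_ext S2) => i si; rewrite cf // (shaped_ar S1) // (shaped_ar S2) //.
    rewrite big_seq_cond [RHS]big_seq_cond; apply: eq_bigr => t /andP[/wf[lt _ _ _] _].
    by rewrite cf.
have [f [cf fD fA]] := trans _ _ _ _ _ _ Sbc Sbc'.
have [g [cg _ _]] := trans _ _ _ _ _ _ Sbc' Sbc.
have fL : linear (f : M -> N).
  move=> a u v; rewrite -[LHS]/(f ((u : kmod M) <* a + (v : kmod M))).
  by rewrite fD fA.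
pose fl : {linear M -> N} := HB.pack (f : M -> N) (GRing.isLinear.Build A^c M N *:%R f fL).
exists fl; exists g => v.
  by apply: (shaped_ext Sbc) => i si; rewrite cg // cf.
by apply: (shaped_ext Sbc') => i si; rewrite cf // cg.
Qed.

End Shapes.

(** * Realization of diagrams by matrices *)

Section MatrixModule.
Variables (K : fieldType) (A : falgType K) (n : nat) (rho : A -> 'M[K]_n).

Definition matrix_representation : Prop :=
  [/\ forall a b, rho (a + b) = rho a + rho b, forall k a, rho (k *: a) = k *: rho a,
      rho 1 = 1%:M & forall a b, rho (a * b) = rho a *m rho b].

(** The type depends on the proof so that the row vectors can carry a different module structure for
    each representation. *)
Definition matrix_module (_ : matrix_representation) : Type := 'rV[K]_n.

Variable rhoP : matrix_representation.
Local Notation T := (matrix_module rhoP).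

HB.instance Definition _ := GRing.Zmodule.copy T 'rV[K]_n.

Definition matrix_scale (a : A^c) (v : T) : T := (v : 'rV[K]_n) *m rho a.

Lemma matrix_scaleA a b x :
  matrix_scale a (matrix_scale b x) = matrix_scale (a * b) x.
Proof. have [_ _ _ rM] := rhoP; by rewrite /matrix_scale -mulmxA -rM. Qed.

Lemma matrix_scale1 : left_id 1 matrix_scale.
Proof. have [_ _ r1 _] := rhoP => x; by rewrite /matrix_scale r1 mulmx1. Qed.

Lemma matrix_scaleDr : right_distributive matrix_scale +%R.
Proof. by move=> c x y; exact: mulmxDl. Qed.

Lemma matrix_scaleDl x : {morph matrix_scale^~ x : a b / a + b}.
Proof. have [rD _ _ _] := rhoP => a b; by rewrite /matrix_scale rD; exact: mulmxDr. Qed.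

HB.instance Definition _ := GRing.Zmodule_isLmodule.Build A^c T
  matrix_scaleA matrix_scale1 matrix_scaleDr matrix_scaleDl.

End MatrixModule.

Section Realization.
Variables (K : fieldType) (Q : quiver) (I : set (path_algebra K Q)).
Variables (A : falgType K) (pi : {rmorphism path_algebra K Q -> A}).
Hypotheses (adm : admissible I) (bqa : is_bound_quiver_algebra I pi).

Local Notation KQ := (path_algebra K Q).
Local Notation diagram := (diagram K Q).

(** No element of [I] involves such a path, whatever the number of its terms. *)
Definition isolated (l : seq (arr Q)) : Prop :=
  forall p f, parr p = l -> I f -> mcoeff p f = 0.

Variable S : diagram.
Hypothesis wf : wf_diagram S.
Hypothesis links_isolated : forall t t', t \in slinks S -> t' \in slinks S ->
  ltgt t = lsrc t' -> isolated [:: larr t; larr t'].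
Hypothesis links_short : forall t t' t'', t \in slinks S -> t' \in slinks S ->
  t'' \in slinks S -> ltgt t = lsrc t' -> ltgt t' = lsrc t'' -> False.

Local Notation n := (sdim S).

Definition vmx (a : vert Q) : 'M[K]_n :=
  \matrix_(i, j) ((i == j) && (slab S i == a))%:R.

Definition amx (x : arr Q) : 'M[K]_n :=
  \matrix_(i, j) \sum_(t <- slinks S | [&& larr t == x, lsrc t == i & ltgt t == j]) lcoef t.

Lemma vmxE a (B : 'M[K]_n) i j : (vmx a *m B) i j = if slab S i == a then B i j else 0.
Proof.
rewrite mxE (bigD1 i) //= big1 ?addr0 => [|k ki].
  by rewrite mxE eqxx /=; case: eqP => _; rewrite ?mul1r ?mul0r.
by rewrite mxE eq_sym (negPf ki) mul0r.
Qed.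

Lemma mxvE a (B : 'M[K]_n) i j : (B *m vmx a) i j = if slab S j == a then B i j else 0.
Proof.
rewrite mxE (bigD1 j) //= big1 ?addr0 => [|k ki].
  by rewrite mxE eqxx /=; case: eqP => _; rewrite ?mulr1 ?mulr0.
by rewrite mxE (negPf ki) mulr0.
Qed.

Lemma amx_link x (i j : 'I_n) : amx x i j != 0 ->
  exists t, [/\ t \in slinks S, larr t = x, lsrc t = i & ltgt t = j].
Proof.
rewrite mxE; apply: contraNP => nt; rewrite big_seq_cond big1 // => t.
by case/andP=> tS /and3P[/eqP ? /eqP ? /eqP ?]; case: nt; exists t.
Qed.

Lemma vmx_amx a x : vmx a *m amx x = if a == src x then amx x else 0.
Proof.
apply/matrixP => i j; rewrite vmxE.
have [xij|/amx_link[t [/wf[_ _ si _] tx ti _]]] := eqVneq (amx x i j) 0.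
  by rewrite xij if_same; case: ifP => _; rewrite ?xij // mxE.
by rewrite -ti si tx eq_sym; case: ifP => _; rewrite ?mxE.
Qed.

Lemma amx_vmx a x : amx x *m vmx a = if a == tgt x then amx x else 0.
Proof.
apply/matrixP => i j; rewrite mxvE.
have [xij|/amx_link[t [/wf[_ _ _ sj] tx _ tj]]] := eqVneq (amx x i j) 0.
  by rewrite xij if_same; case: ifP => _; rewrite ?xij // mxE.
by rewrite -tj sj tx eq_sym; case: ifP => _; rewrite ?mxE.
Qed.

Lemma vmx_vmx a b : vmx a *m vmx b = if a == b then vmx a else 0.
Proof.
apply/matrixP => i j; rewrite vmxE; case: (eqVneq a b) => [<-|ab]; rewrite !mxE.
  by case: eqP => //; rewrite andbF.
have [ia|] := eqVneq (slab S i) a; last by [].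
by rewrite ia (negPf ab) andbF.
Qed.

Definition lmx (l : seq (arr Q)) : 'M[K]_n := foldr (fun x B => amx x *m B) 1%:M l.

Lemma lmx_cat l l' : lmx (l ++ l') = lmx l *m lmx l'.
Proof. by elim: l => [|x l IH] /=; rewrite ?mul1mx // IH mulmxA. Qed.

Definition pmx (p : qpath Q) : 'M[K]_n := vmx (psrc p) *m lmx (parr p).

Lemma pmx_tgt a l b : chain a l ->
  vmx a *m lmx l *m vmx b = if b == chain_end a l then vmx a *m lmx l else 0.
Proof.
elim: l a => [|x l IH] a /=.
  by rewrite mulmx1 vmx_vmx eq_sym.
move=> /andP[/eqP xa lc]; rewrite mulmxA vmx_amx -xa eqxx.
have -> : amx x = amx x *m vmx (tgt x) by rewrite amx_vmx eqxx.
rewrite -!mulmxA [vmx _ *m (_ *m _)]mulmxA IH // /chain_end /=.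
by case: eqP => _; rewrite ?mulmx0.
Qed.

Lemma pmxM p q :
  pmx p *m pmx q = if pcat p q is Some r then pmx r else 0.
Proof.
rewrite {2}/pmx mulmxA (pmx_tgt _ (qpathP p)) -/(ptgt p).
have [qp|qp] := eqVneq (psrc q) (ptgt p); last first.
  by rewrite pcatN ?mul0mx // eq_sym.
have [r -> rE] := pcatE (esym qp).
by rewrite /pmx [psrc r]/psrc [parr r]/parr rE /= lmx_cat mulmxA.
Qed.

(** An element of [I] acts by zero term by term: admissibility removes paths of length at most one,
    isolation the paths of length two along the links, and all other paths have zero matrices. *)
Lemma pmx_isolated p f : I f -> mcoeff p f *: pmx p = 0.
Proof.
move=> If; have [p1|p1] := leqP (plength p) 1.
  by rewrite (short_coef adm p1 If) scale0r.
have [->|p0] := eqVneq (pmx p) 0; first by rewrite scaler0.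
suff -> : mcoeff p f = 0 by rewrite scale0r.
have link x (B : 'M[K]_n) i j : (amx x *m B) i j != 0 ->
    exists t, [/\ t \in slinks S, larr t = x, lsrc t = i &
      exists2 k : 'I_n, ltgt t = k & B k j != 0].
  rewrite mxE; apply: contraNP => nt; rewrite big1 // => k _.
  have [->|/amx_link[t [tS tx ti tk]]] := eqVneq (amx x i k) 0; first by rewrite mul0r.
  have [->|Bk] := eqVneq (B k j) 0; first by rewrite mulr0.
  by case: nt; exists t; split=> //; exists k.
have {p0} : lmx (parr p) != 0 by apply: contraNneq p0 => l0; rewrite /pmx l0 mulmx0.
move pl : (parr p) (p1) => l; rewrite /plength pl.
case: l pl => [|x [|y l]] pl //= _ l0.
have [i [j /link[t [tS tx _ [k tk]]]]] : exists i j, lmx [:: x, y & l] i j != 0.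
  apply: contrapT => /forallNP nz; move/eqP: l0; apply; apply/matrixP => i j.
  by rewrite [RHS]mxE; apply: contrapT => /eqP ij; apply: (nz i); exists j.
move=> /link[t' [t'S ty t'k [k' t'k']]].
case: l pl {l0} => [|z l] pl; last first.
  move=> /link[t'' [t''S _ t''k _]].
  by have := links_short tS t'S t''S; rewrite tk t'k t'k' t''k => /(_ erefl erefl).
move=> _; apply: (links_isolated tS t'S) If; first by rewrite tk t'k.
by rewrite pl tx ty.
Qed.

Definition kqmx (f : KQ) : 'M[K]_n := \sum_(p <- msupp f) mcoeff p f *: pmx p.

Lemma kqmxw (d : {fset qpath Q}) f : fsubset (msupp f) d ->
  kqmx f = \sum_(p <- d) mcoeff p f *: pmx p.
Proof.
move=> le; rewrite /kqmx (big_fset_incl _ le) // => p _.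
by move=> /mcoeff_outdom ->; rewrite scale0r.
Qed.

Lemma kqmxD f g : kqmx (f + g) = kqmx f + kqmx g.
Proof.
rewrite (kqmxw (msuppD_le f g)) (kqmxw (fsubsetUl (msupp f) (msupp g))).
rewrite (kqmxw (fsubsetUr (msupp f) (msupp g))) -big_split /=.
by apply: eq_bigr => p _; rewrite mcoeffD scalerDl.
Qed.

Lemma kqmxZ k f : kqmx (k *: f) = k *: kqmx f.
Proof.
rewrite (kqmxw (msupp_pa_scale k f)) /kqmx scaler_sumr.
by apply: eq_bigr => p _; rewrite mcoeff_pa_scale scalerA.
Qed.

Lemma kqmx0 : kqmx 0 = 0.
Proof. by rewrite -(scale0r (0 : KQ)) kqmxZ scale0r. Qed.

Lemma kqmx_path p : kqmx (path_elt K p) = pmx p.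
Proof.
rewrite (@kqmxw [fset p]%fset); last by rewrite path_elt.unlock msuppU_le.
by rewrite big_seq_fset1 path_elt.unlock mcoeffUU scale1r.
Qed.

Lemma kqmx_sum (J : Type) (r : seq J) (F : J -> KQ) :
  kqmx (\sum_(i <- r) F i) = \sum_(i <- r) kqmx (F i).
Proof. exact: (big_morph kqmx kqmxD kqmx0). Qed.

Lemma kqmxM f g : kqmx (f * g) = kqmx f *m kqmx g.
Proof.
elim/pa_ind: f => [|f f' IH IH'|k f IH|p].
- by rewrite mul0r kqmx0 mul0mx.
- by rewrite mulrDl !kqmxD mulmxDl IH IH'.
- by rewrite -[_ * g]/(pa_mul _ g) pa_mulZl !kqmxZ [kqmx _]IH scalemxAl.
elim/pa_ind: g => [|g g' IH IH'|k g IH|q].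
- by rewrite mulr0 kqmx0 mulmx0.
- by rewrite mulrDr !kqmxD mulmxDr IH IH'.
- by rewrite -[_ * (k *: g)]/(pa_mul _ (k *: g)) pa_mulZr !kqmxZ [kqmx _]IH scalemxAr.
rewrite path_mul !kqmx_path pmxM.
by case: (pcat p q) => [r|] /=; rewrite ?kqmx_path // kqmx0.
Qed.

Lemma kqmx1 : kqmx 1 = 1%:M.
Proof.
have -> : (1 : KQ) = \sum_a path_elt K (triv_path a).
  by rewrite -[LHS]/(pa_one K Q) pa_one.unlock.
rewrite kqmx_sum; apply/matrixP => i j; rewrite summxE mxE (bigD1 (slab S i)) //=.
rewrite big1 ?addr0 => [|a ai].
  rewrite kqmx_path /pmx /= mulmx1 mxE eqxx andbT; by [].
by rewrite kqmx_path /pmx /= mulmx1 mxE [slab S i == a]eq_sym (negPf ai) andbF.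
Qed.

Lemma kqmxI f : I f -> kqmx f = 0.
Proof. by move=> If; rewrite /kqmx big1 // => p _; apply: pmx_isolated. Qed.

Definition rmx (a : A) : 'M[K]_n := kqmx (sval (cid (pi_surj bqa a))).

Lemma rmx_pi f : rmx (pi f) = kqmx f.
Proof.
rewrite /rmx; case: cid => g /= gf.
have : I (g - f) by apply/(piI bqa); rewrite rmorphB /= gf subrr.
move=> /kqmxI; rewrite kqmxD -scaleN1r kqmxZ scaleN1r => /eqP.
by rewrite subr_eq0 => /eqP.
Qed.

Lemma rmxP : matrix_representation rmx.
Proof.
split=> [a b|k a||a b].
- have [f <-] := pi_surj bqa a; have [g <-] := pi_surj bqa b.
  by rewrite -rmorphD !rmx_pi kqmxD.
- by have [f <-] := pi_surj bqa a; rewrite -(piZ bqa) !rmx_pi kqmxZ.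
- by rewrite -(rmorph1 pi) rmx_pi kqmx1.
have [f <-] := pi_surj bqa a; have [g <-] := pi_surj bqa b.
by rewrite -rmorphM !rmx_pi kqmxM.
Qed.

Lemma realization : exists M : lmodType A^c, has_diagram pi M S.
Proof.
pose M : lmodType A^c := matrix_module rmxP; exists M.
have ME (v : kmod M) a : v <* a = (v : 'rV[K]_n) *m rmx a by [].
have MZ k (v : kmod M) : k *: v = k *: (v : 'rV[K]_n).
  have [_ rZ r1 _] := rmxP.
  by rewrite [LHS]ME rZ r1 -scalemxAr mulmx1.
pose cf (i : nat) (v : kmod M) : K :=
  if insub i is Some i' then (v : 'rV[K]_n) ord0 i' else 0.
have cL i : linear_for *%R (cf i).
  move=> k u v; rewrite /cf MZ; case: insubP => [i' _ _|_]; last by rewrite mulr0 addr0.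
  by rewrite !mxE.
pose c i : {scalar kmod M} := HB.pack (cf i) (GRing.isLinear.Build K (kmod M) K _ _ (cL i)).
pose b i : kmod M := \row_j (i == j :> nat)%:R.
have cE i (si : (i < n)%N) (v : kmod M) : c i v = (v : 'rV[K]_n) ord0 (Ordinal si).
  by rewrite /= /cf insubT.
exists b, c; split=> [i j si sj|v|i v a si|i v x si].
- by rewrite cE mxE eq_sym.
- apply/rowP => j.
  have -> : (\sum_(i < n) c i v *: b i : kmod M) =
      (\sum_(i < n) c i v *: (b i : 'rV[K]_n) : 'rV[K]_n).
    by apply: eq_bigr => i _; rewrite MZ.
  rewrite summxE (bigD1 j) //= big1 ?addr0 => [|i ij].
    rewrite !mxE eqxx mulr1 /cf insubT //= => jn.
    by congr (_ _ _); apply: val_inj.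
  by rewrite !mxE [i == j :> nat](negPf ij) mulr0.
- rewrite !cE ME /vx rmx_pi kqmx_path /pmx /= mulmx1 mxE (bigD1 (Ordinal si)) //=.
  rewrite big1 ?addr0 => [|k ki]; last by rewrite mxE (negPf ki) mulr0.
  by rewrite mxE eqxx /= eq_sym; case: eqP => _; rewrite ?mulr1 ?mulr0.
rewrite cE ME /ar rmx_pi kqmx_path /pmx /= mulmx1 vmx_amx eqxx mxE.
under [LHS]eq_bigr => k _.
  rewrite [amx x _ _]mxE mulr_sumr big_mkcond; over.
rewrite exchange_big /= [RHS]big_mkcond; apply: eq_big_seq => t /wf[lt _ _ _].
case: eqP => _ /=; last by rewrite big1.
rewrite (bigD1 (Ordinal lt)) //= eqxx big1 ?addr0 => [|k kt].
  by rewrite /cf insubT; case: eqP => _ //; rewrite mulrC.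
by rewrite eq_sym [k == _ :> nat](negPf kt).
Qed.

End Realization.

(** * Strings and relations *)

Section Strings.
Variables (K : fieldType) (Q : quiver) (I : set (path_algebra K Q)).
Variables (A : falgType K) (pi : {rmorphism path_algebra K Q -> A}).
Hypotheses (adm : admissible I) (bqa : is_bound_quiver_algebra I pi).

Local Notation e := (vx pi).
Local Notation ar := (ar pi).
Local Notation mon := (mon pi).
Implicit Types (x y z u w : arr Q) (l : seq (arr Q)) (p q : qpath Q).

Lemma fwd_eq x y : (fwd x == fwd y) = (x == y).
Proof. by rewrite xpair_eqE eqxx andbT. Qed.
Lemma bwd_eq x y : (bwd x == bwd y) = (x == y).
Proof. by rewrite xpair_eqE eqxx andbT. Qed.
Lemma fwd_bwd_eq x y : (fwd x == bwd y) = false.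
Proof. by rewrite xpair_eqE andbF. Qed.
Lemma bwd_fwd_eq x y : (bwd x == fwd y) = false.
Proof. by rewrite xpair_eqE andbF. Qed.
Lemma inv_fwd x : edge_inv (fwd x) = bwd x. Proof. by []. Qed.
Lemma inv_bwd x : edge_inv (bwd x) = fwd x. Proof. by []. Qed.
Definition edge_eqE := (fwd_eq, bwd_eq, fwd_bwd_eq, bwd_fwd_eq, inv_fwd, inv_bwd).

(** The condition that [string] imposes on the paths inside a walk. *)
Definition unrelated p : Prop := ~ I (path_elt K p) /\
  forall q (k : K), q != p -> ~ I (path_elt K p - k *: path_elt K q).

Definition unrelated_arrows l : Prop := forall p, parr p = l -> unrelated p.

Lemma short_unrelated p : (plength p <= 1)%N -> unrelated p.
Proof.
move=> p1; have pp : mcoeff p (path_elt K p) = 1 by rewrite path_elt.unlock mcoeffUU.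
split=> [/(short_coef adm p1)|q k qp /(short_coef adm p1)]; move=> /eqP.
  by rewrite pp oner_eq0.
rewrite mcoeffB pp mcoeff_pa_scale path_elt.unlock mcoeffU (negPf qp).
by rewrite mulr0n mulr0 subr0 oner_eq0.
Qed.

(** Paths of length at most one are unrelated by admissibility, so only longer ones need attention.
    Formal inverses are read in the reversed walk. *)
Lemma make_string a (es : seq (edge Q)) : chain (a : vert (Defs.double Q)) es ->
  sorted (fun c d => d != edge_inv c) es ->
  (forall l, (2 <= size l)%N ->
     infix (map (@fwd Q) l) es \/ infix (map (@bwd Q) l) (rev es) ->
     unrelated_arrows l) ->
  exists2 w : walk Q, edges w = es & string I w.
Proof.
move=> ces ses rel; exists (@QPath (Defs.double Q) (a, es) ces) => //; split=> // p.
rewrite /has_subwalk /edges /parr /= -/(parr p) => sub.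
have [/short_unrelated//|p2] := leqP (plength p) 1.
apply: (rel (parr p)) => //; case: sub => sub; [by left|right].
by move: sub; rewrite /bwd_edges -{1}(revK es) infix_rev.
Qed.

Lemma string_unrelated (ww : walk Q) l : string I ww ->
  infix (map (@fwd Q) l) (edges ww) \/ infix (map (@bwd Q) l) (rev (edges ww)) ->
  unrelated_arrows l.
Proof.
move=> [_ st] sub p pl; apply: st; rewrite /has_subwalk /fwd_edges /bwd_edges pl.
by case: sub => sub; [left|right]; rewrite // -(revK (edges ww)) infix_rev.
Qed.

Lemma path_mon p x l : parr p = x :: l -> pi (path_elt K p) = mon (x :: l).
Proof.
move=> pl; rewrite pi_path pl mon_cons mulrA vx_ar.
by have := qpathP p; rewrite pl /= => /andP[/eqP-> _]; rewrite eqxx.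
Qed.

Lemma mon_src k x y l l' : mon (x :: l) = k *: mon (y :: l') -> mon (x :: l) != 0 ->
  src x = src y.
Proof.
move=> E nz; apply/eqP; apply: contraNT nz => xy.
have : e (src x) * mon (x :: l) = mon (x :: l) by rewrite mon_cons mulrA src_ar.
by rewrite {1}E -scalerAr mon_cons mulrA vx_ar (negPf xy) mul0r scaler0 => <-.
Qed.

Lemma mon_tgt k x y l l' : mon (rcons l x) = k *: mon (rcons l' y) ->
  mon (rcons l x) != 0 -> tgt x = tgt y.
Proof.
move=> E nz; apply/eqP; apply: contraNT nz => xy.
have : mon (rcons l x) * e (tgt x) = mon (rcons l x) by rewrite mon_rcons -mulrA tgt_ar.
by rewrite {1}E -scalerAl mon_rcons -mulrA ar_vx (negPf xy) mulr0 scaler0 => <-.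
Qed.

Lemma mon_subl l l' : mon (l ++ l') != 0 -> mon l != 0.
Proof. by rewrite mon_cat; apply: contraNneq => ->; rewrite mul0r. Qed.

Lemma mon_subr l l' : mon (l ++ l') != 0 -> mon l' != 0.
Proof. by rewrite mon_cat; apply: contraNneq => ->; rewrite mulr0. Qed.

(** The scalar is nonzero because the path is, and a partner of length at most one would have a
    nonzero coefficient in an element of [I]. *)
Lemma related_arrows l : (2 <= size l)%N -> mon l != 0 -> ~ unrelated_arrows l ->
  exists l' k, [/\ l' != l, (2 <= size l')%N, k != 0 & mon l = k *: mon l'].
Proof.
case: l => [//|x l] l2 nz /existsNP[p /not_implyP[pl rel]].
have pE := path_mon pl.
have nI : ~ I (path_elt K p) by move=> /(piI bqa); rewrite pE; apply/eqP.
have [q [k [qp Iq]]] : exists q k, q != p /\ I (path_elt K p - k *: path_elt K q).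
  apply: contrapT => nq; apply: rel; split=> // q k qp Iq.
  by apply: nq; exists q, k.
have k0 : k != 0.
  by apply/eqP => k0; apply: nI; rewrite k0 scale0r subr0 in Iq.
have q2 : (2 <= plength q)%N.
  rewrite leqNgt; apply/negP => /(short_coef adm) /(_ Iq) /eqP.
  rewrite mcoeffB mcoeff_pa_scale path_elt.unlock mcoeffUU mulr1 (mcoeffU p).
  by rewrite [p == q]eq_sym (negPf qp) mulr0n sub0r oppr_eq0 (negPf k0).
have /(piPE bqa) := Iq; rewrite pE.
move: q2; rewrite /plength; case ql : (parr q) => [//|y l'] q2.
rewrite (path_mon ql) => E; exists (y :: l'), k; split=> //.
apply: contraNneq qp => ll; apply/eqP/val_inj.
rewrite [LHS]surjective_pairing [RHS]surjective_pairing.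
rewrite -/(psrc q) -/(psrc p) -/(parr q) -/(parr p) ql pl ll; congr (_, _).
have := qpathP q; rewrite ql /= => /andP[/eqP <- _].
have := qpathP p; rewrite pl /= => /andP[/eqP <- _].
by case: ll => ->.
Qed.

(* An equation exhibiting a path inside a longer path forces it to be zero, as
   iterating it produces arbitrarily long paths. *)
Lemma mon_loop k l r s : mon l = k *: mon (r ++ l ++ s) -> (0 < size r + size s)%N ->
  mon l = 0.
Proof.
move=> E rs.
have it n : mon l = k ^+ n *: (mon r ^+ n * mon l * mon s ^+ n).
  elim: n => [|n IH]; first by rewrite !expr0 scale1r mul1r mulr1.
  rewrite {1}IH {1}E !mon_cat -scalerAr -scalerAl scalerA exprSr; congr (_ *: _).
  by rewrite exprSr exprS !mulrA.
have pw t n : mon t ^+ n = mon (flatten (nseq n t)).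
  elim: n => [|n IH]; first by rewrite expr0 mon_nil.
  by rewrite exprS IH -mon_cat.
have [m mP] := mon_nilp adm bqa; rewrite (it m) !pw.
have sz (t : seq (arr Q)) : (0 < size t)%N -> mon (flatten (nseq m t)) = 0.
  move=> t0; apply: mP; rewrite size_flatten /shape map_nseq sumn_nseq.
  by rewrite -{1}[m]mul1n leq_mul2r t0 orbT.
have [r0|s0] : (0 < size r)%N \/ (0 < size s)%N.
  by move: rs; rewrite addn_gt0 => /orP[]; [left|right].
  by rewrite sz // !mul0r scaler0.
by rewrite [X in _ * X]sz // mulr0 scaler0.
Qed.

Lemma mon_loopl k l r : mon l = k *: mon (r ++ l) -> (0 < size r)%N -> mon l = 0.
Proof.
by move=> E r0; apply: (@mon_loop k _ r [::]); rewrite ?cats0 // addn0.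
Qed.

Lemma mon_loopr k l s : mon l = k *: mon (l ++ s) -> (0 < size s)%N -> mon l = 0.
Proof. by move=> E s0; apply: (@mon_loop k _ [::] s). Qed.

End Strings.

Lemma card_le2 (T : finType) (B : {set T}) (a b c : T) : (#|B| <= 2)%N ->
  a \in B -> b \in B -> c \in B -> a != b -> c = a \/ c = b.
Proof.
move=> B2 aB bB cB ab; have [->|ca] := eqVneq c a; first by left.
have [->|cb] := eqVneq c b; first by right.
have : (2 < #|B|)%N.
  apply/card_gt2P; exists a, b, c; split; first by split.
  by split=> //; rewrite eq_sym.
by rewrite ltnNge B2.
Qed.

(** * Relations in special biserial algebras under conditions (i) and (ii) *)

Section SpecialBiserial.
Variables (K : fieldType) (Q : quiver) (I : set (path_algebra K Q)).
Variables (A : falgType K) (pi : {rmorphism path_algebra K Q -> A}).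
Hypotheses (adm : admissible I) (bqa : is_bound_quiver_algebra I pi).
Hypotheses (sb : special_biserial I) (ci : condition_i I) (cii : condition_ii I).

Local Notation e := (vx pi).
Local Notation ar := (ar pi).
Local Notation mon := (mon pi).
Implicit Types (x y z u w : arr Q) (l : seq (arr Q)) (p q : qpath Q).

Lemma next_unique x y y' : ar x * ar y != 0 -> ar x * ar y' != 0 -> y = y'.
Proof.
case: sb => _ _ + _ => H /eqP xy /eqP xy'.
by apply: (H x) => /(I_arrows bqa).
Qed.

Lemma prev_unique x z z' : ar z * ar x != 0 -> ar z' * ar x != 0 -> z = z'.
Proof.
case: sb => _ _ _ H /eqP zx /eqP zx'.
by apply: (H x) => /(I_arrows bqa).
Qed.

Lemma out_le2 x y z : x != y -> src x = src y -> src z = src x -> z = x \/ z = y.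
Proof.
case: sb => H _ _ _ xy sxy szx; apply: card_le2 (H (src x)) _ _ _ xy;
by rewrite inE ?sxy ?szx ?eqxx // -sxy.
Qed.

Lemma in_le2 x y z : x != y -> tgt x = tgt y -> tgt z = tgt x -> z = x \/ z = y.
Proof.
case: sb => _ H _ _ xy sxy szx; apply: card_le2 (H (tgt x)) _ _ _ xy;
by rewrite inE ?sxy ?szx ?eqxx // -sxy.
Qed.

Lemma mon_prefix x l l' : mon (x :: l) != 0 -> mon (x :: l') != 0 ->
  (size l <= size l')%N -> l' = l ++ drop (size l) l'.
Proof.
elim: l l' x => [|y l IH] [|y' l'] x nz nz' //=.
rewrite ltnS => ll.
have yy : y = y'.
  apply: (@next_unique x); rewrite -(mon2 pi).
    by apply: (@mon_subl _ _ _ pi _ l).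
  by apply: (@mon_subl _ _ _ pi _ l').
rewrite -yy in nz' *; congr (_ :: _); apply: (IH _ y) => //.
  by apply: (@mon_subr _ _ _ pi [:: x]).
by apply: (@mon_subr _ _ _ pi [:: x]).
Qed.

(* By [next_unique], one of the two paths extends the other. *)
Lemma related_heads k x l l' : mon (x :: l) = k *: mon (x :: l') -> l' != l ->
  mon (x :: l) != 0 -> False.
Proof.
move=> E ll nz; have k0 : k != 0.
  by apply: contraNneq nz => k0; rewrite E k0 scale0r.
have nz' : mon (x :: l') != 0.
  by apply: contraNneq nz => l0; rewrite E l0 scaler0.
have [le|/ltnW le] := leqP (size l) (size l').
  have := mon_prefix nz nz' le; set d := drop _ _ => dE.
  move/eqP: nz; apply; apply: (mon_loopr adm bqa (k := k) (s := d)).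
    by rewrite /= -dE.
  by rewrite lt0n size_eq0; apply: contraNneq ll => d0; rewrite dE d0 cats0.
have := mon_prefix nz' nz le; set d := drop _ _ => dE.
move/eqP: nz'; apply; apply: (mon_loopr adm bqa (k := k^-1) (s := d)).
  by rewrite /= -dE E scalerA mulVf // scale1r.
by rewrite lt0n size_eq0; apply: contraNneq ll => d0; rewrite dE d0 cats0.
Qed.

(** Otherwise [w1 w2^{-1} z] is a string of length three, against condition (i). *)
Lemma merge_out w1 w2 z : w1 != w2 -> tgt w1 = tgt w2 -> src z = src w2 -> z = w2.
Proof.
move=> w12 tw sz; apply/eqP; apply: contrapT => /negP zw.
have [|||w we sw] := make_string adm (a := src w1) (es := [:: fwd w1; bwd w2; fwd z]).
- by rewrite /= tw sz !eqxx.
- by rewrite /= !edge_eqE eq_sym w12 zw.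
- by move=> [|x [|y l]] //= _; rewrite !edge_eqE !(andbF, andFb, orbF) => -[].
have : edges w = [:: fwd w1; bwd w2].
  by apply: ci sw w12 tw _; rewrite /has_subwalk we /= !edge_eqE !eqxx.
by rewrite we.
Qed.

(** Otherwise [w1 w2^{-1} u^{-1}] is a string, against condition (i). *)
Lemma merge_related w1 w2 u : w1 != w2 -> tgt w1 = tgt w2 -> ar u * ar w2 != 0 ->
  ~ unrelated_arrows I [:: u; w2].
Proof.
move=> w12 tw nz rel; have uw := ar2_neq0 nz.
have [|||w we sw] := make_string adm (a := src w1) (es := [:: fwd w1; bwd w2; bwd u]).
- by rewrite /= tw uw !eqxx.
- by rewrite /= !edge_eqE eq_sym w12.
- move=> [|x [|y l]] //= _; rewrite /rev /= !edge_eqE !(andbF, andFb, orbF).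
  by case=> // /and3P[/eqP-> /eqP->]; case: l => [|? ?] //=; rewrite bwd_fwd_eq.
have : edges w = [:: fwd w1; bwd w2].
  by apply: ci sw w12 tw _; rewrite /has_subwalk we /= !edge_eqE !eqxx.
by rewrite we.
Qed.

(** A partner of [u w2] ends at the target of [w2]. If its last arrow were [w2], the one before
    would be [u], and [u w2] would recur at the end of a longer path, which [mon_loopl] forbids. *)
Lemma src_related u w2 l' k : mon [:: u; w2] = k *: mon l' -> mon [:: u; w2] != 0 ->
  forall w1, w1 != w2 -> tgt w1 = tgt w2 -> l' != [:: u; w2] -> (2 <= size l')%N ->
  exists l'' v, l' = rcons (rcons l'' v) w1.
Proof.
move=> E nz w1 w12 tw ll l2.
have nz' : mon l' != 0 by apply: contraNneq nz => l0; rewrite E l0 scaler0.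
case/lastP: l' => [//|l' w] in E ll l2 nz' *.
case/lastP: l' => [//|l' v] in E ll l2 nz' *.
have tgw : tgt w = tgt w2.
  by apply/esym; apply: (@mon_tgt _ _ _ pi k _ _ [:: u] (rcons l' v)).
have [|ww|ww] := @in_le2 w1 w2 w w12 tw; first by rewrite tgw.
  by exists l', v; rewrite ww.
have vu : v = u.
  apply: (@prev_unique w2); last by rewrite -(mon2 pi).
  rewrite -(mon2 pi) -ww; apply: (@mon_subr _ _ _ pi l').
  by rewrite -[l' ++ _]/(l' ++ [:: v] ++ [:: w]) catA !cats1.
move/eqP: nz; case; apply: (mon_loopl adm bqa (k := k) (r := l')).
  by rewrite E ww vu -!cats1 -catA.
by rewrite lt0n size_eq0; apply: contraNneq ll => l0; rewrite l0 ww vu.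
Qed.

(** By [src_related] the partner of [u w2] ends in some [v w1], whose own partner ends in [u w2].
    Substituting one relation into the other puts [v w1] into a longer path, unless the first
    partner is [v w1] itself. *)
Lemma merge_square w1 w2 u : w1 != w2 -> tgt w1 = tgt w2 -> ar u * ar w2 != 0 ->
  exists u' k, [/\ u' != u, src u' = src u, k != 0 &
                   ar u * ar w2 = k *: (ar u' * ar w1)].
Proof.
move=> w12 tw nz; rewrite -(mon2 pi) in nz.
have rel : ~ unrelated_arrows I [:: u; w2].
  by apply: merge_related w12 tw _; rewrite -mon2.
have [l' [k [ll l2 k0 E]]] := related_arrows adm bqa (l := [:: u; w2]) isT nz rel.
have [l'' [v lE]] := src_related E nz w12 tw ll l2.
have nz' : mon l' != 0 by apply: contraNneq nz => l0; rewrite E l0 scaler0.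
have vw : mon [:: v; w1] != 0.
  by apply: (@mon_subr _ _ _ pi l''); move: nz'; rewrite lE -!cats1 -catA.
have w21 : w2 != w1 by rewrite eq_sym.
have rel' : ~ unrelated_arrows I [:: v; w1].
  by apply: merge_related w21 (esym tw) _; rewrite -mon2.
have [m [k' [mm m2 k'0 E']]] := related_arrows adm bqa (l := [:: v; w1]) isT vw rel'.
have [m'' [v' mE]] := src_related E' vw w21 (esym tw) mm m2.
have nzm : mon m != 0 by apply: contraNneq vw => l0; rewrite E' l0 scaler0.
have v'u : v' = u.
  apply: (@prev_unique w2); rewrite -(mon2 pi) //.
  by apply: (@mon_subr _ _ _ pi m''); move: nzm; rewrite mE -!cats1 -catA.
have l''0 : l'' = [::].
  apply: contraNeq vw; rewrite -size_eq0 -lt0n => l0.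
  apply/eqP; apply: (mon_loopl adm bqa (k := k' * k) (r := m'' ++ l'')); last first.
    by rewrite size_cat addn_gt0 l0 orbT.
  have E1 : mon m = mon m'' * mon [:: u; w2].
    by rewrite mE v'u -mon_cat -!cats1 -catA.
  have E3 : mon l' = mon l'' * mon [:: v; w1].
    by rewrite lE -mon_cat -!cats1 -catA.
  by rewrite {1}E' E1 E E3 -scalerAr scalerA !mon_cat mulrA.
rewrite l''0 in lE; have E2 : ar u * ar w2 = k *: (ar v * ar w1).
  by rewrite -!(mon2 pi) E lE.
have vw1 := ar2_neq0 (pi := pi) (x := v) (y := w1).
rewrite -(mon2 pi) in vw1; exists v, k; split=> //.
  (* If [v = u], then [w1] starts where [w2] does, and [merge_out] identifies them. *)
  apply: contraNneq (w12) => vu; apply/eqP; apply: (merge_out w12 tw).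
  by rewrite -vw1 // vu; apply: (ar2_neq0 (pi := pi)); rewrite -(mon2 pi).
apply/esym/(@mon_src _ _ _ pi k u v [:: w2] [:: w1]) => //.
by rewrite !(mon2 pi).
Qed.

(** A second arrow into the target of [w1] would make [w1] the only arrow out of its source. *)
Lemma split_in w1 w2 z : w1 != w2 -> src w1 = src w2 -> tgt z = tgt w1 -> z = w1.
Proof.
move=> w12 sw tz; apply/eqP; apply: contraNT w12 => zw.
by apply/eqP/esym; apply: (merge_out zw tz).
Qed.

Lemma split_tgt w1 w2 : w1 != w2 -> src w1 = src w2 -> tgt w1 != tgt w2.
Proof.
move=> w12 sw; apply: contraNneq (w12) => tw; apply/eqP/esym.
exact: split_in sw (esym tw).
Qed.

(** A partner of [w1 y] starts with [w2] by [related_heads]. Its last arrow [z] is not [y], since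
    otherwise [w1 y] would be its proper end. So [y] and [z] merge, and [merge_square] applies. *)
Lemma related_split w1 w2 y : w1 != w2 -> src w1 = src w2 -> ar w1 * ar y != 0 ->
  ~ unrelated_arrows I [:: w1; y] ->
  exists k y', k != 0 /\ ar w1 * ar y = k *: (ar w2 * ar y').
Proof.
move=> w12 sw nz rel; rewrite -(mon2 pi) in nz.
have [l' [k [ll l2 k0 E]]] := related_arrows adm bqa (l := [:: w1; y]) isT nz rel.
have nz' : mon l' != 0 by apply: contraNneq nz => l0; rewrite E l0 scaler0.
case: l' => [//|v l'] in E ll l2 nz' *.
have sv := mon_src E nz.
have vw : v = w2.
  have [|vw|//] := @out_le2 w1 w2 v w12 sw; first by rewrite sv.
  rewrite vw in E ll; case: (related_heads E _ nz).
  by apply: contraNneq ll => ->.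
case/lastP: l' => [//|l' z] in E ll l2 nz' *.
have tz : tgt z = tgt y.
  by apply/esym; apply: (@mon_tgt _ _ _ pi k _ _ [:: w1] (v :: l')).
have yw : tgt w1 = src y by apply: (ar2_neq0 (pi := pi)); rewrite -(mon2 pi).
have zy : z != y.
  apply: contraNneq (w12) => zy.
  have lz : ar (last v l') * ar z != 0.
    rewrite -(mon2 pi); apply: (@mon_subr _ _ _ pi (belast v l')).
    by rewrite -cat_rcons -lastI cats1 rcons_cons.
  have tl : tgt (last v l') = tgt w1 by rewrite yw -zy; apply: ar2_neq0 lz.
  have lw := split_in w12 sw tl.
  move/eqP: nz; case; apply: (mon_loopl adm bqa (k := k) (r := belast v l')).
    rewrite E; congr (_ *: mon _).
    by rewrite -cat_rcons -[in RHS]lw -lastI cats1 -zy.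
  rewrite size_belast lt0n size_eq0; apply: contraNneq (w12) => l0.
  by rewrite l0 /= in lw; rewrite -lw vw.
have [u' [k' [uw su k'0 E2]]] : exists u' k', [/\ u' != w1, src u' = src w1, k' != 0 &
     ar w1 * ar y = k' *: (ar u' * ar z)].
  by apply: (merge_square zy tz); rewrite -(mon2 pi).
have [u1|u2] := @out_le2 w1 w2 u' w12 sw su; first by rewrite u1 eqxx in uw.
by exists k', z; rewrite -u2.
Qed.

(** If both paths were unrelated, [y^{-1} w1^{-1} w2 y'] would be a string of length four, against
    condition (ii). A related one lies in a square by [related_split]. *)
Lemma split_square w1 w2 y y' : w1 != w2 -> src w1 = src w2 ->
  ar w1 * ar y != 0 -> ar w2 * ar y' != 0 ->
  exists2 k, k != 0 & ar w1 * ar y = k *: (ar w2 * ar y').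
Proof.
move=> w12 sw nz nz'; have w21 : w2 != w1 by rewrite eq_sym.
have yw := ar2_neq0 nz; have yw' := ar2_neq0 nz'.
have [rel|rel] : ~ unrelated_arrows I [:: w1; y] \/ ~ unrelated_arrows I [:: w2; y'].
- apply/not_andP => -[rel rel'].
  have [|||w we st] := make_string adm (a := tgt y)
    (es := [:: bwd y; bwd w1; fwd w2; fwd y']).
  + by rewrite /= yw sw yw' !eqxx.
  + by rewrite /= !edge_eqE eq_sym w12.
  + move=> [|x1 [|x2 l]] //= _; rewrite /rev /= !edge_eqE !(andbF, andFb, orbF).
    case=> /and3P[/eqP-> /eqP->];
    by case: l => [|? ?] //=; rewrite ?bwd_fwd_eq.
  have := cii st w12 sw; rewrite /has_subwalk /walk_length /plength -/(edges w) we.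
  by rewrite /= !edge_eqE !eqxx /= orbT => /(_ isT).
- have [k [y2 [k0 E]]] := related_split w12 sw nz rel.
  exists k => //; rewrite (_ : y' = y2) //; apply: next_unique nz' _.
  by apply: contraNneq nz => y0; rewrite E y0 scaler0.
have [k [y2 [k0 E]]] := related_split w21 (esym sw) nz' rel.
exists k^-1; first by rewrite invr_eq0.
rewrite E scalerA mulVf // scale1r (_ : y = y2) //; apply: next_unique nz _.
by apply: contraNneq nz' => y0; rewrite E y0 scaler0.
Qed.

Section Square.
Variables (w1 w2 y y' : arr Q) (k : K).
Hypotheses (w12 : w1 != w2) (sw : src w1 = src w2) (k0 : k != 0).
Hypotheses (nz : ar w1 * ar y != 0) (E : ar w1 * ar y = k *: (ar w2 * ar y')).

Lemma square_nz : ar w2 * ar y' != 0.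
Proof. by apply: contraNneq nz => y0; rewrite E y0 scaler0. Qed.

Lemma square_tgt : tgt y = tgt y'.
Proof.
apply: (@mon_tgt _ _ _ pi k _ _ [:: w1] [:: w2]); by rewrite !(mon2 pi).
Qed.

Lemma square_neq : y != y'.
Proof.
apply: contraNneq (split_tgt w12 sw) => yy.
by rewrite (ar2_neq0 nz) (ar2_neq0 square_nz) yy.
Qed.

(** [z] would have the two predecessors [y] and [y']. *)
Lemma square_after z : ar w1 * ar y * ar z = 0.
Proof.
apply/eqP; apply: contraNT square_neq => nz'; apply/eqP; apply: (@prev_unique z).
  by apply: contraNneq nz' => y0; rewrite -mulrA y0 mulr0.
by apply: contraNneq nz' => y0; rewrite E -scalerAl -mulrA y0 mulr0 scaler0.
Qed.

Lemma square_before z : ar z * (ar w1 * ar y) = 0.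
Proof.
apply/eqP; apply: contraNT w12 => nz'; apply/eqP; apply: (@next_unique z).
  by apply: contraNneq nz' => y0; rewrite mulrA y0 mul0r.
by apply: contraNneq nz' => y0; rewrite E -scalerAr mulrA y0 mul0r scaler0.
Qed.

End Square.

(** If [w1 y z] is nonzero, [w2] has no continuation, because a square cannot be prolonged. Then
    [w1 y], [w1 y z] and [y z] are unrelated, and [z^{-1} y^{-1} w1^{-1} w2] is a string of length
    four. *)
Lemma split_short w1 w2 y z : w1 != w2 -> src w1 = src w2 ->
  ar w1 * ar y * ar z = 0.
Proof.
move=> w12 sw; apply/eqP; apply: contrapT => /negP nz.
have nz1 : ar w1 * ar y != 0 by apply: contraNneq nz => ->; rewrite mul0r.
have nz2 : ar y * ar z != 0 by apply: contraNneq nz => y0; rewrite -mulrA y0 mulr0.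
have nw y' : ar w2 * ar y' = 0.
  apply/eqP; apply: contraNT nz => nz'.
  have [k k0 E] := split_square w12 sw nz1 nz'.
  by rewrite (square_after w12 sw nz1 E).
have nz3 : mon [:: w1; y; z] != 0 by rewrite mon_cons mon2 mulrA.
have rel_w1 l : (1 < size (w1 :: l))%N -> mon (w1 :: l) != 0 -> unrelated_arrows I (w1 :: l).
  move=> l2 nzl; apply: contrapT => rel.
  have [l' [k [ll l'2 k0 E]]] := related_arrows adm bqa l2 nzl rel.
  have nz' : mon l' != 0 by apply: contraNneq nzl => l0; rewrite E l0 scaler0.
  case: l' => [//|v [//|v' l']] in E ll l'2 nz' *.
  have [|vw|vw] := @out_le2 w1 w2 v w12 sw.
  - by rewrite (mon_src E nzl).
  - rewrite vw in E ll; apply: (related_heads E _ nzl).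
    by apply: contraNneq ll => ->.
  - by move: nz'; rewrite vw mon_cons mon_cons mulrA nw mul0r eqxx.
have rel_y : unrelated_arrows I [:: y; z].
  apply: contrapT => rel; rewrite -(mon2 pi) in nz2.
  have [l' [k [ll l'2 k0 E]]] := related_arrows adm bqa (l := [:: y; z]) isT nz2 rel.
  by apply: (related_heads (k := k) _ ll nz3); rewrite !(mon_cons pi w1) E scalerAr.
have [|||w we st] := make_string adm (a := tgt z)
  (es := [:: bwd z; bwd y; bwd w1; fwd w2]).
- by rewrite /= (ar2_neq0 nz2) (ar2_neq0 nz1) sw !eqxx.
- by rewrite /= !edge_eqE eq_sym w12.
- move=> [|x1 [|x2 [|x3 l]]] //= _; rewrite /rev /= !edge_eqE !(andbF, andFb, orbF, orFb, andbT).
    case=> // /orP[]/andP[/eqP-> /eqP->] //.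
    by apply: rel_w1; rewrite ?mon2.
  case=> // /and4P[/eqP-> /eqP-> /eqP->].
  by case: l => [|? ?] //= _; apply: rel_w1.
have := cii st w12 sw; rewrite /has_subwalk /walk_length /plength -/(edges w) we.
by rewrite /= !edge_eqE !eqxx /= !orbT => /(_ isT).
Qed.

End SpecialBiserial.

(** * Classification of the indecomposable modules *)

Section Diagrams.
Variables (K : fieldType) (Q : quiver).
Implicit Types (x y w : arr Q).

(** [k] is the scalar in [w1 y = k w2 y']. The last basis vector is the image of the first under
    [w1 y], so that [w2 y'] yields [k^-1] times it. *)
Definition square_diagram w1 y w2 y' (k : K) : diagram K Q :=
  Diagram 4 (nth (src w1) [:: src w1; tgt w1; tgt w2; tgt y])
    [:: (0%N, w1, 1, 1%N); (0%N, w2, 1, 2); (1%N, y, 1, 3); (2, y', k^-1, 3)].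

Definition merge_diagram w1 w2 : diagram K Q :=
  Diagram 3 (nth (src w1) [:: src w1; src w2; tgt w1])
    [:: (0%N, w1, 1, 2); (1%N, w2, 1, 2)].

Definition hook_diagram w1 y w2 : diagram K Q :=
  Diagram 4 (nth (src w1) [:: src w1; tgt w1; tgt w2; tgt y])
    [:: (0%N, w1, 1, 1%N); (0%N, w2, 1, 2); (1%N, y, 1, 3)].

Definition fork_diagram w1 w2 : diagram K Q :=
  Diagram 3 (nth (src w1) [:: src w1; tgt w1; tgt w2])
    [:: (0%N, w1, 1, 1%N); (0%N, w2, 1, 2)].

Definition path_diagram (a : vert Q) (l : seq (arr Q)) : diagram K Q :=
  Diagram (size l).+1 (nth a (a :: map (@tgt Q) l))
    [seq (t.1, t.2, 1, t.1.+1) | t <- zip (iota 0 (size l)) l].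

End Diagrams.

Section Classification.
Variables (K : fieldType) (Q : quiver) (I : set (path_algebra K Q)).
Variables (A : falgType K) (pi : {rmorphism path_algebra K Q -> A}).
Hypotheses (adm : admissible I) (bqa : is_bound_quiver_algebra I pi).
Hypotheses (sb : special_biserial I) (ci : condition_i I) (cii : condition_ii I).
Variable M : lmodType A^c.
Hypothesis indM : indecomposable M.

Local Notation V := (kmod M).
Local Notation e := (vx pi).
Local Notation ar := (ar pi).
Local Notation mon := (mon pi).
Implicit Types (x y z w : arr Q) (a : vert Q) (l : seq (arr Q)) (u v m : V).

(** The links make the span of [s] a submodule, the last two hypotheses do so for the kernel of
    [fs]; by indecomposability [s] is a basis. *)
Lemma diagram_of_triangular S s (fs : seq {scalar V}) : size s = sdim S -> (0 < sdim S)%N ->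
  wf_diagram S -> triangular s fs ->
  (forall i a, (i < sdim S)%N -> s`_i <* e a = if a == slab S i then s`_i else 0) ->
  (forall i x, (i < sdim S)%N -> s`_i <* ar x =
     \sum_(t <- slinks S | (larr t == x) && (lsrc t == i)) lcoef t *: s`_(ltgt t)) ->
  (forall a v, vanish fs v -> vanish fs (v <* e a)) ->
  (forall x v, vanish fs v -> vanish fs (v <* ar x)) ->
  has_diagram pi M S.
Proof.
move=> sS S0 wf tri se sa fe fa.
have sp := subspace_spanN s (@subspace0 K V).
have smem i : (i < sdim S)%N -> lspan s s`_i.
  by move=> si; apply: spanN_mem; [exact: subspace0|rewrite mem_nth ?sS].
have [|c cP] := triangular_shaped (pi := pi) sS wf tri _ se sa; last first.
  by exists (fun i => s`_i), c.
apply: (split_span bqa indM _ tri) => //; first by rewrite sS.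
  move=> a _ /(nthP 0)[i si <-]; rewrite sS in si.
  by rewrite se //; case: ifP => _; [exact: smem|case: sp].
move=> x _ /(nthP 0)[i si <-]; rewrite sS in si; rewrite sa // big_seq_cond.
apply: subspace_sum => // t /andP[/wf[_ rt _ _] _].
by case: sp => _ _; apply; exact: smem.
Qed.

Lemma act_src v a x : v <* e a = v -> a != src x -> v <* ar x = 0.
Proof. by move=> <- ax; rewrite vx_ar_act (negPf ax). Qed.

Lemma act_eq0 x y v : ar x * ar y = 0 -> v <* ar x <* ar y = 0.
Proof. by move=> xy; rewrite ractM xy ract0r. Qed.

Definition at_vx (phi : {scalar V}) a : Prop :=
  forall b v, phi (v <* e b) = if b == a then phi v else 0.

Lemma at_vx_rform phi a : at_vx (rform phi (e a)) a.
Proof.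
move=> b v; rewrite ?rformE vx_vx_act; case: eqP => [->//|_]; exact: sform0.
Qed.

Lemma nonzero_form u a : u != 0 -> u <* e a = u ->
  exists phi : {scalar V}, phi u = 1 /\ at_vx phi a.
Proof.
move=> u0 ua; have [phi [_ phi1]] := separating_form (@subspace0 K V) (elimN eqP u0).
by exists (rform phi (e a)); split; [rewrite rformE ua|exact: at_vx_rform].
Qed.

Lemma vx_of_ar v x : v <* ar x <* e (tgt x) = v <* ar x.
Proof. by rewrite ar_vx_act eqxx. Qed.

Lemma at_vx_ar phi a x v : at_vx phi a -> tgt x != a -> phi (v <* ar x) = 0.
Proof. by move=> pa xa; rewrite -(vx_of_ar v x) pa (negPf xa). Qed.

Lemma split_act w1 w2 m x : w1 != w2 -> src w1 = src w2 -> m <* e (src w1) = m ->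
  x != w1 -> x != w2 -> m <* ar x = 0.
Proof.
move=> w12 sw me xw1 xw2; apply: (act_src me); rewrite eq_sym.
apply: contraNneq xw1 => sx.
by have [->//|xw] := out_le2 sb w12 sw sx; rewrite xw eqxx in xw2.
Qed.

(** The forms are [phi] pulled back along the paths of the square to its last vertex. Their kernel
    is stable because no arrow acts before the square, [y] and [y'] have one predecessor each, and
    no third arrow enters their target. *)
Lemma square_case w1 w2 y y' (k : K) m0 : w1 != w2 -> src w1 = src w2 -> k != 0 ->
  ar w1 * ar y != 0 -> ar w1 * ar y = k *: (ar w2 * ar y') ->
  m0 <* ar w1 <* ar y != 0 ->
  has_diagram pi M (square_diagram w1 y w2 y' k).
Proof.
move=> w12 sw k0 nz E m0nz.
have nz' := square_nz nz E.
have ty := square_tgt nz E.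
have yy := square_neq adm ci w12 sw nz E.
have yw := ar2_neq0 nz; have yw' := ar2_neq0 nz'.
have after v x : v <* ar w1 <* ar y <* ar x = 0.
  by rewrite !ractM mulrA (square_after adm bqa sb ci w12 sw nz E) ract0r.
have before v x : v <* ar x <* ar w1 <* ar y = 0.
  by rewrite !ractM (square_before bqa sb w12 E) ract0r.
have w1x x : x != y -> ar w1 * ar x = 0.
  by move=> xy; apply/eqP; apply: contraNT xy => xnz; apply/eqP/(next_unique bqa sb xnz).
have w2x x : x != y' -> ar w2 * ar x = 0.
  by move=> xy; apply/eqP; apply: contraNT xy => xnz; apply/eqP/(next_unique bqa sb xnz).
have xy x : x != w1 -> ar x * ar y = 0.
  by move=> xw; apply/eqP; apply: contraNT xw => xnz; apply/eqP/(prev_unique bqa sb xnz).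
have xy' x : x != w2 -> ar x * ar y' = 0.
  by move=> xw; apply/eqP; apply: contraNT xw => xnz; apply/eqP/(prev_unique bqa sb xnz).
have E' v : v <* ar w2 <* ar y' = k^-1 *: (v <* ar w1 <* ar y).
  by rewrite !ractM E ractZr scalerA mulVf // scale1r.
pose m := m0 <* e (src w1).
have me : m <* e (src w1) = m by rewrite vx_vx_act eqxx.
have mw : m <* ar w1 <* ar y != 0 by rewrite vx_ar_act eqxx.
have [phi [phi1 pa]] := nonzero_form mw (vx_of_ar _ y).
apply: (@diagram_of_triangular _
  [:: m; m <* ar w1; m <* ar w2; m <* ar w1 <* ar y]
  [:: rform (rform phi (ar y)) (ar w1); rform phi (ar y); rform phi (ar y'); phi]) => //.
- move=> t; rewrite !inE => /or4P[]/eqP->; rewrite /lsrc /larr /ltgt /=;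
  by split=> //; rewrite ?yw ?yw' ?ty.
- rewrite /= ?rformE; do !split.
  + by rewrite phi1 oner_neq0.
  + move=> v; rewrite !inE => /or3P[]/eqP->; rewrite ?rformE.
    * by rewrite before sform0.
    * by rewrite before sform0.
    * by rewrite after ract0l sform0.
  + by rewrite phi1 oner_neq0.
  + move=> v; rewrite !inE => /orP[]/eqP->; rewrite ?rformE.
      by rewrite (act_eq0 _ (w2x _ yy)) sform0.
    by rewrite after sform0.
  + by rewrite E' sformZ phi1 mulr1 invr_eq0.
  + move=> v; rewrite !inE => /eqP->; rewrite ?rformE.
    by rewrite after sform0.
  + by rewrite phi1 oner_neq0.
  + by [].
- case=> [|[|[|[|i]]]] a //= _; rewrite ?ar_vx_act //.
  by rewrite /m vx_vx_act eq_sym; case: eqP => // ->.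
- case=> [|[|[|[|i]]]] x //= _; rewrite !big_cons big_nil /lsrc /larr /ltgt /lcoef /=
    ?andbT ?andbF ?addr0.
  + case: (eqVneq w1 x) => [<-|xw1].
      by rewrite eq_sym (negPf w12) /= ?addr0 scale1r.
    case: (eqVneq w2 x) => [<-|xw2]; first by rewrite ?addr0 scale1r.
    by apply: (split_act w12 sw me); rewrite eq_sym.
  + case: (eqVneq y x) => [<-|yx]; first by rewrite scale1r.
    by apply/act_eq0/w1x; rewrite eq_sym.
  + case: (eqVneq y' x) => [<-|yx]; first by rewrite E'.
    by apply/act_eq0/w2x; rewrite eq_sym.
  + by rewrite after.
- move=> a v; rewrite {1}/vanish /= => /and5P[/eqP f1 /eqP f2 /eqP f3 /eqP f4 _].
  rewrite ?rformE in f1 f2 f3; rewrite /vanish /= ?rformE !vx_ar_act pa.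
  apply/and5P; split=> //; case: ifP => _; rewrite ?ract0l ?sform0 ?f1 ?f2 ?f3 ?f4 //.
move=> x v; rewrite {1}/vanish /= => /and5P[/eqP f1 /eqP f2 /eqP f3 /eqP f4 _].
rewrite ?rformE in f1 f2 f3; rewrite /vanish /= ?rformE.
rewrite before sform0 eqxx /=; apply/and4P; split=> //.
- have [->|xw] := eqVneq x w1; first by rewrite f1.
  by rewrite act_eq0 ?sform0 // xy.
- have [->|xw] := eqVneq x w2; first by rewrite E' sformZ f1 mulr0.
  by rewrite act_eq0 ?sform0 // xy'.
have [tx|/(at_vx_ar v pa)->//] := eqVneq (tgt x) (tgt y).
by have [->|->] := in_le2 sb yy ty tx; rewrite ?f2 ?f3.
Qed.

(** As nothing acts before [w1] and [w2], the common kernel of [phi] and its pullbacks along both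
    arrows is stable. By [merge_out] each of the two is the only arrow out of its source. *)
Lemma merge_case w1 w2 v1 v2 : w1 != w2 -> tgt w1 = tgt w2 ->
  (forall x v, v <* ar x <* ar w1 = 0) -> (forall x v, v <* ar x <* ar w2 = 0) ->
  v1 <* ar w1 = v2 <* ar w2 -> v1 <* ar w1 != 0 ->
  has_diagram pi M (merge_diagram K w1 w2).
Proof.
move=> w12 tw kill1 kill2; have w21 : w2 != w1 by rewrite eq_sym.
wlog [e1 e2] : v1 v2 / v1 <* e (src w1) = v1 /\ v2 <* e (src w2) = v2.
  move=> H v12 nz; apply: (H (v1 <* e (src w1)) (v2 <* e (src w2))).
  - by rewrite !vx_vx_act !eqxx.
  - by rewrite !vx_ar_act !eqxx.
  - by rewrite vx_ar_act eqxx.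
move=> v12 nz; have [phi [phi1 pa]] := nonzero_form nz (vx_of_ar _ w1).
have sw : src w1 != src w2.
  by apply: contraNneq (w12) => sw; apply/eqP; apply: (merge_out adm ci w12 tw sw).
have sw' : src w2 != src w1 by rewrite eq_sym.
have after x : v1 <* ar w1 <* ar x = 0.
  have [/act_eq0->//|nz1] := eqVneq (ar w1 * ar x) 0.
  rewrite v12; apply/act_eq0/eqP; apply: contraNT w12 => nz2; apply/eqP.
  exact: (prev_unique bqa sb nz1 nz2).
apply: (@diagram_of_triangular _
  [:: v1; v2; v1 <* ar w1]
  [:: rform phi (ar w1); rform phi (ar w2); phi]) => //.
- by move=> t; rewrite !inE => /orP[]/eqP->; rewrite /lsrc /larr /ltgt /=; split.
- rewrite /= ?rformE; do !split.
  + by rewrite phi1 oner_neq0.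
  + move=> v; rewrite !inE => /orP[]/eqP->; rewrite ?rformE.
      by rewrite (act_src e2 sw') sform0.
    by rewrite after sform0.
  + by rewrite -v12 phi1 oner_neq0.
  + by move=> v; rewrite inE => /eqP->; rewrite ?rformE after sform0.
  + by rewrite phi1 oner_neq0.
  + by [].
- case=> [|[|[|i]]] a //= _; rewrite ?ar_vx_act //.
    by rewrite -{1}e1 vx_vx_act e1 eq_sym.
  by rewrite -{1}e2 vx_vx_act e2 eq_sym.
- case=> [|[|[|i]]] x //= _; rewrite !big_cons big_nil /lsrc /larr /ltgt /lcoef /=
    ?andbT ?andbF ?addr0.
  + case: (eqVneq w1 x) => [<-|xw1]; first by rewrite scale1r.
    apply: (act_src e1); apply: contraNneq xw1 => sx; apply/eqP/esym.
    exact: (merge_out adm ci w21 (esym tw) (esym sx)).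
  + case: (eqVneq w2 x) => [<-|xw1]; first by rewrite scale1r v12.
    apply: (act_src e2); apply: contraNneq xw1 => sx; apply/eqP/esym.
    exact: (merge_out adm ci w12 tw (esym sx)).
  + by rewrite after.
- move=> a v; rewrite {1}/vanish /= => /and4P[/eqP f1 /eqP f2 /eqP f3 _].
  rewrite ?rformE in f1 f2; rewrite /vanish /= ?rformE !vx_ar_act pa.
  by apply/and4P; split=> //; case: ifP => _; rewrite ?sform0 ?f1 ?f2 ?f3.
move=> x v; rewrite {1}/vanish /= => /and4P[/eqP f1 /eqP f2 /eqP f3 _].
rewrite ?rformE in f1 f2; rewrite /vanish /= ?rformE kill1 kill2 sform0 eqxx /= andbT.
have [tx|/(at_vx_ar v pa)->//] := eqVneq (tgt x) (tgt w1).
by have [->|->] := in_le2 sb w12 tw tx; rewrite ?f1 ?f2.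
Qed.

Local Notation MJ := (rad1 pi (setT : set V)).

(* The vectors that contribute neither to the part of the top of [M] detected
   by [b1] nor to the one detected by [b2]. *)
Definition hidden (b1 b2 : A) v : Prop := exists k1 k2 : V,
  [/\ k1 <* b1 = 0, k2 <* b2 = 0 & MJ (v - k1 - k2)].

Lemma subspace_hidden b1 b2 : subspace (hidden b1 b2).
Proof.
have [J0 JD JZ] := submodule_subspace bqa (submodule_rad1 bqa (submoduleT M)).
split=> [|u v [k1 [k2 [h1 h2 J]]] [l1 [l2 [h1' h2' J']]]|k u [k1 [k2 [h1 h2 J]]]].
- by exists 0, 0; rewrite !ract0l !subr0; split.
- exists (k1 + l1), (k2 + l2); rewrite !ractDl h1 h2 h1' h2' !addr0; split=> //.
  by rewrite !opprD (addrACA u) (addrACA (u - k1)); apply: JD.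
- exists (k *: k1), (k *: k2); rewrite !ractZl h1 h2 !scaler0; split=> //.
  by rewrite -!scalerBr; apply: JZ.
Qed.

(** A form that kills the hidden vectors kills the kernels of [b1] and of [b2], hence factors
    through both actions. *)
Lemma visible_form b1 b2 a m : ~ hidden b1 b2 m -> e a * b1 = b1 ->
  exists theta phi psi : {scalar V},
    [/\ theta (m <* e a) = 1, forall b v, theta (v <* e b) = if b == a then theta v else 0,
        forall x v, theta (v <* ar x) = 0, forall v, phi (v <* b1) = theta v
      & forall v, psi (v <* b2) = theta v].
Proof.
move=> hm eb1; have [theta [th t1]] := separating_form (subspace_hidden b1 b2) hm.
have [J0 _ _] := submodule_subspace bqa (submodule_rad1 bqa (submoduleT M)).
have th1 v : v <* b1 = 0 -> theta v = 0.
  by move=> v0; apply: th; exists v, 0; rewrite ract0l subr0 subrr.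
have th2 v : v <* b2 = 0 -> theta v = 0.
  by move=> v0; apply: th; exists 0, v; rewrite ract0l subr0 subrr.
have [phi phiP] := form_factor (g := @ract K A M b1) th1.
have [psi psiP] := form_factor (g := @ract K A M b2) th2.
have te v : theta (v <* e a) = theta v.
  by rewrite -!phiP /= ractM eb1.
exists theta, phi, psi; split=> //; first by rewrite te.
  move=> b v; have [->|ba] := eqVneq b a; first exact: te.
  by apply: th1; rewrite -eb1 ractM mulrA vxM (negPf ba) mul0r ract0r.
move=> x v; apply: th; exists 0, 0; rewrite !ract0l !subr0; split=> //.
by apply: rad1_mem => //; apply: submoduleT.
Qed.

(** By [visible_form], forms at both ends of the hook pull back to the same [theta] on the top.
    Their kernel is stable because the only arrows into the targets of [w1], [w2] and [y] are those
    of the hook. *)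
Lemma hook_case w1 y w2 m0 : w1 != w2 -> src w1 = src w2 -> ar w1 * ar y != 0 ->
  (forall x, ar w2 * ar x = 0) -> ~ hidden (ar w1 * ar y) (ar w2) m0 ->
  has_diagram pi M (hook_diagram K w1 y w2).
Proof.
move=> w12 sw nz w2x hm; have yw := ar2_neq0 nz.
have [|theta [phi0 [psi0 [t1 te tx phiP0 psiP0]]]] :=
    visible_form (a := src w1) hm; first by rewrite mulrA src_ar.
pose phi := rform phi0 (e (tgt y)); pose psi := rform psi0 (e (tgt w2)).
have pa : at_vx phi (tgt y) by exact: at_vx_rform.
have qa : at_vx psi (tgt w2) by exact: at_vx_rform.
have phiP v : phi (v <* ar w1 <* ar y) = theta v.
  by rewrite rformE vx_of_ar ractM phiP0.
have psiP v : psi (v <* ar w2) = theta v by rewrite rformE vx_of_ar psiP0.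
clearbody phi psi.
have short v x z : v <* ar w1 <* ar x <* ar z = 0.
  by rewrite !ractM mulrA (split_short adm bqa sb ci cii x z w12 sw) ract0r.
have w1x x : x != y -> ar w1 * ar x = 0.
  by move=> xy; apply/eqP; apply: contraNT xy => xnz; apply/eqP/(next_unique bqa sb xnz).
(* Another arrow into this target would give a square through [w2], which has no continuation. *)
have y_in x : tgt x = tgt y -> x = y.
  move=> txy; apply/eqP; apply: contraT => xy.
  have [u' [k [u1 su k0 E]]] := merge_square adm bqa sb ci xy txy nz.
  have [|u'1|u'2] := out_le2 sb w12 sw (z := u') _; first by rewrite su.
    by rewrite u'1 eqxx in u1.
  by move/eqP: nz; rewrite E u'2 w2x scaler0.
pose m := m0 <* e (src w1).
have me : m <* e (src w1) = m by rewrite vx_vx_act eqxx.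
rewrite -/m in t1; clearbody m.
apply: (@diagram_of_triangular _
  [:: m; m <* ar w1; m <* ar w2; m <* ar w1 <* ar y]
  [:: theta; rform phi (ar y); psi; phi]) => //.
- move=> t; rewrite !inE => /or3P[]/eqP->; rewrite /lsrc /larr /ltgt /=;
  by split=> //; rewrite ?yw.
- rewrite /= ?rformE; do !split.
  + by rewrite t1 oner_neq0.
  + by move=> v; rewrite !inE => /or3P[]/eqP->; rewrite tx.
  + by rewrite phiP t1 oner_neq0.
  + move=> v; rewrite !inE => /orP[]/eqP->; rewrite ?rformE.
      by rewrite act_eq0 ?sform0.
    by rewrite short sform0.
  + by rewrite psiP t1 oner_neq0.
  + move=> v; rewrite inE => /eqP->.
    (* If [y] and [w2] share their target, then [y = w2], and [psi] after [w2] is [theta], which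
       vanishes on images of arrows. *)
    have [ty|/(at_vx_ar (m <* ar w1) qa)->//] := eqVneq (tgt y) (tgt w2).
    have -> : y = w2 by apply: split_in adm ci _ _ _ _ (esym sw) ty; rewrite eq_sym.
    by rewrite psiP tx.
  + by rewrite phiP t1 oner_neq0.
  + by [].
- case=> [|[|[|[|i]]]] a //= _; rewrite ?ar_vx_act //.
  by rewrite -{1}me vx_vx_act me eq_sym.
- case=> [|[|[|[|i]]]] x //= _; rewrite !big_cons big_nil /lsrc /larr /ltgt /lcoef /=
    ?andbT ?andbF ?addr0.
  + case: (eqVneq w1 x) => [<-|xw1].
      by rewrite eq_sym (negPf w12) /= ?addr0 scale1r.
    case: (eqVneq w2 x) => [<-|xw2]; first by rewrite ?addr0 scale1r.
    by apply: (split_act w12 sw me); rewrite eq_sym.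
  + case: (eqVneq y x) => [<-|yx]; first by rewrite scale1r.
    by apply/act_eq0/w1x; rewrite eq_sym.
  + exact: act_eq0.
  + exact: short.
- move=> a v; rewrite {1}/vanish /= => /and5P[/eqP f1 /eqP f2 /eqP f3 /eqP f4 _].
  rewrite ?rformE in f2; rewrite /vanish /= ?rformE !vx_ar_act pa qa te.
  by apply/and5P; split=> //; case: ifP => _; rewrite ?sform0 ?f1 ?f2 ?f3 ?f4.
move=> x v; rewrite {1}/vanish /= => /and5P[/eqP f1 /eqP f2 /eqP f3 /eqP f4 _].
rewrite ?rformE in f2; rewrite /vanish /= ?rformE tx eqxx /=.
apply/and4P; split=> //.
- have [sx|sx] := eqVneq (tgt x) (src y); last by rewrite act_eq0 ?sform0 // ar_ar0.
  have -> : x = w1 by apply: split_in adm ci _ _ _ w12 sw _; rewrite yw.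
  by rewrite phiP f1.
- have [sx|/(at_vx_ar v qa)->//] := eqVneq (tgt x) (tgt w2).
  have -> : x = w2 by apply: split_in adm ci _ _ _ _ (esym sw) sx; rewrite eq_sym.
  by rewrite psiP f1.
have [/y_in->|/(at_vx_ar v pa)->//] := eqVneq (tgt x) (tgt y).
by rewrite f2.
Qed.

Lemma fork_case w1 w2 m0 : w1 != w2 -> src w1 = src w2 ->
  (forall x, m0 <* ar w1 <* ar x = 0) -> (forall x, m0 <* ar w2 <* ar x = 0) ->
  ~ hidden (ar w1) (ar w2) m0 -> has_diagram pi M (fork_diagram K w1 w2).
Proof.
move=> w12 sw m0w1 m0w2 hm; have w21 : w2 != w1 by rewrite eq_sym.
have [|theta [phi0 [psi0 [t1 te tx phiP0 psiP0]]]] :=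
    visible_form (a := src w1) hm; first by rewrite src_ar.
pose phi := rform phi0 (e (tgt w1)); pose psi := rform psi0 (e (tgt w2)).
have pa : at_vx phi (tgt w1) by exact: at_vx_rform.
have qa : at_vx psi (tgt w2) by exact: at_vx_rform.
have phiP v : phi (v <* ar w1) = theta v by rewrite rformE vx_of_ar phiP0.
have psiP v : psi (v <* ar w2) = theta v by rewrite rformE vx_of_ar psiP0.
clearbody phi psi.
have tw := split_tgt adm ci w12 sw.
pose m := m0 <* e (src w1).
have me : m <* e (src w1) = m by rewrite vx_vx_act eqxx.
have mw1 x : m <* ar w1 <* ar x = 0 by rewrite vx_ar_act eqxx.
have mw2 x : m <* ar w2 <* ar x = 0 by rewrite vx_ar_act sw eqxx.
rewrite -/m in t1; clearbody m.
apply: (@diagram_of_triangular _ [:: m; m <* ar w1; m <* ar w2] [:: theta; phi; psi]) => //.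
- by move=> t; rewrite !inE => /orP[]/eqP->; rewrite /lsrc /larr /ltgt /=; split.
- rewrite /=; do !split.
  + by rewrite t1 oner_neq0.
  + by move=> v; rewrite !inE => /orP[]/eqP->; rewrite tx.
  + by rewrite phiP t1 oner_neq0.
  + move=> v; rewrite inE => /eqP->; rewrite (at_vx_ar _ pa) //.
    by rewrite eq_sym.
  + by rewrite psiP t1 oner_neq0.
  + by [].
- case=> [|[|[|i]]] a //= _; rewrite ?ar_vx_act //.
  by rewrite -{1}me vx_vx_act me eq_sym.
- case=> [|[|[|i]]] x //= _; rewrite !big_cons big_nil /lsrc /larr /ltgt /lcoef /=
    ?andbT ?andbF ?addr0 //.
  case: (eqVneq w1 x) => [<-|xw1].
    by rewrite eq_sym (negPf w12) /= ?addr0 scale1r.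
  case: (eqVneq w2 x) => [<-|xw2]; first by rewrite ?addr0 scale1r.
  by apply: (split_act w12 sw me); rewrite eq_sym.
- move=> a v; rewrite {1}/vanish /= => /and4P[/eqP f1 /eqP f2 /eqP f3 _].
  rewrite /vanish /= pa qa te.
  by apply/and4P; split=> //; case: ifP => _; rewrite ?f1 ?f2 ?f3.
move=> x v; rewrite {1}/vanish /= => /and4P[/eqP f1 /eqP f2 /eqP f3 _].
rewrite /vanish /= tx eqxx /= andbT; apply/andP; split.
  have [sx|/(at_vx_ar v pa)->//] := eqVneq (tgt x) (tgt w1).
  by rewrite (split_in adm ci w12 sw sx) phiP f1.
have [sx|/(at_vx_ar v qa)->//] := eqVneq (tgt x) (tgt w2).
by rewrite (split_in adm ci w21 (esym sw) sx) psiP f1.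
Qed.

End Classification.

Section PathDiagram.
Variables (K : fieldType) (Q : quiver).

Lemma path_links x0 (l : seq (arr Q)) : slinks (path_diagram K (src x0) l) =
  [seq (i, nth x0 l i, 1, i.+1) | i <- iota 0 (size l)].
Proof.
apply: (@eq_from_nth _ (0%N, x0, 1, 0%N)).
  by rewrite !size_map size_zip size_iota minnn.
move=> i; rewrite size_map size_zip size_iota minnn => il.
rewrite (nth_map (0%N, x0)) ?size_zip ?size_iota ?minnn //.
by rewrite (nth_map 0%N) ?size_iota // nth_zip ?size_iota //= nth_iota.
Qed.

Lemma path_links_vx a b (l : seq (arr Q)) :
  slinks (path_diagram K a l) = slinks (path_diagram K b l).
Proof. by []. Qed.

Lemma path_linkP a (l : seq (arr Q)) (t : link K Q) :
  t \in slinks (path_diagram K a l) ->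
  exists x0, [/\ (lsrc t < size l)%N, larr t = nth x0 l (lsrc t), lcoef t = 1 &
                 ltgt t = (lsrc t).+1].
Proof.
case: l => [//|x0 l]; rewrite (path_links_vx _ (src x0)) path_links.
by move=> /mapP[i]; rewrite mem_iota => /andP[_ il] ->; exists x0.
Qed.

Lemma path_link_sum (V : lmodType K) a x0 (l : seq (arr Q)) x i (F : nat -> V) :
  \sum_(t <- slinks (path_diagram K a l) | (larr t == x) && (lsrc t == i))
     lcoef t *: F (ltgt t) =
  if (i < size l)%N && (nth x0 l i == x) then F i.+1 else 0.
Proof.
rewrite (path_links_vx _ (src x0)) path_links big_map /lcoef /larr /lsrc /ltgt /=.
have -> : iota 0 (size l) = index_iota 0 (size l) by rewrite /index_iota subn0.
rewrite big_mkord; case: (ltnP i (size l)) => [il|il] /=; last first.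
  by rewrite big1 // => j /andP[_ /eqP ji]; move: (ltn_ord j); rewrite ji ltnNge il.
rewrite big_mkcond (bigD1 (Ordinal il)) //= eqxx andbT big1 ?addr0.
  by case: eqP => _; rewrite ?scale1r.
move=> j ji; case: ifP => // /andP[_ /eqP ij]; case/eqP: ji; exact: val_inj.
Qed.

End PathDiagram.

Section ClassificationTheorem.
Variables (K : fieldType) (Q : quiver) (I : set (path_algebra K Q)).
Variables (A : falgType K) (pi : {rmorphism path_algebra K Q -> A}).
Hypotheses (adm : admissible I) (bqa : is_bound_quiver_algebra I pi).
Hypotheses (sb : special_biserial I) (ci : condition_i I) (cii : condition_ii I).

Local Notation e := (vx pi).
Local Notation ar := (ar pi).
Local Notation mon := (mon pi).
Implicit Types (x y z w : arr Q) (a : vert Q) (l : seq (arr Q)).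

Section Path.
Variable M : lmodType A^c.
Hypothesis indM : indecomposable M.
Local Notation V := (kmod M).
Implicit Types (u v m : V).

Variable l : seq (arr Q).
Hypothesis longest : forall l' v, (size l < size l')%N -> v <* mon l' = 0.

Lemma wf_path_diagram a : chain a l -> wf_diagram (path_diagram K a l).
Proof.
move=> lc t /path_linkP[x0 [il xE _ jE]]; rewrite jE xE /=; split=> //.
- exact: leqW.
- elim: l a lc (lsrc t) il => [//|x l' IH] a /= /andP[/eqP xa lc] [|i] //= il.
  by rewrite -(IH (tgt x)) //; apply: set_nth_default; rewrite /= size_map leqW.
- by rewrite (nth_map x0).
Qed.

(** The forms are [phi], placed at the end of the path, pulled back along the final segments of [l].
    Values below the diagonal would involve [take j l] followed by [drop i l] with [i < j], which is
    longer than [l] and acts by zero. *)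
Lemma path_case a m : m <* e a = m -> m <* mon l != 0 -> chain a l ->
  (forall x l', x :: l' = l -> forall z, z != x -> m <* ar z = 0) ->
  (forall x z v, tgt z = tgt x -> z != x -> forall l', l = rcons l' x ->
     m <* mon l <> v <* ar z) ->
  has_diagram pi M (path_diagram K a l).
Proof.
move=> me mnz lc first last'.
pose n := size l; pose d := chain_end a l.
have ml0 l' v : (n < size l')%N -> v <* mon l' = 0 by exact: longest.
pose u := m <* mon l.
have ud : u <* e d = u.
  rewrite /u /d; case/lastP: (l) => [|l' x]; first by rewrite mon_nil ract1 /chain_end /= me.
  by rewrite mon_rcons -ractM /chain_end map_rcons last_rcons vx_of_ar.
have [phi [phi1 pa pz]] : exists phi : {scalar V}, [/\ phi u = 1, at_vx pi phi d &
    forall z v, (forall l', l <> rcons l' z) -> phi (v <* ar z) = 0].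
  have [[x [z [[l' lE] tz zx]]]|nz] := pselect (exists x z,
      [/\ exists l', l = rcons l' x, tgt z = tgt x & z != x]).
    have dE : d = tgt x by rewrite /d lE /chain_end map_rcons last_rcons.
    (* By [last'] the vector [u] is not in the image of the other arrow [z] into [d], so a form can
       kill that image and still be 1 at [u]. *)
    pose U : set V := (fun v => exists v', v <* e d = v' <* ar z).
    have sU : subspace U.
      split=> [|v1 v2 [v1' E1] [v2' E2]|k v [v' E]].
      - by exists 0; rewrite !ract0l.
      - by exists (v1' + v2'); rewrite !ractDl E1 E2.
      - by exists (k *: v'); rewrite !ractZl E.
    have Uu : ~ U u by case=> v' E; apply: (last' x z v' tz zx l' lE); rewrite -E ud.
    have [phi [phiU phi1]] := separating_form sU Uu.
    exists (rform phi (e d)); split; first by rewrite rformE ud.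
      exact: at_vx_rform.
    move=> t v lt; rewrite rformE.
    have [dt|dt] := eqVneq (tgt t) d; last by rewrite ar_vx_act eq_sym (negPf dt) sform0.
    have tx : t != x by apply: contra_notN (lt l') => /eqP ->.
    have xz : x != z by rewrite eq_sym.
    have ttx : tgt t = tgt x by rewrite dt dE.
    have [tx'|->] := in_le2 sb xz (esym tz) ttx; first by rewrite tx' eqxx in tx.
    by apply: phiU; exists v; rewrite vx_vx_act eqxx ar_vx_act dE tz eqxx.
  have [phi [phi1 pa]] := nonzero_form (u := u) mnz ud.
  exists phi; split=> // z v lt.
  have [dz|/(at_vx_ar v pa)//] := eqVneq (tgt z) d.
  move: dz; rewrite /d; case/lastP El : (l) => [|l' x].
    by move=> _; rewrite -(mon1 pi) ml0 ?sform0 // /n El.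
  rewrite /chain_end map_rcons last_rcons => tz; case: nz; exists x, z; split=> //.
    by exists l'; rewrite El.
  by apply: contra_notN (lt l') => /eqP ->; rewrite El.
have nthE i : (i < n)%N -> exists x, forall x0, nth x0 l i = x.
  move=> il; have := il; rewrite {1}/n; case El : {1}l => [|x0 l'] // _.
  by exists (nth x0 l i) => x1; apply: set_nth_default.
have dropE i x : (i < n)%N -> nth x l i = x ->
    forall v, v <* mon (drop i l) = v <* ar x <* mon (drop i.+1 l).
  by move=> il xE v; rewrite (drop_nth x) // xE mon_cons -ractM.
have consec i x y : (i.+1 < n)%N -> nth x l i = x -> nth y l i.+1 = y -> ar x * ar y != 0.
  move=> il xE yE; rewrite -(mon2 pi); apply: contraNneq mnz => xy0.
  rewrite -[l](cat_take_drop i) (drop_nth x) ?(ltnW il) // (drop_nth y) // xE yE.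
  by rewrite -[_ :: _ :: _]/([:: x; y] ++ _) !mon_cat xy0 mul0r mulr0 ract0r.
pose s i : V := m <* mon (take i l).
pose f i : {scalar V} := rform phi (mon (drop i l)).
have sS i x : (i < n)%N -> nth x l i = x -> s i <* ar x = s i.+1.
  by move=> il xE; rewrite /s (take_nth x) // xE mon_rcons ractM.
have s0 i x : (i < n)%N -> nth x l i != x -> s i <* ar x = 0.
  move=> il xE; case: i il xE => [|i] il xE.
    rewrite /s take0 mon_nil ract1; move: xE il; rewrite /n.
    case El : l => [|y l'] //= yx _.
    by apply: (first y l') => //; rewrite eq_sym.
  have [y yE] := nthE i (ltnW il); have [z zE] := nthE i.+1 il.
  rewrite -(sS i y (ltnW il) (yE y)) ractM (_ : ar y * ar x = 0) ?ract0r //; apply/eqP; apply: contraNT xE => yx.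
  have zx := next_unique bqa sb (consec _ _ _ il (yE y) (zE z)) yx.
  by rewrite -zx zE.
have sn x : s n <* ar x = 0.
  by rewrite /s take_size ractM -mon_rcons ml0 // size_rcons.
apply: (diagram_of_triangular bqa indM (s := mkseq s n.+1) (fs := mkseq f n.+1)).
- by rewrite size_mkseq.
- by [].
- exact: wf_path_diagram.
- apply: triangular_mkseq => [i|i j /andP[ij jn]].
    by rewrite ltnS => il; rewrite /f /s rformE ractM -mon_cat cat_take_drop phi1 oner_neq0.
  rewrite /f /s rformE ractM -mon_cat ml0 ?sform0 // size_cat size_take size_drop.
  rewrite -/n; rewrite ltnS in jn; have lin := leq_trans ij jn.
  rewrite -{1}(subnKC (ltnW lin)) ltn_add2r.
  by case: ifP.
- move=> i b il; rewrite nth_mkseq //=; case: i il => [|i] il /=.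
    by rewrite /s take0 mon_nil ract1 -{1}me vx_vx_act me eq_sym.
  rewrite ltnS in il; have [x xE] := nthE i il.
  by rewrite -(sS i x il (xE x)) ar_vx_act (nth_map x) // xE.
- move=> i x il; rewrite nth_mkseq // (path_link_sum a x) -/n.
  have [in'|ni] := ltnP i n; last first.
    have -> : i = n by apply/eqP; rewrite eqn_leq ni -ltnS il.
    exact: sn.
  rewrite andTb; case: eqP => [xE|/eqP xE].
    by rewrite nth_mkseq // sS.
  by rewrite s0.
- move=> b v /vanish_mkseq fv; apply/vanish_mkseq => i il.
  have := fv i il; rewrite /f !rformE.
  have [in'|ni] := ltnP i n.
    have [x xE] := nthE i in'; rewrite !(dropE i x in' (xE x)) vx_ar_act.
    by case: eqP => _ // _; rewrite ract0l sform0.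
  by rewrite drop_oversize // mon_nil !ract1 pa => ->; case: eqP.
move=> x v /vanish_mkseq fv; apply/vanish_mkseq => i il; rewrite /f rformE.
case: i il => [|i] il.
  by rewrite drop0 -ract_mon_cons ml0 ?sform0.
rewrite ltnS in il; have [y yE] := nthE i il.
have [->|xy] := eqVneq x y.
  by rewrite -(dropE i y il (yE y)); apply: fv; rewrite ltnS ltnW.
have [il'|] := ltnP i.+1 n.
  have [z zE] := nthE i.+1 il'; rewrite (dropE i.+1 z il' (zE z)).
  rewrite (ractM v) (_ : ar x * ar z = 0) ?ract0r ?ract0l ?sform0 //.
  apply/eqP; apply: contraNT xy => xz; apply/eqP.
  exact: (prev_unique bqa sb xz (consec i y z il' (yE y) (zE z))).
move=> ni; rewrite drop_oversize // mon_nil ract1; apply: pz => l' lE.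
have sl : size l' = i.
  by apply/eqP; rewrite -eqSS -(size_rcons l' x) -lE eqn_leq ni il.
by have := yE x; rewrite lE nth_rcons sl ltnn eqxx => xy'; rewrite xy' eqxx in xy.
Qed.

End Path.
Inductive listed : diagram K Q -> Prop :=
| ListedSquare w1 y w2 y' k of w1 != w2 & src w1 = src w2 & k != 0 &
    ar w1 * ar y != 0 & ar w1 * ar y = k *: (ar w2 * ar y') :
    listed (square_diagram w1 y w2 y' k)
| ListedMerge w1 w2 of w1 != w2 & tgt w1 = tgt w2 : listed (merge_diagram K w1 w2)
| ListedHook w1 y w2 of w1 != w2 & src w1 = src w2 & ar w1 * ar y != 0 &
    (forall x, ar w2 * ar x = 0) : listed (hook_diagram K w1 y w2)
| ListedFork w1 w2 of w1 != w2 & src w1 = src w2 : listed (fork_diagram K w1 w2)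
| ListedPath a l of chain a l & mon l != 0 : listed (path_diagram K a l).

Lemma longest_path (M : lmodType A^c) : (exists v : kmod M, v != 0) ->
  exists (m : kmod M) l, m <* mon l != 0 /\
    forall l' (v : kmod M), (size l < size l')%N -> v <* mon l' = 0.
Proof.
move=> [v v0]; have [n nP] := mon_nilp adm bqa.
pose P k := `[< exists (m : kmod M) l, size l = k /\ m <* mon l != 0 >].
have exP : exists k, P k.
  by exists 0%N; apply/asboolP; exists v, [::]; rewrite mon_nil ract1.
have bd k : P k -> (k <= n)%N.
  move=> /asboolP[m [l [<- ml]]]; rewrite leqNgt; apply: contra ml => nl.
  by rewrite nP ?ract0r // ltnW.
case: (ex_maxnP exP bd) => k /asboolP[m [l [lk ml]]] max.
exists m, l; split=> // l' v' ll'; apply/eqP; apply: contraLR ll' => v'l'.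
by rewrite -leqNgt lk; apply: max; apply/asboolP; exists v', l'.
Qed.

(** If there is no square, squares act by zero, which provides the hypotheses on merges and hooks.
    If there is no hook or fork either, every vector is hidden from any two arrows with a common
    source, and a longest nonzero path then splits off. *)
Lemma classification (M : lmodType A^c) : indecomposable M ->
  exists S, listed S /\ has_diagram pi M S.
Proof.
move=> indM; apply: contrapT => none.
have no S : listed S -> ~ has_diagram pi M S by move=> lS hS; apply: none; exists S.
pose V := kmod M; have [J0 JD JZ] :=
  submodule_subspace bqa (submodule_rad1 bqa (submoduleT M)).
have noSquare w1 w2 y y' k : w1 != w2 -> src w1 = src w2 -> k != 0 ->
    ar w1 * ar y != 0 -> ar w1 * ar y = k *: (ar w2 * ar y') ->
    forall v : V, v <* ar w1 <* ar y = 0.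
  move=> w12 sw k0 nz E v; apply/eqP; apply: contraPT (no _ (ListedSquare w12 sw k0 nz E)).
  by move=> vnz; apply; apply: (square_case adm bqa sb ci indM w12 sw k0 nz E vnz).
have noMerge w1 w2 : w1 != w2 -> tgt w1 = tgt w2 ->
    forall v1 v2 : V, v1 <* ar w1 = v2 <* ar w2 -> v1 <* ar w1 = 0.
  move=> w12 tw v1 v2 v12; apply/eqP; apply: contraPT (no _ (ListedMerge w12 tw)).
  (* An arrow in front of a merge completes it to a square, which acts by zero. *)
  have kill x1 x2 : x1 != x2 -> tgt x1 = tgt x2 -> forall x (v : V), v <* ar x <* ar x2 = 0.
    move=> x12 tx x v; have [/act_eq0->//|nz] := eqVneq (ar x * ar x2) 0.
    have [u [k [ux su k0 E]]] := merge_square adm bqa sb ci x12 tx nz.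
    by apply: (noSquare x u x2 x1 k) => //; rewrite eq_sym.
  move=> nz; apply; apply: (merge_case adm bqa sb ci indM w12 tw _ _ v12 nz).
    by apply: (kill w2); rewrite // eq_sym.
  exact: (kill w1).
have noHook w1 y w2 : w1 != w2 -> src w1 = src w2 -> ar w1 * ar y != 0 ->
    (forall x, ar w2 * ar x = 0) -> forall m : V, hidden pi (ar w1 * ar y) (ar w2) m.
  move=> w12 sw nz w2x m; apply: contrapT => hm.
  apply: (no _ (ListedHook w12 sw nz w2x)).
  exact: (hook_case adm bqa sb ci cii indM w12 sw nz w2x hm).
have noFork w1 w2 : w1 != w2 -> src w1 = src w2 -> forall m : V,
    (forall x, m <* ar w1 <* ar x = 0) -> (forall x, m <* ar w2 <* ar x = 0) ->
    hidden pi (ar w1) (ar w2) m.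
  move=> w12 sw m m1 m2; apply: contrapT => hm.
  apply: (no _ (ListedFork w12 sw)).
  exact: (fork_case adm bqa sb ci indM w12 sw m1 m2 hm).
(* Without squares [w2] has no continuation. The absence of hooks splits [m] into a part killed by
   [w1 y], a part killed by [w2] and a radical part; the absence of forks then splits the first
   part. *)
have half w1 w2 (m v0 : V) y : w1 != w2 -> src w1 = src w2 ->
    v0 <* ar w1 <* ar y != 0 -> hidden pi (ar w1) (ar w2) m.
  move=> w12 sw v0y; have nz : ar w1 * ar y != 0.
    by apply: contraNneq v0y => nz; rewrite act_eq0.
  have w2x x : ar w2 * ar x = 0.
    apply/eqP; apply: contraNT v0y => nz'.
    have [k k0 E] := split_square adm bqa sb ci cii w12 sw nz nz'.
    by rewrite (noSquare _ _ _ _ _ w12 sw k0 nz E).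
  have [k1 [k2 [h1 h2 h3]]] := noHook _ _ _ w12 sw nz w2x m.
  have [||l1 [l2 [g1 g2 g3]]] := noFork _ _ w12 sw k1.
  - move=> x; have [->|xy] := eqVneq x y; first by rewrite ractM.
    apply/act_eq0/eqP; apply: contraNT xy => xnz; apply/eqP.
    exact: (next_unique bqa sb xnz nz).
  - by move=> x; apply: act_eq0.
  exists l1, (l2 + k2); rewrite ractDl g2 h2 addr0; split=> //.
  have -> : m - l1 - (l2 + k2) = (m - k1 - k2) + (k1 - l1 - l2).
    by rewrite [RHS](AC (3*3) (1*5*(6*3)*(2*4)))/= addNr addr0 opprD.
  exact: JD.
have all w1 w2 (m : V) : w1 != w2 -> src w1 = src w2 -> hidden pi (ar w1) (ar w2) m.
  move=> w12 sw.
  have [[v0 [y v0y]]|n1] := pselect (exists (v0 : V) y, v0 <* ar w1 <* ar y != 0).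
    exact: half w12 sw v0y.
  have [[v0 [y v0y]]|n2] := pselect (exists (v0 : V) y, v0 <* ar w2 <* ar y != 0).
    have w21 : w2 != w1 by rewrite eq_sym.
    have [k1 [k2 [h1 h2 h3]]] := half w2 w1 m v0 y w21 (esym sw) v0y.
    by exists k2, k1; split=> //; rewrite addrAC.
  apply: noFork => // x; apply/eqP; apply: contrapT => /negP nz.
    by apply: n1; exists m, x.
  by apply: n2; exists m, x.
have [m0 [l [ml max]]] := longest_path indM.1.
have mlx x (v : V) : v <* ar x <* mon l = 0 by rewrite -ract_mon_cons max.
have radl (v : V) : rad1 pi setT v -> v <* mon l = 0.
  by case=> g _ ->; rewrite ract_suml big1.
have [a [m [me mnz lc mz]]] : exists a (m : V), [/\ m <* e a = m, m <* mon l != 0, chain a l &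
    forall x l', x :: l' = l -> forall z, z != x -> m <* ar z = 0].
  case: l ml max mlx radl => [|x l] ml max mlx radl.
    have m00 : m0 != 0 by rewrite mon_nil ract1 in ml.
    have [a] : exists a, m0 <* e a != 0.
      apply: contrapT => /forallNP n0; move/eqP: m00; apply.
      rewrite -(ract_vx_sum pi m0) big1 // => a _; apply: contrapT => /eqP; exact: n0.
    move=> ma; exists a, (m0 <* e a); split=> //; first by rewrite vx_vx_act eqxx.
    by rewrite mon_nil ract1.
  have xl0 : mon (x :: l) != 0 by apply: contraNneq ml => ->; rewrite ract0r.
  have lc : chain (src x) (x :: l).
    have [p pE _] := mon_path xl0; have := qpathP p.
    by rewrite /psrc /parr pE.
  have [[z [zx sz]]|nz] := pselect (exists z, z != x /\ src z = src x); last first.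
    exists (src x), (m0 <* e (src x)); split=> //.
    - by rewrite vx_vx_act eqxx.
    - by rewrite mon_cons -!ractM vx_ar_act eqxx ractM -mon_cons.
    - move=> _ _ [-> _] z zx; rewrite vx_ar_act; case: eqP => // sz.
      by case: nz; exists z.
  have xz : x != z by rewrite eq_sym.
  (* Only [k2] survives the path: [k1] is killed by the first arrow [x], and radical vectors by
     maximality of [l]. Since [z] kills [k2], its component at the source of [x] is moved by no
     arrow other than [x]. *)
  have [k1 [k2 [h1 h2 h3]]] := all x z m0 xz (esym sz).
  have k2l : k2 <* mon (x :: l) = m0 <* mon (x :: l).
    have mE : m0 = (m0 - k1 - k2) + k1 + k2 by rewrite addrAC !subrK.
    by rewrite [in RHS]mE 2!ractDl (radl _ h3) add0r [k1 <* _]ract_mon_cons h1 ract0l add0r.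
  exists (src x), (k2 <* e (src x)); split=> //.
  - by rewrite vx_vx_act eqxx.
  - by rewrite mon_cons -!ractM vx_ar_act eqxx ractM -mon_cons k2l.
  - move=> _ _ [-> _] t tx; rewrite vx_ar_act; case: eqP => // st.
    have [tx'|->] := out_le2 sb xz (esym sz) (esym st); first by rewrite tx' eqxx in tx.
    by [].
have mon0 : mon l != 0 by apply: contraNneq mnz => ->; rewrite ract0r.
apply: (no _ (ListedPath lc mon0)).
(* If another arrow also reached the last vector of the path, there would be a merge. *)
apply: (path_case indM max me mnz lc mz) => x z v tz zx l' lE E.
have xz : x != z by rewrite eq_sym.
move: mnz E; rewrite lE mon_rcons -ractM => mnz E.
by move: mnz; rewrite (noMerge x z xz (esym tz) _ _ E) eqxx.
Qed.

End ClassificationTheorem.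

(** * Factor serial type *)

Ltac links := rewrite /= ?big_cons ?big_nil /lsrc /larr /ltgt /lcoef /= ?andbT ?andbF ?addr0.

Section DiagramModules.
Variables (K : fieldType) (Q : quiver) (I : set (path_algebra K Q)).
Variables (A : falgType K) (pi : {rmorphism path_algebra K Q -> A}).
Hypotheses (adm : admissible I) (bqa : is_bound_quiver_algebra I pi).
Variable M : lmodType A^c.

Local Notation V := (kmod M).
Local Notation e := (vx pi).
Local Notation ar := (ar pi).
Local Notation mon := (mon pi).
Implicit Types (x y z w : arr Q) (a : vert Q) (l : seq (arr Q)) (u v : V).

Section Shaped.
Variables (S : diagram K Q) (b : nat -> V) (c : nat -> {scalar V}).
Hypothesis Sbc : shaped pi S b c.

(** The [i]-th coordinate then vanishes on the radical, so it is a form on the top. *)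
Definition source_index i : Prop := forall t, t \in slinks S -> ltgt t != i.

Lemma source_form i x v : (i < sdim S)%N -> source_index i -> c i (v <* ar x) = 0.
Proof.
move=> si src_i; rewrite (shaped_ar Sbc) // big_seq_cond big1 // => t.
by case/andP=> /src_i/negPf ti; rewrite ti andbF.
Qed.

Lemma shaped_c_b i j : (i < sdim S)%N -> (j < sdim S)%N -> c i (b j) = (i == j)%:R.
Proof. exact: (shaped_dual Sbc). Qed.

Lemma shaped_c_vx i a v : (i < sdim S)%N -> c i v = 0 -> c i (v <* e a) = 0.
Proof. by move=> si cv; rewrite (shaped_vx Sbc) // cv if_same. Qed.

Lemma shaped_wide_top i j : (i < sdim S)%N -> (j < sdim S)%N -> i != j ->
  source_index i -> source_index j -> wide_top pi M.
Proof.
move=> si sj ij srci srcj; exists (c i), (c j), (b j), (b i); split.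
- by move=> x v; rewrite !source_form.
- by move=> a v; split; apply: shaped_c_vx.
- by rewrite !shaped_c_b // (negPf ij) eqxx; split=> //; apply/eqP/oner_neq0.
- by rewrite !shaped_c_b // eq_sym (negPf ij) eqxx; split=> //; apply/eqP/oner_neq0.
Qed.

Lemma shaped_wide_radical h i j : (h < sdim S)%N -> (i < sdim S)%N -> (j < sdim S)%N ->
  i != j -> h != i -> h != j -> source_index h ->
  (forall t, t \in slinks S -> ltgt t = i \/ ltgt t = j -> lsrc t = h) ->
  wide_radical pi M.
Proof.
move=> sh si sj ij hi hj srch srcij; exists (c h), (c i), (c j), (b j), (b i).
have cx r x v : (r < sdim S)%N -> r = i \/ r = j -> c h v = 0 -> c r (v <* ar x) = 0.
  move=> sr rij hv; rewrite (shaped_ar Sbc) // big_seq_cond big1 // => t.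
  case/and3P=> tS _ /eqP tr; rewrite (srcij t tS) ?hv ?mulr0 //.
  by rewrite tr.
split.
- by move=> x v; apply: source_form.
- by move=> x v hv; split; apply: cx => //; [left|right].
- by move=> a v; split; apply: shaped_c_vx.
- rewrite !shaped_c_b // (negPf ij) (negPf hj) eqxx; split=> //; exact/eqP/oner_neq0.
- rewrite !shaped_c_b // [j == i]eq_sym (negPf ij) (negPf hi) eqxx; split=> //.
  exact/eqP/oner_neq0.
Qed.

Section Local.
Hypotheses (S0 : (0 < sdim S)%N) (src0 : source_index 0).
Hypothesis bP : forall i, (0 < i < sdim S)%N ->
  exists j x, (j < sdim S)%N /\ b j <* ar x = b i.

Lemma shaped_radical v : c 0%N v = 0 -> rad1 pi (setT : set V) v.
Proof.
move=> v0; rewrite (shaped_sum Sbc v).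
have sR := submodule_subspace bqa (submodule_rad1 bqa (submoduleT M)).
apply: subspace_sum => // i _.
have [->|i0] := posnP i; first by rewrite v0 scale0r; case: sR.
have [_ _ RZ] := sR; apply: RZ.
have [|j [x [sj <-]]] := bP (i := i); first by rewrite i0 /=.
by apply: rad1_mem => //; apply: submoduleT.
Qed.

Lemma shaped_local : uniserial_quotient (@radical_pow A^c M 1).
Proof.
apply: (local_uniserial_radical adm bqa (f := c 0%N) (m := b 0%N)) => //.
- exact: shaped_fdim Sbc.
- by rewrite shaped_c_b // eqxx; apply/eqP/oner_neq0.
- by move=> x v; apply: source_form.
by move=> v v0; rewrite (radical_powE adm bqa); apply: shaped_radical.
Qed.

Lemma shaped_local_indecomposable : indecomposable M.
Proof.
apply: (@local_indecomposable _ _ _ (c 0%N) (b 0%N)).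
  by rewrite shaped_c_b // eqxx; apply/eqP/oner_neq0.
move=> N v sN Nv /eqP v0 w; apply: (nakayama adm bqa sN (submoduleT M)) => // u _.
exists ((c 0%N u / c 0%N v) *: v).
  by have [_ _ NZ] := submodule_subspace bqa sN; apply: NZ.
by apply: shaped_radical; rewrite sformB sformZ divfK // subrr.
Qed.

End Local.

End Shaped.

(** Length four, with a simple top and a radical whose top is not simple: the type is one less than
    the length. *)
Lemma square_factor_serial w1 w2 y y' k : w1 != w2 -> src w1 = src w2 ->
  wf_diagram (square_diagram w1 y w2 y' k) ->
  has_diagram pi M (square_diagram w1 y w2 y' k) -> factor_serial M 3.
Proof.
move=> w12 sw wf [b [c Sbc]].
have fd := shaped_fdim Sbc.
apply: (rad2_factor_serial adm bqa fd).
- apply: (shaped_has_length bqa Sbc) => t; rewrite !inE.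
  by case/or4P=> /eqP->.
- apply: (@shaped_wide_radical _ _ _ Sbc 0 1 2) => // t; rewrite !inE.
    by case/or4P=> /eqP->.
  by case/or4P=> /eqP-> //= [].
- apply: (shaped_local Sbc) => // [t|]; first by rewrite !inE; case/or4P=> /eqP->.
  case=> [|[|[|[|i]]]] // _.
  + exists 0%N, w1; split=> //; rewrite (shaped_b_ar Sbc) //; links.
    by rewrite eqxx eq_sym (negPf w12) /= ?addr0 scale1r.
  + exists 0%N, w2; split=> //; rewrite (shaped_b_ar Sbc) //; links.
    by rewrite eqxx (negPf w12) /= ?addr0 scale1r.
  + exists 1%N, y; split=> //; rewrite (shaped_b_ar Sbc) //; links.
    by rewrite eqxx /= ?addr0 scale1r.
Qed.

Lemma hook_links w1 w2 y b c : w1 != w2 -> wf_diagram (hook_diagram K w1 y w2) ->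
  shaped (M := M) pi (hook_diagram K w1 y w2) b c ->
  forall i, (0 < i < 4)%N -> exists j x, (j < 4)%N /\ b j <* ar x = b i.
Proof.
move=> w12 wf Sbc; case=> [|[|[|[|i]]]] // _.
- exists 0%N, w1; split=> //; rewrite (shaped_b_ar Sbc) //; links.
  by rewrite eqxx eq_sym (negPf w12) /= ?addr0 scale1r.
- exists 0%N, w2; split=> //; rewrite (shaped_b_ar Sbc) //; links.
  by rewrite eqxx (negPf w12) /= ?addr0 scale1r.
- exists 1%N, y; split=> //; rewrite (shaped_b_ar Sbc) //; links.
  by rewrite eqxx /= ?addr0 scale1r.
Qed.

Lemma hook_source w1 w2 y : source_index (hook_diagram K w1 y w2) 0.
Proof. by move=> t; rewrite !inE; case/or3P=> /eqP->. Qed.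

Lemma hook_factor_serial w1 w2 y : w1 != w2 ->
  wf_diagram (hook_diagram K w1 y w2) ->
  has_diagram pi M (hook_diagram K w1 y w2) -> factor_serial M 3.
Proof.
move=> w12 wf [b [c Sbc]].
have fd := shaped_fdim Sbc.
apply: (rad2_factor_serial adm bqa fd).
- apply: (shaped_has_length bqa Sbc) => t; rewrite !inE.
  by case/or3P=> /eqP->.
- apply: (@shaped_wide_radical _ _ _ Sbc 0 1 2) => // t; rewrite !inE.
    by case/or3P=> /eqP->.
  by case/or3P=> /eqP-> //= [].
- by apply: (shaped_local Sbc); [|exact: hook_source|exact: hook_links Sbc].
Qed.

Lemma hook_indecomposable w1 w2 y : w1 != w2 ->
  wf_diagram (hook_diagram K w1 y w2) ->
  has_diagram pi M (hook_diagram K w1 y w2) -> indecomposable M.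
Proof.
move=> w12 wf [b [c Sbc]].
by apply: (shaped_local_indecomposable Sbc); [|exact: hook_links Sbc].
Qed.

Lemma fork_radical w1 w2 : w1 != w2 -> wf_diagram (fork_diagram K w1 w2) ->
  has_diagram pi M (fork_diagram K w1 w2) ->
  uniserial_quotient (@radical_pow A^c M 1).
Proof.
move=> w12 wf [b [c Sbc]].
apply: (shaped_local Sbc) => // [t|]; first by rewrite !inE; case/orP=> /eqP->.
case=> [|[|[|i]]] // _.
- exists 0%N, w1; split=> //; rewrite (shaped_b_ar Sbc) //; links.
  by rewrite eqxx eq_sym (negPf w12) /= ?addr0 scale1r.
- exists 0%N, w2; split=> //; rewrite (shaped_b_ar Sbc) //; links.
  by rewrite eqxx (negPf w12) /= ?addr0 scale1r.
Qed.

Lemma fork_factor_serial w1 w2 : w1 != w2 -> wf_diagram (fork_diagram K w1 w2) ->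
  has_diagram pi M (fork_diagram K w1 w2) -> factor_serial M 2.
Proof.
move=> w12 wf hS; have uni := fork_radical w12 wf hS.
move: hS => [b [c Sbc]]; have fd := shaped_fdim Sbc.
apply: (rad2_factor_serial adm bqa fd) => //.
- apply: (shaped_has_length bqa Sbc) => t; rewrite !inE.
  by case/orP=> /eqP->.
- apply: (@shaped_wide_radical _ _ _ Sbc 0 1 2) => // t; rewrite !inE.
    by case/orP=> /eqP->.
  by case/orP=> /eqP-> //= [].
Qed.

Lemma merge_factor_serial w1 w2 : has_diagram pi M (merge_diagram K w1 w2) ->
  factor_serial M 3.
Proof.
move=> [b [c Sbc]]; have fd := shaped_fdim Sbc.
apply: (top2_factor_serial adm bqa fd).
- apply: (shaped_has_length bqa Sbc) => t; rewrite !inE.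
  by case/orP=> /eqP->.
- by apply: (@shaped_wide_top _ _ _ Sbc 0 1) => // t; rewrite !inE; case/orP=> /eqP->.
Qed.

(** The [k]-th arrow moves a leading coordinate from [k] to [k + 1]. So a submodule with a vector
    whose leading coordinate is [k] contains all vectors that vanish below [k], and submodules are
    comparable. *)
Lemma path_uniserial a l : has_diagram pi M (path_diagram K a l) -> uniserial M.
Proof.
move=> [b [c Sbc]]; have fd := shaped_fdim Sbc; set n := size l.
apply: (comparable_uniserial adm bqa fd); first exact: submodule0.
have cx i v x0 : (i < n)%N -> c i.+1 (v <* ar (nth x0 l i)) = c i v.
  move=> il; rewrite (shaped_ar Sbc) ?ltnS //.
  (* Re-indexing by the source of the link and writing the coordinate as a function of its target
     brings the sum into the form of [path_link_sum]. *)
  transitivity (\sum_(t <- slinks (path_diagram K a l) |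
      (larr t == nth x0 l i) && (lsrc t == i)) lcoef t *: (fun j => c j.-1 v : K^o) (ltgt t)).
    rewrite big_seq_cond [RHS]big_seq_cond; apply: eq_big => t.
      have [tS|//] := boolP (t \in slinks (path_diagram K a l)).
      by have [x1 [_ _ _ ->]] := path_linkP tS; rewrite eqSS.
    by case/andP=> /path_linkP[x1 [_ _ -> ->]].
  by rewrite (@path_link_sum K Q K^o a x0 l _ i (fun j => c j.-1 v)) -/n il eqxx.
have cx0 i v x : (i <= n)%N -> (forall j, (j < i)%N -> c j v = 0) ->
    c i (v <* ar x) = 0.
  move=> il v0; rewrite (shaped_ar Sbc) ?ltnS // big_seq_cond big1 // => t.
  case/and3P=> /path_linkP[x1 [_ _ _ ti]] _ /eqP tE.
  by rewrite v0 ?mulr0 // -tE ti.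
pose F k v := forall i, (i < k)%N -> c i v = 0.
have lead v : v != 0 -> exists2 k, (k <= n)%N & F k v /\ c k v != 0.
  move=> v0; have ex : exists k, (k <= n)%N && (c k v != 0).
    apply: contrapT => /forallNP nk; move/eqP: v0; apply.
    apply: (shaped_ext Sbc) => i si; rewrite sform0; apply/eqP; apply: contrapT => /negP ci.
    by apply: (nk i); rewrite -ltnS si.
  case: (ex_minnP ex) => k /andP[kn ck] kmin; exists k => //; split=> // i ik.
  apply/eqP; apply: contraTT (ik) => ci; rewrite -leqNgt; apply: kmin.
  by rewrite ci (leq_trans (ltnW ik) kn).
have fill (X : set V) d k v : submodule (X : set M) -> (k + d = n)%N -> X v -> F k v ->
    c k v != 0 -> forall w : V, F k w -> X w.
  move=> sX; have [X0 XD XZ] := submodule_subspace bqa sX.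
  elim: d k v => [|d IH] k v kd Xv Fv cv w Fw.
    rewrite addn0 in kd; have -> : w = (c k w / c k v) *: v; last exact: XZ.
    apply: (shaped_ext Sbc) => i; rewrite ltnS sformZ leq_eqVlt -[size l]/n -kd.
    by move=> /predU1P[->|ik]; [rewrite divfK|rewrite (Fv i ik) (Fw i ik) mulr0].
  have kn : (k < n)%N by rewrite -kd addnS ltnS leq_addr.
  have [x0 _] : exists x0 : arr Q, True.
    by move: kn; rewrite /n; case: (l) => [|x0 l'] // _; exists x0.
  pose v' := v <* ar (nth x0 l k).
  have FX : forall u, F k.+1 u -> X u.
    apply: (IH k.+1 v'); first by rewrite addSnnS.
    - exact: (submodule_ar bqa).
    - move=> i; rewrite ltnS => ik; apply: cx0 => [|j ji].
        exact: leq_trans ik (ltnW kn).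
      by apply: Fv; apply: leq_trans ji ik.
    - by rewrite cx.
  apply: (subspaceK (U := X) (v := (c k w / c k v) *: v)) => //; first exact: XZ.
  apply: FX => i; rewrite ltnS leq_eqVlt sformB sformZ => /predU1P[->|ik].
    by rewrite divfK // subrr.
  by rewrite (Fv i ik) (Fw i ik) mulr0 subr0.
move=> X Y sX sY _ _.
have [XY|/existsNP[w /not_implyP[Xw Yw]]] := pselect (forall v : V, X v -> Y v).
  by left.
right=> y Yy; have [->|y0] := eqVneq (y : V) 0; first by case: sX.
have w0 : (w : V) != 0 by apply: contra_notN Yw => /eqP->; case: sY.
have [j jn [Fw cw]] := lead w w0; have [j' jn' [Fy cy]] := lead y y0.
have [jj|jj] := leqP j j'.
  apply: (fill X (n - j)%N j w) => //; first by rewrite subnKC.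
  by move=> i ij; apply: Fy; apply: leq_trans ij jj.
case: Yw; apply: (fill Y (n - j')%N j' y) => //; first by rewrite subnKC.
by move=> i ij; apply: Fw; apply: leq_trans ij (ltnW jj).
Qed.

End DiagramModules.

(** * Indecomposability of modules given by diagrams *)

Section ShapedIndecomposable.
Variables (K : fieldType) (Q : quiver) (I : set (path_algebra K Q)).
Variables (A : falgType K) (pi : {rmorphism path_algebra K Q -> A}).
Hypotheses (adm : admissible I) (bqa : is_bound_quiver_algebra I pi).
Variables (M : lmodType A^c) (S : diagram K Q).
Local Notation V := (kmod M).
Local Notation ar := (ar pi).
Variables (b : nat -> V) (c : nat -> {scalar V}).
Hypothesis Sbc : shaped pi S b c.

Lemma shaped_b_neq0 i : (i < sdim S)%N -> b i != 0.
Proof.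
move=> si; apply: contraTneq isT => b0; have := shaped_dual Sbc si si.
by rewrite b0 sform0 eqxx => /esym/eqP; rewrite oner_eq0.
Qed.

Lemma socle_indecomposable s : (s < sdim S)%N ->
  (forall v : V, v != 0 -> exists (a : A) (k : K), k != 0 /\ v <* a = k *: b s) ->
  indecomposable M.
Proof.
move=> ss soc; apply: (simple_socle_indecomposable (shaped_b_neq0 ss)) => N v sN Nv v0.
have [a [k [k0 E]]] := soc v v0.
apply: (subspaceZ (submodule_subspace bqa sN) k0); rewrite -E.
by case: sN => _ _ NZ; exact: NZ.
Qed.

(* [T] holds of enough vectors for one of two complementary submodules to meet it,
   and that submodule then contains the socle of [M]. *)
Lemma pair_indecomposable (T : V -> Prop) : (0 < sdim S)%N ->
  (forall N P : set V, submodule (N : set M) -> submodule (P : set M) ->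
     (forall v, N v -> P v -> v = 0) ->
     (forall v, exists2 n, N n & P (v - n)) ->
     (exists2 v, N v & T v) -> forall v, P v -> v = 0) ->
  (forall N P : set V, submodule (N : set M) -> submodule (P : set M) ->
     (forall v, exists2 n, N n & P (v - n)) ->
     (exists2 v, N v & T v) \/ (exists2 v, P v & T v)) ->
  indecomposable M.
Proof.
move=> S0 one two; split; first by exists (b 0); apply: shaped_b_neq0.
move=> N P sN sP NP0 NP.
have NP1 v : N v -> P v -> v = 0 :> V.
  move=> Nv Pv; have : (N `&` P)%classic v by split.
  by rewrite NP0.
have dec v : exists2 n : V, N n & P (v - n).
  have [n [p [Nn Pp E]]] := NP v; exists n => //.
  by rewrite (_ : v = (n : V) + (p : V)) // addrAC subrr add0r.
have dec' v : exists2 n : V, P n & N (v - n).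
  have [n Nn Pn] := dec v; exists (v - n) => //; by rewrite subKr.
have zero (X : set M) : submodule X -> (forall v : V, X v -> v = 0) -> X = [set 0]%classic.
  by move=> [X0 _ _] H; apply/seteqP; split=> v; [exact: H|move=> ->].
have [Tn|Tp] := two N P sN sP dec.
  by right; apply: zero => //; apply: one sN sP NP1 dec Tn.
left; apply: zero => //; apply: one sP sN _ dec' Tp => v Pv Nv.
exact: NP1.
Qed.

Lemma shaped_act x (v : V) : wf_diagram S ->
  v <* ar x = \sum_(t <- slinks S | larr t == x) (lcoef t * c (lsrc t) v) *: b (ltgt t).
Proof.
move=> wf; apply: (shaped_ext Sbc) => j sj; rewrite (shaped_ar Sbc) // sform_sum.
rewrite [LHS]big_mkcond [RHS]big_mkcond; apply: eq_big_seq => t /wf[_ rt _ _].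
case: eqP => _ //=; rewrite sformZ (shaped_dual Sbc) // [j == _]eq_sym.
by case: eqP => _; rewrite ?mulr1 ?mulr0.
Qed.

End ShapedIndecomposable.

(** * Paths that occur in no relation *)

Section IsolatedPaths.
Variables (K : fieldType) (Q : quiver) (I : set (path_algebra K Q)).
Variables (A : falgType K) (pi : {rmorphism path_algebra K Q -> A}).
Hypotheses (adm : admissible I) (bqa : is_bound_quiver_algebra I pi).

Local Notation e := (vx pi).
Local Notation ar := (ar pi).
Local Notation mon := (mon pi).
Implicit Types (x y z u w : arr Q) (l : seq (arr Q)) (p q : qpath Q).

Lemma path_vx_tgt p : pi (path_elt K p) * e (ptgt p) = pi (path_elt K p).
Proof.
by rewrite /vx -rmorphM path_mul pcat_trivr eqxx.
Qed.

Lemma path_mul_vx p a : pi (path_elt K p) * e a =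
  if a == ptgt p then pi (path_elt K p) else 0.
Proof.
rewrite /vx -rmorphM path_mul pcat_trivr; case: eqP => // _; exact: rmorph0.
Qed.

Lemma vx_mul_path p a : e a * pi (path_elt K p) =
  if a == psrc p then pi (path_elt K p) else 0.
Proof.
rewrite /vx -rmorphM path_mul pcat_trivl; case: eqP => // _; exact: rmorph0.
Qed.

(* The paths parallel to [p] are assumed to vanish or to be proper right
   multiples of [p], so that a relation involving [p] reads [p (c + j) = 0] with
   [j] in the radical. *)
Lemma isolated_path p : pi (path_elt K p) != 0 ->
  (forall q, psrc q = psrc p -> ptgt q = ptgt p -> q != p -> (2 <= plength q)%N ->
     pi (path_elt K q) = 0 \/
     exists2 s, s != [::] & pi (path_elt K q) = pi (path_elt K p) * mon s) ->
  forall f, I f -> mcoeff p f = 0.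
Proof.
move=> p0 par f If; set P := pi (path_elt K p) in p0 par *.
apply/eqP; apply: contraNT p0 => c0.
(* The idempotents at both ends of [p] retain only the paths parallel to [p]. *)
pose term q := e (psrc p) * pi (mcoeff q f *: path_elt K q) * e (ptgt p).
have term0 q : q != p -> exists (k : K) s, s != [::] /\ term q = k *: (P * mon s) \/ term q = 0.
  move=> qp; rewrite /term (piZ bqa) -scalerAr -scalerAl vx_mul_path.
  have [sq|sq] := eqVneq (psrc p) (psrc q); last first.
    by exists 0, [::]; right; rewrite mul0r scaler0.
  rewrite path_mul_vx; have [tq|tq] := eqVneq (ptgt p) (ptgt q); last first.
    by exists 0, [::]; right; rewrite scaler0.
  have [q2|q2] := leqP (plength q) 1.
    by exists 0, [::]; right; rewrite (short_coef adm q2 If) scale0r.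
  have [->|[s s0 ->]] := par q (esym sq) (esym tq) qp q2.
    by exists 0, [::]; right; rewrite scaler0.
  by exists (mcoeff q f), s; left.
have sum0 : \sum_(q <- msupp f) term q = 0.
  have -> : \sum_(q <- msupp f) term q = e (psrc p) * pi f * e (ptgt p).
    by rewrite [in RHS](pa_expand f) rmorph_sum mulr_sumr mulr_suml.
  by rewrite (proj2 (piI bqa f) If) mulr0 mul0r.
have pf : p \in msupp f by rewrite mcoeff_neq0 in c0.
have termp : term p = mcoeff p f *: P.
  by rewrite /term (piZ bqa) -scalerAr vx_mul_path eqxx -scalerAl path_vx_tgt.
have [m mP] := mon_nilp adm bqa.
(* Multiplying the relation by [mon t] expresses [P * mon t] through products with longer sequences;
   these vanish by descending induction, and the empty [t] gives [P = 0]. *)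
suff dec d t : (m - d <= size t)%N -> P * mon t = 0.
  by apply/eqP; rewrite -(mulr1 P) -(mon_nil pi) (dec m) // subnn.
elim: d t => [|d IH] t td; first by rewrite mP ?mulr0 // -[m]subn0.
have : \sum_(q <- msupp f) term q * mon t = 0 by rewrite -mulr_suml sum0 mul0r.
rewrite (big_fsetD1 p) //= termp [X in _ + X]big_seq big1 ?addr0.
  by rewrite -scalerAl => /eqP; rewrite scaler_eq0 (negPf c0) => /eqP.
move=> q; rewrite !inE => /andP[/term0[k [s [[s0 ->]|->]]] _]; last by rewrite mul0r.
rewrite -scalerAl -mulrA -mon_cat IH ?scaler0 // size_cat.
case: s s0 => [//|x s] _ /=; rewrite leq_subLR in td; rewrite leq_subLR.
by apply: leq_trans td _; rewrite !addSn addnS ltnS leq_add2l leq_addl.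
Qed.

Lemma isolated_arrows x l : mon (x :: l) != 0 ->
  (forall l', l' != x :: l -> (2 <= size l')%N -> mon l' != 0 ->
    (forall y m, l' = y :: m -> src y = src x) ->
    (mon l' * e (chain_end (src x) (x :: l)) = mon l') ->
    exists2 s, s != [::] & mon l' = mon (x :: l) * mon s) ->
  isolated I (x :: l).
Proof.
move=> nz par p f pl; have pE := path_mon pi pl.
have sp : psrc p = src x by have := qpathP p; rewrite pl /= => /andP[/eqP].
apply: isolated_path; first by rewrite pE.
move=> q sq tq qp; rewrite /plength; case ql : (parr q) => [//|y m] m2.
have qE := path_mon pi ql.
have [->|qnz] := eqVneq (pi (path_elt K q)) 0; [by left|right].
have sqy : psrc q = src y by have := qpathP q; rewrite ql /= => /andP[/eqP].
rewrite qE pE; apply: par.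
- apply: contraNneq qp => ml; apply/eqP/val_inj.
  rewrite [LHS]surjective_pairing [RHS]surjective_pairing.
  by rewrite -/(psrc q) -/(psrc p) -/(parr q) -/(parr p) ql pl ml sq.
- by [].
- by rewrite -qE.
- by move=> y' m' [<- _]; rewrite -sp -sq sqy.
rewrite -qE -sp -pl -[chain_end _ _]/(ptgt p) -tq.
exact: path_vx_tgt.
Qed.

Lemma unrelated_nz x l : chain (src x) (x :: l) -> unrelated_arrows I (x :: l) ->
  mon (x :: l) != 0.
Proof.
move=> lc rel; apply/eqP => l0.
have [] := rel (@QPath _ (src x, x :: l) lc) erefl; case.
by apply/(piI bqa); rewrite (@path_mon _ _ _ pi _ x l).
Qed.

Lemma unrelated_neq x l l' (k : K) : unrelated_arrows I (x :: l) -> mon (x :: l) != 0 ->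
  mon (x :: l) = k *: mon l' -> l' != [::] -> l' = x :: l.
Proof.
move=> rel nz E l'0; apply/eqP; apply: contrapT => /negP ll.
have nz' : mon l' != 0 by apply: contraNneq nz => l'z; rewrite E l'z scaler0.
case: l' => [//|y l'] in E ll l'0 nz' *.
have [p pE pM] := mon_path nz; have [q qE qM] := mon_path nz'.
have pl : parr p = x :: l by rewrite /parr pE.
have [_ /(_ q k)] := rel p pl; case.
  by apply: contraNneq ll => qp; move: pE; rewrite -qp qE => -[_ -> ->].
by apply/(piPE bqa); rewrite pM qM.
Qed.

End IsolatedPaths.

(** * The conditions imply the right 3-Nakayama property *)

Section Converse.
Variables (K : fieldType) (Q : quiver) (I : set (path_algebra K Q)).
Variables (A : falgType K) (pi : {rmorphism path_algebra K Q -> A}).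
Hypotheses (adm : admissible I) (bqa : is_bound_quiver_algebra I pi).

Local Notation e := (vx pi).
Local Notation ar := (ar pi).
Local Notation mon := (mon pi).
Implicit Types (x y z u w : arr Q) (l : seq (arr Q)) (p q : qpath Q).

Lemma diagram_module S : wf_diagram S ->
  (forall t t', t \in slinks S -> t' \in slinks S ->
     ltgt t = lsrc t' -> isolated I [:: larr t; larr t']) ->
  (forall t t' t'', t \in slinks S -> t' \in slinks S -> t'' \in slinks S ->
     ltgt t = lsrc t' -> ltgt t' = lsrc t'' -> False) ->
  exists (M : lmodType A^c) b c, shaped (M := M) pi S b c.
Proof.
by move=> wf iso short; have [M [b [c ?]]] := realization adm bqa wf iso short; exists M, b, c.
Qed.

Lemma merge_module w1 w2 : w1 != w2 -> tgt w1 = tgt w2 ->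
  exists M : lmodType A^c, [/\ finitely_generated M, indecomposable M & factor_serial M 3].
Proof.
move=> w12 tw; have w21 : w2 != w1 by rewrite eq_sym.
have wf : wf_diagram (merge_diagram K w1 w2).
  by move=> t; rewrite !inE => /orP[]/eqP->; rewrite /lsrc /larr /ltgt /=; split.
have [||M [b [c Sbc]]] := @diagram_module (merge_diagram K w1 w2) wf.
- by move=> t t'; rewrite !inE => /orP[]/eqP-> /orP[]/eqP->.
- by move=> t t' t''; rewrite !inE => /orP[]/eqP-> /orP[]/eqP->.
exists M; split; first exact: shaped_fg Sbc.
  apply: (socle_indecomposable bqa Sbc (s := 2)) => // v v0.
  have [c0|c0] := eqVneq (c 0%N v) 0; last first.
    exists (ar w1), (c 0%N v); rewrite (shaped_act Sbc) //; links.
    by rewrite eqxx (negPf w21) mul1r ?addr0.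
  have [c1|c1] := eqVneq (c 1%N v) 0; last first.
    exists (ar w2), (c 1%N v); rewrite (shaped_act Sbc) //; links.
    by rewrite eqxx (negPf w12) mul1r ?addr0.
  have vE : v = c 2 v *: b 2.
    by rewrite [LHS](shaped_sum Sbc) /= !big_ord_recr big_ord0 /= c0 c1 !scale0r !add0r.
  exists 1, (c 2 v); rewrite ract1; split=> //.
  by apply: contraNneq v0 => c20; rewrite vE c20 scale0r eqxx.
by apply: (merge_factor_serial adm bqa (w1 := w1) (w2 := w2)); exists b, c.
Qed.

Lemma hook_module w1 y w2 : w1 != w2 -> src w1 = src w2 -> tgt w1 = src y ->
  isolated I [:: w1; y] ->
  exists M : lmodType A^c, [/\ finitely_generated M, indecomposable M & factor_serial M 3].
Proof.
move=> w12 sw yw iso; have w21 : w2 != w1 by rewrite eq_sym.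
have wf : wf_diagram (hook_diagram K w1 y w2).
  move=> t; rewrite !inE => /or3P[]/eqP->; rewrite /lsrc /larr /ltgt /=;
  by split.
have [|||M [b [c Sbc]]] := @diagram_module (hook_diagram K w1 y w2).
- exact: wf.
- by move=> t t'; rewrite !inE => /or3P[]/eqP-> /or3P[]/eqP->.
- by move=> t t' t''; rewrite !inE => /or3P[]/eqP-> /or3P[]/eqP-> /or3P[]/eqP->.
exists M; split; first exact: shaped_fg Sbc.
  by apply: (hook_indecomposable adm bqa w12 wf); exists b, c.
by apply: (hook_factor_serial adm bqa w12 wf); exists b, c.
Qed.

Lemma two_in a : #|[set x : arr Q | tgt x == a]%SET| = 2%N ->
  exists w1 w2, w1 != w2 /\ tgt w1 = tgt w2.
Proof.
move=> card2; have /card_gt1P[w1 [w2 []]] : (1 < #|[set x : arr Q | tgt x == a]%SET|)%N.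
  by rewrite card2.
by rewrite !inE => /eqP w1a /eqP w2a w12; exists w1, w2; rewrite w1a w2a.
Qed.

Hypotheses (sb : special_biserial I) (ci : condition_i I) (cii : condition_ii I).

(** A parallel path that starts with [w1] continues with [y] and ends there by [split_short]; one
    that starts with [w2] begins with a square, which would relate [w1 y] to [w2 y']. *)
Lemma hook_isolated w1 y w2 : w1 != w2 -> src w1 = src w2 -> tgt w1 = src y ->
  unrelated_arrows I [:: w1; y] -> isolated I [:: w1; y].
Proof.
move=> w12 sw yw rel.
have nz : mon [:: w1; y] != 0.
  by apply: (unrelated_nz bqa) rel; rewrite /= yw !eqxx.
apply: (isolated_arrows adm bqa nz) => -[//|z [//|y' m]] ll _ nz' sz _.
exfalso; have nz2 : ar z * ar y' != 0.
  by rewrite -(mon2 pi); apply: (@mon_subl _ _ _ pi [:: z; y'] m).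
rewrite (mon2 pi) in nz.
have [|zw|zw] := out_le2 sb w12 sw (z := z) _; first exact: sz.
  rewrite zw in ll nz' nz2; have yy := next_unique bqa sb nz nz2.
  case: m ll nz' {sz} => [|t m] ll nz'; first by rewrite yy eqxx in ll.
  move/eqP: nz'; apply; rewrite !(mon_cons pi) !mulrA.
  by rewrite (split_short adm bqa sb ci cii y' t w12 sw) mul0r.
rewrite zw in nz2; have [k k0 E] := split_square adm bqa sb ci cii w12 sw nz nz2.
have := unrelated_neq bqa rel (l' := [:: w2; y']) (k := k).
rewrite !(mon2 pi) => /(_ nz E isT) [w21 _].
by rewrite w21 eqxx in w12.
Qed.

(** The third edge of the string prolongs one side of the turn [w1^{-1} w2]. By condition (i) it
    cannot turn back, so it extends [w1] or [w2] to a path of length two. *)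
Lemma iv_b_hook : condition_iv_b I -> exists w1 y w2,
  [/\ w1 != w2, src w1 = src w2, tgt w1 = src y & isolated I [:: w1; y]].
Proof.
move=> [w [w1 [w2 [sw w3 w12 sw12 sub]]]].
have ch := qpathP w; have st := sw.1.
have w21 : w2 != w1 by rewrite eq_sym.
move: (w3); rewrite /walk_length /plength -/(edges w).
move: (sub); rewrite /has_subwalk.
move: ch; rewrite -/(edges w).
case Ew : (edges w) st => [|[x1 d1] [|[x2 d2] [|[x3 d3] [|? ?]]]] // st ch + _.
move: ch => /= /and4P[_ ch1 ch2 _]; rewrite !andbF !orbF !andbT.
move: st => /= /and3P[st1 st2 _].
have mk (v1 v2 y : arr Q) : v1 != v2 -> src v1 = src v2 -> tgt v1 = src y ->
    infix [:: fwd v1; fwd y] (edges w) \/ infix [:: bwd v1; bwd y] (rev (edges w)) ->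
    exists u1 y u2, [/\ u1 != u2, src u1 = src u2, tgt u1 = src y & isolated I [:: u1; y]].
  move=> v12 sv yv inf; exists v1, y, v2; split=> //.
  by apply: hook_isolated v12 sv yv _; exact: (string_unrelated (l := [:: v1; y]) sw inf).
have bad (z1 z2 : arr Q) : z1 != z2 -> tgt z1 = tgt z2 ->
    infix [:: fwd z1; bwd z2] (edges w) -> False.
  by move=> z12 tz inf; have := ci sw z12 tz inf; rewrite Ew.
case/orP=> /andP[/eqP[E1 E2] /eqP[E3 E4]].
  subst x1 d1 x2 d2; case: d3 in Ew st2 ch2 *.
    apply: (mk w2 w1 x3) => //; first by rewrite (eqP ch2).
    by left; rewrite Ew /= !eqxx !orbT.
  case: (bad w2 x3); first by apply: contraNneq st2 => ->.
    by rewrite (eqP ch2).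
  by rewrite Ew /= !eqxx !orbT.
subst x2 d2 x3 d3; case: d1 in Ew st1 ch1 *.
  case: (bad x1 w1); first by apply: contraNneq st1 => ->.
    by rewrite (eqP ch1).
  by rewrite Ew /= !eqxx.
apply: (mk w1 w2 x1) => //; first by rewrite (eqP ch1).
by right; rewrite Ew /rev /= !eqxx !orbT.
Qed.

(** Two parallel paths of length two differ in their last arrows, or else in their first arrows,
    which then also have a common target. *)
Lemma iv_c_in : condition_iv_c I -> condition_iv_a Q.
Proof.
move=> [p [q [[sp tp pq _] p2 q2]]].
have cp := qpathP p; have cq := qpathP q.
have [w1 [w2 [w12 tw]]] : exists w1 w2 : arr Q, w1 != w2 /\ tgt w1 = tgt w2.
  move: p2 q2 pq cp cq tp; rewrite /plength /ptgt /chain_end.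
  have -> : (p != q) = (parr p != parr q).
    congr (~~ _); apply/eqP/eqP => [->//|pq]; apply: val_inj.
    rewrite [LHS]surjective_pairing [RHS]surjective_pairing.
    by rewrite -/(psrc p) -/(psrc q) -/(parr p) -/(parr q) pq sp.
  case: (parr p) => [|x1 [|x2 [|? ?]]] // _; case: (parr q) => [|y1 [|y2 [|? ?]]] // _ pq.
  move=> /= /and3P[_ /eqP sx _] /and3P[_ /eqP sy _] txy.
  have [xy2|xy2] := eqVneq x2 y2; last by exists x2, y2.
  exists x1, y1; split; last by rewrite -sx -sy xy2.
  by apply: contraNneq pq => xy1; rewrite xy1 xy2.
exists (tgt w1); apply/eqP; rewrite eqn_leq; case: sb => _ -> _ _ /=.
by apply/card_gt1P; exists w1, w2; split; rewrite ?inE ?tw.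
Qed.

Lemma listed_wf S : listed pi S -> wf_diagram S.
Proof.
case=> [w1 y w2 y' k w12 sw k0 nz E|w1 w2 w12 tw|w1 y w2 w12 sw nz w2x|w1 w2 w12 sw|a l lc nz].
- have yw := ar2_neq0 nz; have yw' := ar2_neq0 (square_nz nz E).
  move=> t; rewrite !inE => /or4P[]/eqP->; rewrite /lsrc /larr /ltgt /=;
  by split=> //; rewrite ?yw ?yw' ?(square_tgt nz E).
- by move=> t; rewrite !inE => /orP[]/eqP->; rewrite /lsrc /larr /ltgt /=; split.
- have yw := ar2_neq0 nz.
  move=> t; rewrite !inE => /or3P[]/eqP->; rewrite /lsrc /larr /ltgt /=;
  by split=> //; rewrite ?yw.
- by move=> t; rewrite !inE => /orP[]/eqP->; rewrite /lsrc /larr /ltgt /=; split.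
- exact: wf_path_diagram.
Qed.

Lemma listed_factor_serial (M : lmodType A^c) S : listed pi S -> has_diagram pi M S ->
  exists i, [/\ (1 <= i)%N, (i <= 3)%N & factor_serial M i].
Proof.
move=> lS; move: lS (listed_wf lS).
case=> [w1 y w2 y' k w12 sw k0 nz E|w1 w2 w12 tw|w1 y w2 w12 sw nz w2x|w1 w2 w12 sw|a l lc nz] wf hS.
- by exists 3; split=> //; apply: (square_factor_serial adm bqa w12 _ wf hS).
- by exists 3; split=> //; apply: (merge_factor_serial adm bqa hS).
- by exists 3; split=> //; apply: (hook_factor_serial adm bqa w12 wf hS).
- by exists 2; split=> //; apply: (fork_factor_serial adm bqa w12 wf hS).
- by exists 1%N; split=> //; apply: (path_uniserial adm bqa hS).
Qed.

Lemma listed_finite : exists (T : finType) (sh : T -> diagram K Q),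
  forall S, listed pi S -> exists t, S = sh t.
Proof.
have [m mP] := mon_nilp adm bqa.
(* The scalar of a square is determined by its arrows because [w2 y'] is nonzero; hence arrows alone
   index the squares. *)
pose kk (w1 y w2 y' : arr Q) : K :=
  xget 0 [set k | ar w1 * ar y = k *: (ar w2 * ar y')]%classic.
pose sh (t : 'I_4 * (arr Q * arr Q * arr Q * arr Q) + vert Q * m.-bseq (arr Q)) :=
  match t with
  | inl (n, (w1, y, w2, y')) =>
    match val n with
    | 0%N => square_diagram w1 y w2 y' (kk w1 y w2 y')
    | 1%N => merge_diagram K w1 w2
    | 2 => hook_diagram K w1 y w2
    | _ => fork_diagram K w1 w2
    end
  | inr (a, l) => path_diagram K a l
  end.
exists ('I_4 * (arr Q * arr Q * arr Q * arr Q) + vert Q * m.-bseq (arr Q))%type, sh => S.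
case=> [w1 y w2 y' k w12 sw k0 nz E|w1 w2 w12 tw|w1 y w2 w12 sw nz w2x|w1 w2 w12 sw|a l lc nz].
- exists (inl (inord 0, (w1, y, w2, y'))); rewrite /sh /= inordK //.
  congr square_diagram; rewrite /kk.
  have := @xgetPex _ 0 [set k | ar w1 * ar y = k *: (ar w2 * ar y')]%classic.
  move=> /(_ (ex_intro _ k E)) /=; set k' := xget _ _ => E'.
  have /eqP : (k - k') *: (ar w2 * ar y') = 0 by rewrite scalerBl -E -E' subrr.
  by rewrite scaler_eq0 (negPf (square_nz nz E)) orbF subr_eq0 => /eqP.
(* Positions that the diagram does not use are filled with [w1]. *)
- by exists (inl (inord 1, (w1, w1, w2, w1))); rewrite /sh /= inordK.
- by exists (inl (inord 2, (w1, y, w2, w1))); rewrite /sh /= inordK.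
- by exists (inl (inord 3, (w1, w1, w2, w1))); rewrite /sh /= inordK.
have lm : (size l <= m)%N.
  by rewrite leqNgt; apply: contra nz => ml; rewrite mP // ltnW.
by exists (inr (a, Bseq lm)).
Qed.

Lemma listed_finite_type : finite_type A.
Proof.
have [T [sh shP]] := listed_finite.
(* Codes that no module realizes are sent to the regular module as a default. *)
have /choice[G GP] (t : T) : exists M : lmodType A^c,
    (exists N : lmodType A^c, has_diagram pi N (sh t)) -> has_diagram pi M (sh t).
  have [[N hN]|nN] := pselect (exists N : lmodType A^c, has_diagram pi N (sh t)).
    by exists N.
  by exists ((A^c)^o : lmodType A^c).
exists #|T|, (fun i => G (enum_val i)) => M _ indM.
have [S [lS hS]] := classification adm bqa sb ci cii indM.
have [t St] := shP S lS; exists (enum_rank t); rewrite enum_rankK.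
rewrite St in lS hS.
by apply: (diagram_iso bqa (listed_wf lS) hS); apply: GP; exists M.
Qed.

Lemma conditions_right_nakayama : condition_iv_a Q \/ condition_iv_b I \/ condition_iv_c I ->
  right_nakayama A 3.
Proof.
move=> iv; split=> [M _ indM|].
  have [S [lS hS]] := classification adm bqa sb ci cii indM.
  exact: listed_factor_serial lS hS.
have [iva|ivb] : condition_iv_a Q \/ condition_iv_b I.
  by case: iv => [|[|/iv_c_in]]; [left|right|left].
  by have [a /two_in[w1 [w2 [w12 tw]]]] := iva; apply: merge_module w12 tw.
by have [w1 [y [w2 [w12 sw yw iso]]]] := iv_b_hook ivb; apply: hook_module w12 sw yw iso.
Qed.

End Converse.

(** * Bounds on the length *)

Section Projective.
Variables (K : fieldType) (A : falgType K) (eps : A).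

(** For an idempotent [eps] this describes [eps A] by a boolean test, from which a subtype can be
    formed. *)
Definition fixed_by : pred (A^c)^o := fun x => eps * (x : A) == x.

Lemma fixed_by_closed : submod_closed fixed_by.
Proof.
split=> [|a x y]; first by apply/eqP; rewrite mulr0.
move=> /eqP ex /eqP ey; apply/eqP.
rewrite -[a *: x]/((x : A) * a) -[LHS]/(eps * ((x : A) * a + y)).
by rewrite mulrDr mulrA ex ey.
Qed.

HB.instance Definition _ := GRing.isSubmodClosed.Build A^c (A^c)^o fixed_by fixed_by_closed.

Record projective := Projective { pval : (A^c)^o; _ : fixed_by pval }.

HB.instance Definition _ := [isSub for pval].
HB.instance Definition _ := [Choice of projective by <:].
HB.instance Definition _ := [SubChoice_isSubLmodule of projective by <:].

End Projective.

Section ShortCoefficients.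
Variables (K : fieldType) (Q : quiver) (I : set (path_algebra K Q)).
Variables (A : falgType K) (pi : {rmorphism path_algebra K Q -> A}).
Hypotheses (adm : admissible I) (bqa : is_bound_quiver_algebra I pi).

Local Notation e := (vx pi).
Local Notation ar := (ar pi).
Local Notation mon := (mon pi).
Implicit Types (x y z : arr Q) (l : seq (arr Q)) (p q : qpath Q).

(* This does not depend on the chosen representative modulo [I]. *)
Definition coef p (a : A) : K := mcoeff p (sval (cid (pi_surj bqa a))).

Lemma coefE p f : (plength p <= 1)%N -> coef p (pi f) = mcoeff p f.
Proof.
move=> p1; rewrite /coef; case: cid => g /= gf.
have : I (g - f) by apply/(piI bqa); rewrite rmorphB /= gf subrr.
by move=> /(short_coef adm p1)/eqP; rewrite mcoeffB subr_eq0 => /eqP.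
Qed.

Lemma coef_path p q : (plength p <= 1)%N -> coef p (pi (path_elt K q)) = (q == p)%:R.
Proof. by move=> p1; rewrite coefE // path_elt.unlock mcoeffU. Qed.

Section Short.
Variable p : qpath Q.
Hypothesis p1 : (plength p <= 1)%N.

Lemma coefD a a' : coef p (a + a') = coef p a + coef p a'.
Proof.
have [f <-] := pi_surj bqa a; have [g <-] := pi_surj bqa a'.
by rewrite -rmorphD !coefE // mcoeffD.
Qed.

Lemma coefZ k a : coef p (k *: a) = k * coef p a.
Proof.
by have [f <-] := pi_surj bqa a; rewrite -(piZ bqa) !coefE // mcoeff_pa_scale.
Qed.

Lemma coef0 : coef p 0 = 0.
Proof. by rewrite -(scale0r (0 : A)) coefZ mul0r. Qed.

Lemma coef_ind (P : A -> Prop) : P 0 -> (forall a a', P a -> P a' -> P (a + a')) ->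
  (forall k a, P a -> P (k *: a)) -> (forall q, P (pi (path_elt K q))) ->
  forall a, P a.
Proof.
move=> P0 PD PZ Pq a; have [f <-] := pi_surj bqa a.
elim/pa_ind: f => [|f g Pf Pg|k f Pf|q]; last exact: Pq.
- by rewrite rmorph0.
- by rewrite rmorphD; apply: PD.
- by rewrite (piZ bqa); apply: PZ.
Qed.

Lemma coef_vx a c : coef p (a * e c) = if c == ptgt p then coef p a else 0.
Proof.
move: a; apply: coef_ind => [|a a' Ha Ha'|k a Ha|q].
- by rewrite mul0r coef0 if_same.
- by rewrite mulrDl !coefD Ha Ha'; case: ifP => _ //; rewrite addr0.
- by rewrite -scalerAl !coefZ Ha; case: ifP => _ //; rewrite mulr0.
rewrite path_mul_vx coef_path //; have [->|qp] := eqVneq q p.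
  by case: ifP => _; [rewrite coef_path // eqxx|rewrite coef0].
by rewrite if_same; case: ifP => _; [rewrite coef_path // (negPf qp)|rewrite coef0].
Qed.

Lemma coef_ar a x : coef p (a * ar x) =
  if p == arrow_path x then coef (triv_path (src x)) a else 0.
Proof.
(* Linearity is needed here for the coefficient at a trivial path instead of the fixed [p]. *)
have t1 : (plength (triv_path (src x)) <= 1)%N by [].
have [c0 [cD cZ]] : coef (triv_path (src x)) 0 = 0 /\
    (forall a a', coef (triv_path (src x)) (a + a') =
      coef (triv_path (src x)) a + coef (triv_path (src x)) a') /\
    (forall k a, coef (triv_path (src x)) (k *: a) = k * coef (triv_path (src x)) a).
  have Z k b : coef (triv_path (src x)) (k *: b) = k * coef (triv_path (src x)) b.
    by have [f <-] := pi_surj bqa b; rewrite -(piZ bqa) !coefE // mcoeff_pa_scale.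
  split; first by rewrite -(scale0r (0 : A)) Z mul0r.
  split=> // b b'; have [f <-] := pi_surj bqa b; have [g <-] := pi_surj bqa b'.
  by rewrite -rmorphD !coefE // mcoeffD.
move: a; apply: coef_ind => [|a a' Ha Ha'|k a Ha|q].
- by rewrite mul0r coef0 c0 if_same.
- by rewrite mulrDl !coefD Ha Ha' cD; case: ifP => _ //; rewrite addr0.
- by rewrite -scalerAl !coefZ Ha cZ; case: ifP => _ //; rewrite mulr0.
rewrite /ar -rmorphM path_mul coef_path //.
have [qx|qx] := eqVneq (ptgt q) (src x); last first.
  rewrite pcatN // rmorph0 coef0; case: eqP => // _.
  have [qt|//] := eqVneq q (triv_path (src x)).
  by rewrite qt /ptgt /= eqxx in qx.
have [r -> rE] := @pcatE _ q (arrow_path x) qx; rewrite coef_path //.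
have [qt|qt] := eqVneq q (triv_path (src x)).
  have -> : r = arrow_path x by apply: val_inj; rewrite rE qt.
  by rewrite eq_sym; case: eqP.
rewrite if_same; have [rp|//] := eqVneq r p.
move: p1; rewrite -rp /plength {1}/parr rE /= size_cat /= addn1 ltnS leqn0 size_eq0.
move=> /eqP q0; case/eqP: qt; apply: val_inj; rewrite [LHS]surjective_pairing /=.
by rewrite -/(parr q) q0 -qx /ptgt q0.
Qed.

Lemma coef_mon l : (2 <= size l)%N -> coef p (mon l) = 0.
Proof.
case: l => [//|x l] l2; have [->|nz] := eqVneq (mon (x :: l)) 0; first exact: coef0.
have [q qE <-] := mon_path nz; rewrite coef_path //.
have [qp|//] := eqVneq q p.
by move: p1; rewrite -qp /plength /parr qE /= leqNgt l2.
Qed.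

End Short.

Variable H : forall M : lmodType A^c, finitely_generated M -> indecomposable M ->
  exists i, [/\ (1 <= i)%N, (i <= 3)%N & factor_serial M i].

(** [M / rad^k] is not uniserial for any [k > 0], so in the definition of type [i] the exponent
    [l - i] is zero. *)
Lemma wide_top_length (M : lmodType A^c) : finitely_generated M -> indecomposable M ->
  fdim M -> wide_top pi M -> exists2 l, has_length M l & (l <= 3)%N.
Proof.
move=> fg ind fd wt; have [i [i1 i3 fs]] := H fg ind.
case: i i1 i3 fs => [//|[|i]] _ i3 fs; first by case: (wide_top_nonzero adm bqa fd wt).
have [_ [l [len il uni _]]] := fs; exists l => //.
move: uni; case E : (l - i.+2)%N => [|k] uni.
  by apply: leq_trans i3; rewrite -subn_eq0 E.
by case: (wide_top_not_uniserial adm bqa fd wt uni).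
Qed.

(** The exponent [l - i] is at most one because [M / rad^k] is not uniserial for [k > 1]. *)
Lemma wide_radical_length (M : lmodType A^c) : finitely_generated M -> indecomposable M ->
  fdim M -> wide_radical pi M -> exists2 l, has_length M l & (l <= 4)%N.
Proof.
move=> fg ind fd wt; have [i [i1 i3 fs]] := H fg ind.
case: i i1 i3 fs => [//|[|i]] _ i3 fs; first by case: (wide_radical_nonzero adm bqa fd wt).
have [_ [l [len il uni _]]] := fs; exists l => //.
move: uni; case E : (l - i.+2)%N => [|[|k]] uni.
- by apply: leq_trans (leqW i3); rewrite -subn_eq0 E.
- by rewrite -(subnK il) E add1n.
by case: (wide_radical_not_uniserial adm bqa fd wt uni).
Qed.

Section ProjectiveModule.
Variable b : vert Q.
Local Notation P := (projective (e b)).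
Local Notation V := (kmod P).

Lemma pvalZ (k : K) (v : V) : pval (k *: v) = k *: (pval v : A).
Proof. by rewrite -[LHS]/((pval v : A) * k%:A) -scalerAr mulr1. Qed.

Lemma pvalA (v : V) (a : A) : pval (v <* a) = (pval v : A) * a.
Proof. by []. Qed.

Lemma pvalD (u v : V) : pval (u + v) = (pval u : A) + pval v.
Proof. by []. Qed.

Lemma proj_fixed (v : V) : e b * (pval v : A) = pval v.
Proof. by case: v => v /= /eqP. Qed.

Lemma proj_of_proof (a : A) : fixed_by (e b) (e b * a).
Proof. by rewrite /fixed_by mulrA vxx. Qed.

Definition proj_of (a : A) : V := Projective (proj_of_proof a).

Lemma proj_ofK (v : V) : proj_of (pval v) = v.
Proof. by apply: val_inj; rewrite /= proj_fixed. Qed.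

Lemma proj_ofD a a' : proj_of (a + a') = proj_of a + proj_of a'.
Proof. by apply: val_inj; rewrite /= mulrDr. Qed.

Lemma proj_ofZ k a : proj_of (k *: a) = k *: proj_of a.
Proof. by apply: val_inj; rewrite [RHS]pvalZ /= -scalerAr. Qed.

Lemma proj_ofM a a' : proj_of (a * a') = proj_of a <* a'.
Proof. by apply: val_inj; rewrite [RHS]pvalA /= mulrA. Qed.

Lemma proj_sum (J : Type) (r : seq J) (F : J -> A) :
  proj_of (\sum_(i <- r) F i) = \sum_(i <- r) proj_of (F i).
Proof.
apply: (big_morph _ proj_ofD); by apply: val_inj; rewrite /= mulr0.
Qed.

Lemma proj_fg : finitely_generated P.
Proof.
exists 1%N, (fun=> proj_of 1) => v; exists (fun=> pval v).
apply: val_inj; rewrite big_ord_recl big_ord0 addr0.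
by rewrite -[RHS]/(e b * 1 * (pval v : A)) mulr1 proj_fixed.
Qed.

Lemma proj_fdim : fdim P.
Proof.
exists [seq proj_of a | a <- vbasis {:A}] => v.
have sp := subspace_spanN [seq proj_of a | a <- vbasis {:A}] (@subspace0 K V).
rewrite -(proj_ofK v) (coord_vbasis (memvf (pval v : A))) proj_sum.
apply: subspace_sum => // i _; rewrite proj_ofZ; case: (sp) => _ _; apply.
apply: spanN_mem; first exact: subspace0.
by apply/map_f/mem_nth; rewrite size_tuple.
Qed.

Definition proj_form_fun p (v : V) : K := coef p (pval v).

Lemma proj_form_linear p : (plength p <= 1)%N -> linear_for *%R (proj_form_fun p).
Proof.
by move=> p1 k u v; rewrite /proj_form_fun pvalD coefD // pvalZ coefZ.
Qed.

Lemma proj_form p : (plength p <= 1)%N ->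
  exists f : {scalar V}, forall v, f v = coef p (pval v).
Proof.
move=> p1.
pose f : {scalar V} := HB.pack (proj_form_fun p)
  (GRing.isLinear.Build K V K _ _ (proj_form_linear p1)).
by exists f.
Qed.

(** Modulo the radical [e_b A] is spanned by [proj_of 1]: a path of positive length ends in an
    arrow, and [e b] kills the trivial paths at other vertices. *)
Lemma proj_radical (v : V) : coef (triv_path b) (pval v) = 0 -> rad1 pi (setT : set V) v.
Proof.
have sR := submodule_subspace bqa (submodule_rad1 bqa (submoduleT P)).
have [R0 RD RZ] := sR; have t1 : (plength (triv_path b) <= 1)%N by [].
suff key a : rad1 pi setT (proj_of a - coef (triv_path b) a *: proj_of 1).
  by move=> v0; have := key (pval v); rewrite v0 scale0r subr0 proj_ofK.
move: a; apply: coef_ind => [|a a' Ha Ha'|k a Ha|q].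
- rewrite coef0 // scale0r subr0; have -> // : proj_of 0 = 0.
  by apply: val_inj; rewrite /= mulr0.
- by rewrite proj_ofD coefD // scalerDl opprD addrACA; apply: RD.
- by rewrite proj_ofZ coefZ // -scalerA -scalerBr; apply: RZ.
rewrite coef_path; last by [].
rewrite pi_path.
case/lastP E : (parr q) => [|l x].
  have -> : q = triv_path (psrc q).
    by apply: val_inj; rewrite [LHS]surjective_pairing -/(parr q) E.
  rewrite mon_nil mulr1 (_ : (_ == _) = (psrc q == b)); last first.
    by apply/eqP/eqP => [[->]|->].
  have [->|qb] := eqVneq (psrc q) b.
    suff -> : proj_of (e b) = proj_of 1 by rewrite scale1r subrr.
    by apply: val_inj; rewrite /= vxx mulr1.
  rewrite scale0r subr0; have -> // : proj_of (e (psrc q)) = 0.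
  by apply: val_inj; rewrite /= vxM eq_sym (negPf qb).
have [qb|_] := eqVneq q (triv_path b).
  by move: E; rewrite qb /parr /=; case: l.
rewrite scale0r subr0 mon_rcons mulrA proj_ofM.
by apply: rad1_mem => //; apply: submoduleT.
Qed.

Lemma proj_indecomposable : e b != 0 -> indecomposable P.
Proof.
move=> eb0; have [f fE] := proj_form (p := triv_path b) isT.
have ct : coef (triv_path b) (e b) = 1 by rewrite coef_path // eqxx.
apply: (@local_indecomposable _ _ _ f (proj_of 1)).
  by rewrite fE /= mulr1 ct; apply/eqP/oner_neq0.
move=> N v sN Nv /eqP v0 w; apply: (nakayama adm bqa sN (submoduleT P)) => // u _.
exists ((f u / f v) *: v).
  by have [_ _ NZ] := submodule_subspace bqa sN; apply: NZ.
by apply: proj_radical; rewrite -fE sformB sformZ divfK // subrr.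
Qed.

Variables y y' : arr Q.
Hypotheses (yy : y != y') (yb : src y = b) (y'b : src y' = b).

Lemma arrow_coef x x' : coef (arrow_path x) (ar x') = (x' == x)%:R.
Proof.
rewrite coef_path //; congr (_%:R); congr nat_of_bool; apply/eqP/eqP => [|->//].
by move=> /(congr1 (@parr Q)) [].
Qed.

Lemma proj_arrow x : src x = b -> (pval (proj_of (ar x)) : A) = ar x.
Proof. by move=> xb; rewrite /= vx_ar xb eqxx. Qed.

Lemma arrow_top x a : coef (triv_path a) (ar x) = 0.
Proof. by rewrite coef_path //; case: eqP => // /(congr1 (@parr Q)). Qed.

(* The radical of [e_b A] is not local. *)
Lemma proj_span : exists2 s : seq V, (size s <= 4)%N & forall v, lspan s v.
Proof.
have tb1 : (plength (triv_path b) <= 1)%N by [].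
have a1 x : (plength (arrow_path x) <= 1)%N by [].
have eb0 : e b != 0.
  apply: contraTneq isT => eb0; have := coef_path (triv_path b) tb1.
  by rewrite -/(e b) eb0 coef0 // eqxx => /esym/eqP; rewrite oner_eq0.
have [h hE] := proj_form tb1.
have [f fE] := proj_form (a1 y); have [g gE] := proj_form (a1 y').
have tx x : (triv_path b == arrow_path x) = false.
  by apply/eqP => /(congr1 (@parr Q)).
have ax x x' (v : V) : h v = 0 -> src x = b -> coef (arrow_path x) (pval (v <* ar x')) = 0.
  move=> hv xb; rewrite pvalA coef_ar //; case: eqP => // E.
  have -> : x' = x by move: E => /(congr1 (@parr Q)) [].
  by rewrite xb -hE.
have wr : wide_radical pi P.
  exists h, f, g, (proj_of (ar y')), (proj_of (ar y)); split.
  - by move=> x v; rewrite hE pvalA coef_ar // tx.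
  - by move=> x v hv; rewrite fE gE !ax.
  - move=> a v; rewrite !hE !fE !gE !pvalA !coef_vx //.
    by split=> ->; rewrite if_same.
  - rewrite !hE !fE !gE !proj_arrow // arrow_top !arrow_coef eqxx [y' == y]eq_sym.
    by rewrite (negPf yy); split=> //; apply/eqP/oner_neq0.
  - rewrite !hE !fE !gE !proj_arrow // arrow_top !arrow_coef eqxx (negPf yy).
    by split=> //; apply/eqP/oner_neq0.
have [l [cs csP <-] l4] := wide_radical_length proj_fg (proj_indecomposable eb0) proj_fdim wr.
have [s [ss _ sT]] := composition_span adm bqa (@subspace0 K V) csP.
by exists s; rewrite ?ss // => v; rewrite /lspan -sT.
Qed.

Lemma proj_paths l1 l2 : (2 <= size l1)%N -> (2 <= size l2)%N ->
  e b * mon l1 = mon l1 -> e b * mon l2 = mon l2 -> mon l2 != 0 ->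
  exists k, mon l1 = k *: mon l2.
Proof.
move=> s1 s2 b1 b2 nz; apply: contrapT => /forallNP nk.
have [s s4 sP] := proj_span.
have tb1 : (plength (triv_path b) <= 1)%N by [].
have a1 x : (plength (arrow_path x) <= 1)%N by [].
have [h hE] := proj_form tb1.
have [f fE] := proj_form (a1 y); have [g gE] := proj_form (a1 y').
pose r1 := proj_of (mon l1); pose r2 := proj_of (mon l2).
have kill (phi : {scalar V}) (N : set V) (v : V) :
    (forall u, N u -> phi u = 0) -> phi v = 0 -> forall u, line_add N v u -> phi u = 0.
  by move=> pN pv u [k /pN]; rewrite sformB sformZ pv mulr0 subr0.
(* The order puts long paths first: each coefficient form at a path of length at most one vanishes
   on everything before its own vector. *)
suff : freeN [set 0 : V]%classic [:: r2; r1; proj_of (ar y); proj_of (ar y'); proj_of 1].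
  move=> /(free_le_span (@subspace0 K V)) /(_ (fun v _ => sP v)) /=.
  by move=> /leq_trans /(_ s4).
have ey : e b * ar y = ar y by rewrite -yb src_ar.
have ey' : e b * ar y' = ar y' by rewrite -y'b src_ar.
have co1 p : (plength p <= 1)%N -> coef p (pval r1) = 0.
  by move=> p1; rewrite /= b1 coef_mon.
have co2 p : (plength p <= 1)%N -> coef p (pval r2) = 0.
  by move=> p1; rewrite /= b2 coef_mon.
have hy x : src x = b -> h (proj_of (ar x)) = 0.
  by move=> xb; rewrite hE proj_arrow // arrow_top.
have N0 (phi : {scalar V}) (u : V) : [set 0 : V]%classic u -> phi u = 0 by move=> ->; exact: sform0.
split; [|split; [|split; [|split; [|split]]]] => //=.
- by move=> r20; move/eqP: nz; apply; rewrite -b2 -[LHS]/(pval r2) r20.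
- move=> [k /= /subr0_eq E]; apply: (nk k); rewrite -b1 -b2 -[LHS]/(pval r1) E.
  exact: pvalZ.
- suff no (u : V) : line_add (line_add [set 0]%classic r2) r1 u -> f u = 0.
    move=> /no; rewrite fE /= ey arrow_coef eqxx => /eqP; by rewrite oner_eq0.
  by apply: (kill); [apply: (kill); [exact: (N0)|]|]; rewrite fE ?co1 ?co2.
- suff no (u : V) : line_add (line_add (line_add [set 0]%classic r2) r1) (proj_of (ar y)) u -> g u = 0.
    move=> /no; rewrite gE /= ey' arrow_coef eqxx => /eqP; by rewrite oner_eq0.
  apply: (kill); [apply: (kill); [apply: (kill); [exact: (N0)|]|]|]; rewrite gE ?co1 ?co2 //.
  by rewrite /= ey arrow_coef (negPf yy).
suff no (u : V) : line_add (line_add (line_add (line_add [set 0]%classic r2) r1) (proj_of (ar y)))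
    (proj_of (ar y')) u -> h u = 0.
  move=> /no; rewrite hE /= mulr1 coef_path // eqxx => /eqP; by rewrite oner_eq0.
apply: (kill); [apply: (kill); [apply: (kill); [apply: (kill); [exact: (N0)|]|]|]|].
- by rewrite hE co2.
- by rewrite hE co1.
- exact: hy.
- exact: hy.
Qed.

End ProjectiveModule.

End ShortCoefficients.

(** * Forbidden configurations *)

Section Walks.
Variables (K : fieldType) (Q : quiver) (I : set (path_algebra K Q)).
Variables (w : walk Q) (sw : string I w).

Lemma walk_adjacent l (c d : edge Q) r : edges w = l ++ c :: d :: r ->
  @tgt (Defs.double Q) c = @src (Defs.double Q) d /\ d != edge_inv c.
Proof.
move=> E; have := qpathP w; rewrite -/(edges w) E chain_cat => /andP[_].
rewrite /= => /and3P[_ /eqP-> _]; split=> //.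
have := sw.1; rewrite E => /cat_sorted2[_] /=; by case/andP.
Qed.

Lemma fwd_subwalk l (s : seq (arr Q)) r : edges w = l ++ map (@fwd Q) s ++ r ->
  unrelated_arrows I s.
Proof.
by move=> E; apply: (string_unrelated sw); left; rewrite E; apply/infixP; exists l, r.
Qed.

Lemma bwd_subwalk l (s : seq (arr Q)) r : edges w = l ++ rev (map (@bwd Q) s) ++ r ->
  unrelated_arrows I s.
Proof.
move=> E; apply: (string_unrelated sw); right; rewrite E -infix_rev revK.
by apply/infixP; exists l, r.
Qed.

End Walks.

Section NakayamaNecessity.
Variables (K : fieldType) (Q : quiver) (I : set (path_algebra K Q)).
Variables (A : falgType K) (pi : {rmorphism path_algebra K Q -> A}).
Hypotheses (adm : admissible I) (bqa : is_bound_quiver_algebra I pi).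

Local Notation e := (vx pi).
Local Notation ar := (ar pi).
Local Notation mon := (mon pi).
Implicit Types (x y z : arr Q) (l : seq (arr Q)) (p q : qpath Q).

Variable H : forall M : lmodType A^c, finitely_generated M -> indecomposable M ->
  exists i, [/\ (1 <= i)%N, (i <= 3)%N & factor_serial M i].

Lemma shaped_top_dim S (M : lmodType A^c) b c i j : shaped (M := M) pi S b c ->
  indecomposable M -> (i < sdim S)%N -> (j < sdim S)%N -> i != j ->
  source_index S i -> source_index S j -> (sdim S <= 3)%N.
Proof.
move=> Sbc ind si sj ij srci srcj.
have wt := shaped_wide_top Sbc si sj ij srci srcj.
have [l len l3] := wide_top_length adm bqa H (shaped_fg Sbc) ind (shaped_fdim Sbc) wt.
by rewrite -(shaped_length adm bqa Sbc len).
Qed.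

(** Three vectors sent to a common fourth give a module with simple socle, of length four and with
    non-simple top. *)
Lemma no_three_in x y z : x != y -> y != z -> z != x -> tgt x = tgt y -> tgt x = tgt z -> False.
Proof.
move=> xy yz zx txy txz.
have yx : y != x by rewrite eq_sym. have zy : z != y by rewrite eq_sym.
have xz : x != z by rewrite eq_sym.
pose S : diagram K Q := Diagram 4 (nth (src x) [:: src x; src y; src z; tgt x])
  [:: (0%N, x, 1, 3); (1%N, y, 1, 3); (2, z, 1, 3)].
have wf : wf_diagram S.
  by move=> t; rewrite !inE => /or3P[]/eqP->; rewrite /lsrc /larr /ltgt /=; split.
have [||M [b [c Sbc]]] := @diagram_module _ _ _ _ pi adm bqa S wf.
- by move=> t t'; rewrite !inE => /or3P[]/eqP-> /or3P[]/eqP->.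
- by move=> t t' t''; rewrite !inE => /or3P[]/eqP-> /or3P[]/eqP->.
suff ind : indecomposable M.
  suff : (4 <= 3)%N by [].
  by apply: (shaped_top_dim (i := 0%N) (j := 1%N) Sbc ind) => // t;
    rewrite !inE => /or3P[]/eqP->.
apply: (socle_indecomposable bqa Sbc (s := 3)) => // v v0.
have [c0|c0] := eqVneq (c 0%N v) 0; last first.
  exists (ar x), (c 0%N v); split=> //; rewrite (shaped_act Sbc) //; links.
  by rewrite eqxx (negPf yx) (negPf zx) ?mul1r ?addr0.
have [c1|c1] := eqVneq (c 1%N v) 0; last first.
  exists (ar y), (c 1%N v); split=> //; rewrite (shaped_act Sbc) //; links.
  by rewrite eqxx (negPf xy) (negPf zy) ?mul1r ?addr0.
have [c2|c2] := eqVneq (c 2 v) 0; last first.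
  exists (ar z), (c 2 v); split=> //; rewrite (shaped_act Sbc) //; links.
  by rewrite eqxx (negPf xz) (negPf yz) ?mul1r ?addr0.
have vE : v = c 3 v *: b 3.
  by rewrite [LHS](shaped_sum Sbc) /= !big_ord_recr big_ord0 /= c0 c1 c2 !scale0r !add0r.
exists 1, (c 3 v); rewrite ract1; split=> //.
by apply: contraNneq v0 => c30; rewrite vE c30 scale0r eqxx.
Qed.

(** Otherwise the walk [x y^{-1} z] carries an indecomposable module of length four with a top of
    length two. *)
Lemma nakayama_merge_out x y z : x != y -> tgt x = tgt y -> src z = src y -> z = y.
Proof.
move=> xy txy szy; apply/eqP; apply: contrapT => /negP zy; have yx : y != x by rewrite eq_sym.
pose S : diagram K Q := Diagram 4 (nth (src x) [:: src x; src y; tgt x; tgt z])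
  [:: (0%N, x, 1, 2); (1%N, y, 1, 2); (1%N, z, 1, 3)].
have wf : wf_diagram S.
  by move=> t; rewrite !inE => /or3P[]/eqP->; rewrite /lsrc /larr /ltgt /=; split.
have [||M [b [c Sbc]]] := @diagram_module _ _ _ _ pi adm bqa S wf.
- by move=> t t'; rewrite !inE => /or3P[]/eqP-> /or3P[]/eqP->.
- by move=> t t' t''; rewrite !inE => /or3P[]/eqP-> /or3P[]/eqP->.
suff ind : indecomposable M.
  suff : (4 <= 3)%N by [].
  by apply: (shaped_top_dim (i := 0%N) (j := 1%N) Sbc ind) => // t;
    rewrite !inE => /or3P[]/eqP->.
have Ey (v : kmod M) : v <* ar y = c 1%N v *: b 2.
  by rewrite (shaped_act Sbc) //; links; rewrite eqxx (negPf xy) (negPf zy) ?mul1r ?addr0.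
(* [x = z] is possible, and then [x] also sends [b 1] to [b 3]; hence the restriction to
   [c 1 v = 0]. *)
have Ex (v : kmod M) : c 1%N v = 0 -> v <* ar x = c 0%N v *: b 2.
  move=> c1; rewrite (shaped_act Sbc) //; links; rewrite eqxx (negPf yx) c1 !mul1r scale0r.
  by case: eqP; rewrite addr0.
have Ez (v : kmod M) : exists k, v <* ar z = k *: b 2 + c 1%N v *: b 3.
  rewrite (shaped_act Sbc) //; links; rewrite eqxx [y == z]eq_sym (negPf zy) ?mul1r ?addr0.
  by case: eqP => _; [exists (c 0%N v)|exists 0; rewrite scale0r add0r].
have b2 : b 2 != 0 by apply: (shaped_b_neq0 Sbc).
apply: (pair_indecomposable Sbc (T := fun v => c 1%N v != 0)) => //; last first.
  move=> N P sN sP dec; have [n Nn Pn] := dec (b 1%N).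
  have [c1|c1] := eqVneq (c 1%N n) 0; [right|by left; exists n].
  exists (b 1%N - n) => //; rewrite sformB (shaped_dual Sbc) // eqxx c1 subr0.
  exact: oner_neq0.
move=> N P sN sP NP0 _ [v Nv c1v] u Pu.
have sN' := submodule_subspace bqa sN; have sP' := submodule_subspace bqa sP.
have [_ ND NZ] := sN'; have [_ PD PZ] := sP'.
have N2 : N (b 2).
  by apply: (subspaceZ sN' c1v); rewrite -Ey; apply: (submodule_ar bqa).
have N3 : N (b 3).
  have [k E] := Ez v; apply: (subspaceZ sN' c1v).
  rewrite (_ : _ *: _ = v <* ar z - k *: b 2); last by rewrite E addrAC subrr add0r.
  by apply: subspaceB => //; [apply: (submodule_ar bqa)|apply: NZ].
have nP2 k : P (k *: b 2) -> k = 0.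
  move=> Pk; apply/eqP; apply: contraNT b2 => k0; apply/eqP/NP0 => //.
  exact: subspaceZ k0 Pk.
have c1u : c 1%N u = 0 by apply: nP2; rewrite -Ey; apply: (submodule_ar bqa).
have c0u : c 0%N u = 0 by apply: nP2; rewrite -Ex //; apply: (submodule_ar bqa).
apply: NP0 => //; rewrite (shaped_sum Sbc u) /= !big_ord_recr big_ord0 /=.
by rewrite c0u c1u !scale0r !add0r; apply: ND; apply: NZ.
Qed.

Lemma nakayama_split_in y y' z : y != y' -> src y = src y' -> tgt z = tgt y -> z = y.
Proof.
move=> yy sy tz; apply/eqP; apply: contraNT yy => zy.
by rewrite eq_sym; apply/eqP/(@nakayama_merge_out z).
Qed.

(** At a vertex where two arrows start, [e_b A] has room for only one path of length at least two,
    up to scalars. *)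
Lemma split_paths y y' z z' l l' : y != y' -> src y = src y' ->
  src z = src y -> src z' = src y -> l != [::] -> l' != [::] -> mon (z' :: l') != 0 ->
  exists k, mon (z :: l) = k *: mon (z' :: l').
Proof.
move=> yy sy sz sz' l0 l'0 nz.
have vz t m : src t = src y -> e (src y) * mon (t :: m) = mon (t :: m).
  by move=> <-; rewrite mon_cons mulrA src_ar.
apply: (proj_paths adm bqa H yy erefl (esym sy)); rewrite ?vz //.
  by case: l l0.
by case: l' l'0 {nz}.
Qed.

(** Such a path would be proportional to its own initial segment of length two by [split_paths],
    which [mon_loopr] forbids. *)
Lemma split_len3 y y' z l : y != y' -> src y = src y' -> src z = src y ->
  (2 <= size l)%N -> mon (z :: l) = 0.
Proof.
move=> yy sy sz; case: l => [//|x [//|x' l]] _; apply/eqP; apply: contrapT => /negP nz.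
have [k E] := split_paths (l := [:: x]) (l' := [:: x, x' & l]) yy sy sz sz isT isT nz.
have /eqP := mon_loopr adm bqa (k := k) (l := [:: z; x]) (s := x' :: l) E isT.
by apply/negP; apply: (@mon_subl _ _ _ pi _ (x' :: l)).
Qed.

(** The diagram is the representation of the Dynkin quiver [D_4] with a plane at the common source
    and a line at each of the three targets; the kernels of the three maps are three different
    lines. *)
Lemma no_three_out x y z : x != y -> y != z -> z != x -> src x = src y -> src x = src z -> False.
Proof.
move=> xy yz zx sxy sxz.
have yx : y != x by rewrite eq_sym. have zy : z != y by rewrite eq_sym.
have xz : x != z by rewrite eq_sym.
pose S : diagram K Q := Diagram 5 (nth (src x) [:: src x; src x; tgt x; tgt y; tgt z])
  [:: (0%N, x, 1, 2); (1%N, y, 1, 3); (0%N, z, 1, 4); (1%N, z, 1, 4)].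
have wf : wf_diagram S.
  by move=> t; rewrite !inE => /or4P[]/eqP->; rewrite /lsrc /larr /ltgt /=; split.
have [||M [b [c Sbc]]] := @diagram_module _ _ _ _ pi adm bqa S wf.
- by move=> t t'; rewrite !inE => /or4P[]/eqP-> /or4P[]/eqP->.
- by move=> t t' t''; rewrite !inE => /or4P[]/eqP-> /or4P[]/eqP->.
suff ind : indecomposable M.
  suff : (5 <= 3)%N by [].
  by apply: (shaped_top_dim (i := 0%N) (j := 1%N) Sbc ind) => // t;
    rewrite !inE => /or4P[]/eqP->.
have Ex (v : kmod M) : v <* ar x = c 0%N v *: b 2.
  by rewrite (shaped_act Sbc) //; links; rewrite eqxx (negPf yx) (negPf zx) mul1r ?addr0.
have Ey (v : kmod M) : v <* ar y = c 1%N v *: b 3.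
  by rewrite (shaped_act Sbc) //; links; rewrite eqxx (negPf xy) (negPf zy) mul1r ?addr0.
have Ez (v : kmod M) : v <* ar z = (c 0%N v + c 1%N v) *: b 4.
  rewrite (shaped_act Sbc) //; links; rewrite eqxx (negPf xz) (negPf yz) ?mul1r ?addr0.
  by rewrite scalerDl.
have bn i : (i < 5)%N -> b i != 0 by apply: (shaped_b_neq0 Sbc).
pose T v := c 0%N v != 0 \/ c 1%N v != 0.
apply: (pair_indecomposable Sbc (T := T)) => //; last first.
  move=> N P sN sP dec; have [n Nn Pn] := dec (b 0%N).
  have [c0|c0] := eqVneq (c 0%N n) 0; [right|by left; exists n => //; left].
  exists (b 0%N - n) => //; left; rewrite sformB (shaped_dual Sbc) // eqxx c0 subr0.
  exact: oner_neq0.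
move=> N P sN sP NP0 dec [v Nv Tv].
have sN' := submodule_subspace bqa sN; have sP' := submodule_subspace bqa sP.
have [_ ND NZ] := sN'; have [_ PD PZ] := sP'.
(* For [i] from 2 to 4, [f i u] is the coefficient of [b i] in the image of [u] under the
   corresponding arrow; the default clause serves [i = 4]. *)
pose f i (u : kmod M) := match i with 2 => c 0%N u | 3 => c 1%N u | _ => c 0%N u + c 1%N u end.
have inN i u : (1 < i < 5)%N -> N u -> f i u != 0 -> N (b i).
  case: i => [|[|[|[|[|i]]]]] //= _ Nu fu; apply: (subspaceZ sN' fu).
  - by rewrite -Ex; apply: (submodule_ar bqa).
  - by rewrite -Ey; apply: (submodule_ar bqa).
  - by rewrite -Ez; apply: (submodule_ar bqa).
have inP i u : (1 < i < 5)%N -> N (b i) -> P u -> f i u = 0.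
  move=> i5 Nb Pu; apply/eqP; apply: contraNT (bn i _) => [fu|]; last by case/andP: i5.
  apply/eqP/NP0 => //; apply: (subspaceZ sP' fu).
  case: i i5 {Nb fu} => [|[|[|[|[|i]]]]] //= _.
  - by rewrite -Ex; apply: (submodule_ar bqa).
  - by rewrite -Ey; apply: (submodule_ar bqa).
  - by rewrite -Ez; apply: (submodule_ar bqa).
have zero u : P u -> c 0%N u = 0 /\ c 1%N u = 0.
  move=> Pu; have [c0|c0] := eqVneq (c 0%N v) 0.
    have [c1|c1] : c 1%N v = 0 \/ c 1%N v != 0 by case: (eqVneq (c 1%N v) 0); [left|right].
      by case: Tv; rewrite ?c0 ?c1 eqxx.
    have u1 : c 1%N u = 0 by apply: (inP 3) => //; apply: (inN 3 v).
    have : c 0%N u + c 1%N u = 0.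
      by apply: (inP 4) => //; apply: (inN 4 v) => //=; rewrite c0 add0r.
    by rewrite u1 addr0.
  have u0 : c 0%N u = 0 by apply: (inP 2) => //; apply: (inN 2 v).
  split=> //; have [c1|c1] := eqVneq (c 1%N v) 0.
    have : c 0%N u + c 1%N u = 0.
      by apply: (inP 4) => //; apply: (inN 4 v) => //=; rewrite c1 addr0.
    by rewrite u0 add0r.
  by apply: (inP 3) => //; apply: (inN 3 v).
(* The component of [b j] in [P] has no top part, so its component in [N] has the same top
   coordinates as [b j]. *)
have all i j : (j < 2)%N -> (1 < i < 5)%N -> f i (b j) = 1 -> N (b i).
  move=> j2 i5 fb; have [n Nn Pn] := dec (b j).
  have [] := zero _ Pn; rewrite !sformB => /subr0_eq E0 /subr0_eq E1.
  apply: (inN i n) => //; suff -> : f i n = f i (b j) by rewrite fb; apply: oner_neq0.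
  by rewrite /f -E0 -E1.
have N2 : N (b 2) by apply: (all 2 0%N) => //=; rewrite (shaped_dual Sbc).
have N3 : N (b 3) by apply: (all 3 1%N) => //=; rewrite (shaped_dual Sbc).
have N4 : N (b 4) by apply: (all 4 0%N) => //=; rewrite !(shaped_dual Sbc) // addr0.
move=> u Pu; have [u0 u1] := zero u Pu.
apply: NP0 => //; rewrite (shaped_sum Sbc u) /= !big_ord_recr big_ord0 /=.
by rewrite u0 u1 !scale0r !add0r; apply: (ND); [apply: (ND)|]; apply: NZ.
Qed.

Lemma nakayama_split_tgt y y' : y != y' -> src y = src y' -> tgt y = tgt y' -> False.
Proof.
move=> yy sy ty; have := nakayama_split_in yy sy (esym ty).
by move=> E; rewrite E eqxx in yy.
Qed.

(* Another path parallel to [x y] would be [x z y] with [z] a loop, and [z] would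
   share its target with [x] and its source with [y]. *)
Lemma next_isolated x y y' : y != y' -> src y = src y' ->
  (forall z, src z = src x -> z = x) -> ar x * ar y != 0 -> isolated I [:: x; y].
Proof.
move=> yy sy sx nz; have xy := ar2_neq0 nz.
apply: (isolated_arrows adm bqa) => [|l' ll l2 nz' hd tl]; first by rewrite (mon2 pi).
exfalso; case: l' => [//|x' m] in ll l2 nz' hd tl *.
have Ex : x' = x by apply: sx; apply: hd erefl.
subst x'; case/lastP: m => [//|m w] in ll l2 nz' hd tl *.
have tw : tgt w = tgt y.
  apply/eqP; apply: contraNT nz'; rewrite -tl -rcons_cons mon_rcons -mulrA ar_vx /= => wy.
  by rewrite [tgt y == _]eq_sym (negPf wy) mulr0.
have wy : w = y by apply: (nakayama_split_in yy sy tw).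
subst w; case: m => [|z1 m] in ll l2 nz' hd tl *; first by rewrite eqxx in ll.
have sz1 : src z1 = src y.
  by rewrite -xy; apply/esym/(@ar2_neq0 _ _ _ pi); rewrite -mon2;
     apply: (@mon_subl _ _ _ pi _ (rcons m y)).
have nz1 : mon (z1 :: rcons m y) != 0 by apply: (@mon_subr _ _ _ pi [:: x]).
case: m => [|z2 m] in ll l2 nz' hd tl nz1 *; last first.
  by rewrite (split_len3 yy sy sz1) ?eqxx // size_rcons in nz1.
have tz1 : tgt z1 = src y by apply: (@ar2_neq0 _ _ _ pi); rewrite -mon2.
have xz1 : x != z1.
  apply: contraNneq yy => xz; have sxy : src x = src y by rewrite xz.
  by rewrite (sx y (esym sxy)) (sx y' _) // -sy.
case/eqP: yy; rewrite (nakayama_merge_out xz1 (z := y)) ?xy //.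
by rewrite (nakayama_merge_out xz1 (z := y')) ?xy // -sy.
Qed.

(** Otherwise [x] followed by the fork of [y] and [y'], with a second top vector sent by [y'] to the
    end of the fork, gives an indecomposable module of length five with a top of length two. *)
Lemma nakayama_next_unique x y y' : ar x * ar y != 0 -> ar x * ar y' != 0 -> y = y'.
Proof.
move=> nz nz'; apply/eqP; apply: contrapT => /negP yy.
have xy := ar2_neq0 nz; have xy' := ar2_neq0 nz'.
have sy : src y = src y' by rewrite -xy.
have y'y : y' != y by rewrite eq_sym.
(* With a second arrow at the source of [x], [split_paths] makes [x y] and [x y'] proportional, so
   that [y] and [y'] would be parallel. *)
have sx z : src z = src x -> z = x.
  move=> sz; apply/eqP; apply: contrapT => /negP zx.
  have := split_paths (z := x) (z' := x) (l := [:: y]) (l' := [:: y']) zx sz (esym sz) (esym sz).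
  rewrite !mon2 => /(_ isT isT nz')[k E].
  apply: (nakayama_split_tgt yy sy); apply: (@mon_tgt _ _ _ pi k y y' [:: x] [:: x]) => //;
  by rewrite !mon2.
have xny : x != y.
  by apply: contraNneq yy => xE; rewrite (sx y') ?xE // -sy.
have xny' : x != y'.
  by apply: contraNneq yy => xE; rewrite (sx y) ?xE ?sy.
pose S : diagram K Q := Diagram 5 (nth (src x) [:: src x; tgt x; tgt x; tgt y; tgt y'])
  [:: (0%N, x, 1, 1%N); (1%N, y, 1, 3); (1%N, y', 1, 4); (2, y', 1, 4)].
have wf : wf_diagram S.
  by move=> t; rewrite !inE => /or4P[]/eqP->; rewrite /lsrc /larr /ltgt /=; split.
have iso : isolated I [:: x; y] by apply: next_isolated sy sx nz.
have iso' : isolated I [:: x; y'] by apply: next_isolated (esym sy) sx nz'.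
have [||M [b [c Sbc]]] := @diagram_module _ _ _ _ pi adm bqa S wf.
- by move=> t t'; rewrite !inE => /or4P[]/eqP-> /or4P[]/eqP->.
- by move=> t t' t''; rewrite !inE => /or4P[]/eqP-> /or4P[]/eqP-> // /or4P[]/eqP->.
suff ind : indecomposable M.
  suff : (5 <= 3)%N by [].
  by apply: (shaped_top_dim (i := 0%N) (j := 2) Sbc ind) => // t;
    rewrite !inE => /or4P[]/eqP->.
have Ex (v : kmod M) : v <* ar x = c 0%N v *: b 1%N.
  rewrite (shaped_act Sbc) //; links; rewrite eqxx ![_ == x]eq_sym (negPf xny) (negPf xny').
  by rewrite mul1r ?addr0.
have Ey (v : kmod M) : v <* ar y = c 1%N v *: b 3.
  by rewrite (shaped_act Sbc) //; links; rewrite eqxx (negPf xny) (negPf y'y) mul1r ?addr0.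
have Ey' (v : kmod M) : v <* ar y' = (c 1%N v + c 2 v) *: b 4.
  rewrite (shaped_act Sbc) //; links; rewrite eqxx (negPf xny') (negPf yy) ?mul1r ?addr0.
  by rewrite scalerDl.
have bn i : (i < 5)%N -> b i != 0 by apply: (shaped_b_neq0 Sbc).
apply: (pair_indecomposable Sbc (T := fun v => c 0%N v != 0)) => //; last first.
  move=> N P sN sP dec; have [n Nn Pn] := dec (b 0%N).
  have [c0|c0] := eqVneq (c 0%N n) 0; [right|by left; exists n].
  exists (b 0%N - n) => //; rewrite sformB (shaped_dual Sbc) // eqxx c0 subr0.
  exact: oner_neq0.
move=> N P sN sP NP0 _ [v Nv c0v].
have sN' := submodule_subspace bqa sN; have sP' := submodule_subspace bqa sP.
have [_ ND NZ] := sN'; have [_ PD PZ] := sP'.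
have N1 : N (b 1%N).
  by apply: (subspaceZ sN' c0v); rewrite -Ex; apply: (submodule_ar bqa).
have N3 : N (b 3).
  have <- : b 1%N <* ar y = b 3 by rewrite Ey (shaped_dual Sbc) // scale1r.
  exact: (submodule_ar bqa).
have N4 : N (b 4).
  have <- : b 1%N <* ar y' = b 4 by rewrite Ey' !(shaped_dual Sbc) // addr0 scale1r.
  exact: (submodule_ar bqa).
have nP i k : (i < 5)%N -> N (b i) -> P (k *: b i) -> k = 0.
  move=> i5 Nb Pk; apply/eqP; apply: contraNT (bn i i5) => k0; apply/eqP/NP0 => //.
  exact: subspaceZ k0 Pk.
move=> u Pu.
have u0 : c 0%N u = 0 by apply: (nP 1%N) => //; rewrite -Ex; apply: (submodule_ar bqa).
have u1 : c 1%N u = 0 by apply: (nP 3) => //; rewrite -Ey; apply: (submodule_ar bqa).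
have u2 : c 2 u = 0.
  have : c 1%N u + c 2 u = 0 by apply: (nP 4) => //; rewrite -Ey'; apply: (submodule_ar bqa).
  by rewrite u1 add0r.
apply: NP0 => //; rewrite (shaped_sum Sbc u) /= !big_ord_recr big_ord0 /=.
by rewrite u0 u1 u2 !scale0r !add0r; apply: ND; apply: NZ.
Qed.

(** A parallel path starts with [w1]. If [z] follows, the path is a proper multiple of [w1 z].
    Otherwise it is [w1 z2 z] with a loop [z2], and [w1] or [w2] merges with this loop although [z]
    and [z2] share their source. *)
Lemma prev_isolated (w1 w2 z : arr Q) : w1 != w2 -> tgt w1 = tgt w2 ->
  ar w1 * ar z != 0 -> isolated I [:: w1; z].
Proof.
move=> w12 tw nz; have wz := ar2_neq0 nz; have w21 : w2 != w1 by rewrite eq_sym.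
apply: (isolated_arrows adm bqa) => [|l' ll l2 nz' hd tl]; first by rewrite (mon2 pi).
case: l' => [//|x' [//|z2 m]] in ll l2 nz' hd tl *.
have Ex : x' = w1.
  by apply: (nakayama_merge_out w21); [rewrite tw|apply: hd erefl].
subst x'; have sz2 : tgt w1 = src z2.
  by apply: (@ar2_neq0 _ _ _ pi); rewrite -mon2; apply: (@mon_subl _ _ _ pi _ m).
have [z2z|z2z] := eqVneq z2 z.
  subst z2; exists m; first by apply: contraNneq ll => ->.
  by rewrite -mon_cat.
exfalso; have sz : src z = src z2 by rewrite -wz.
have zz2 : z != z2 by rewrite eq_sym.
have nz2 : mon (z2 :: m) != 0 by apply: (@mon_subr _ _ _ pi [:: w1]).
have ml : (size m <= 1)%N.
  rewrite leqNgt; apply: contraNN nz2 => m2; apply/eqP.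
  by apply: (split_len3 z2z _ _ m2).
have tm : tgt (last z2 m) = tgt z.
  apply/eqP; apply: contraNT nz'; rewrite -tl lastI mon_rcons -mulrA ar_vx /= => wy.
  by rewrite [tgt z == _]eq_sym (negPf wy) mulr0.
have lm : last z2 m = z by apply: (nakayama_split_in zz2 sz tm).
case: m => [|t [|//]] in ml lm nz2 {tl ll l2 nz' tm hd} *.
  by rewrite /= in lm; rewrite lm eqxx in z2z.
rewrite /= in lm; subst t; have tz2 : tgt z2 = src z.
  by apply: (@ar2_neq0 _ _ _ pi); rewrite -mon2.
have bad (w : arr Q) : w != z2 -> tgt w = tgt w1 -> False.
  move=> wz2 tww; case/eqP: zz2; apply: (nakayama_merge_out wz2) => //.
  by rewrite tz2 tww.
have [w1z|w1z] := eqVneq w1 z2; last exact: (bad w1).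
by apply: (bad w2) => //; rewrite -w1z.
Qed.

(** Otherwise two vectors are joined by [w1] and [w2] and then moved by [z]: this gives simple
    socle, length four and a top of length two. *)
Lemma nakayama_prev_unique (w1 w2 z : arr Q) : ar w1 * ar z != 0 -> ar w2 * ar z != 0 -> w1 = w2.
Proof.
move=> nz1 nz2; apply/eqP; apply: contrapT => /negP w12.
have w1z := ar2_neq0 nz1; have w2z := ar2_neq0 nz2.
have w21 : w2 != w1 by rewrite eq_sym.
have tw : tgt w1 = tgt w2 by rewrite w2z.
pose S : diagram K Q := Diagram 4 (nth (src z) [:: src w1; src w2; tgt w1; tgt z])
  [:: (0%N, w1, 1, 2); (1%N, w2, 1, 2); (2, z, 1, 3)].
have wf : wf_diagram S.
  by move=> t; rewrite !inE => /or3P[]/eqP->; rewrite /lsrc /larr /ltgt /=; split.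
have iso1 := prev_isolated w12 tw nz1; have iso2 := prev_isolated w21 (esym tw) nz2.
have [||M [b [c Sbc]]] := @diagram_module _ _ _ _ pi adm bqa S wf.
- by move=> t t'; rewrite !inE => /or3P[]/eqP-> /or3P[]/eqP->.
- by move=> t t' t''; rewrite !inE => /or3P[]/eqP-> /or3P[]/eqP-> // /or3P[]/eqP->.
have src0 : source_index S 0 by move=> t; rewrite !inE => /or3P[]/eqP->.
have src1 : source_index S 1 by move=> t; rewrite !inE => /or3P[]/eqP->.
suff ind : indecomposable M.
  suff : (4 <= 3)%N by [].
  by apply: (shaped_top_dim (i := 0%N) (j := 1%N) Sbc ind).
have Ez (v : kmod M) : c 0%N v = 0 -> c 1%N v = 0 -> v <* ar z = c 2 v *: b 3.
  move=> c0 c1; rewrite (shaped_act Sbc) //; links; rewrite c0 c1 !mulr0 !scale0r eqxx mul1r.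
  by case: (w1 == z); case: (w2 == z); rewrite ?add0r ?addr0.
have Ew (w : arr Q) i (v : kmod M) : (i < 2)%N -> w = nth w1 [:: w1; w2] i ->
    v <* (ar w * ar z) = c i v *: b 3.
  move=> i2 wE; rewrite -ractM Ez; try exact: (source_form Sbc).
  congr (_ *: _); rewrite (shaped_ar Sbc) //; links; rewrite wE.
  by case: i i2 {wE} => [|[|i]] //= _; rewrite eqxx ?(negPf w21) ?(negPf w12) ?addr0 mul1r.
apply: (socle_indecomposable bqa Sbc (s := 3)) => // v v0.
have [c0|c0] := eqVneq (c 0%N v) 0; last by exists (ar w1 * ar z), (c 0%N v); rewrite (Ew w1 0%N).
have [c1|c1] := eqVneq (c 1%N v) 0; last by exists (ar w2 * ar z), (c 1%N v); rewrite (Ew w2 1%N).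
have [c2|c2] := eqVneq (c 2 v) 0; last by exists (ar z), (c 2 v); rewrite Ez.
have vE : v = c 3 v *: b 3.
  by rewrite [LHS](shaped_sum Sbc) /= !big_ord_recr big_ord0 /= c0 c1 c2 !scale0r !add0r.
exists 1, (c 3 v); rewrite ract1; split=> //.
by apply: contraNneq v0 => c30; rewrite vE c30 scale0r eqxx.
Qed.

(** Otherwise [u w2] is isolated, and the walk [w1 w2^{-1} u^{-1}] carries a module of length four
    with simple socle and a top of length two. *)
Lemma nakayama_merge_unrelated (w1 w2 u : arr Q) : w1 != w2 -> tgt w1 = tgt w2 -> tgt u = src w2 ->
  ~ unrelated_arrows I [:: u; w2].
Proof.
move=> w12 tw uw rel; have w21 : w2 != w1 by rewrite eq_sym.
have nz : mon [:: u; w2] != 0.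
  by apply: (unrelated_nz bqa) rel; rewrite /= uw !eqxx.
have iso : isolated I [:: u; w2].
  apply: (isolated_arrows adm bqa nz) => l' ll l2 nz' hd tl.
  case: l' => [//|u' [//|v m]] in ll l2 nz' hd tl *.
  have su : src u' = src u by apply: hd erefl.
  have [uu|uu] := eqVneq u' u; last first.
    have [k E] := split_paths (z := u) (z' := u') (l := [:: w2]) (l' := v :: m) uu su (esym su) erefl isT isT nz'.
    have := unrelated_neq bqa rel nz E isT.
    by move=> [u'u _]; rewrite u'u eqxx in uu.
  subst u'; have sv : tgt u = src v.
    by apply: (@ar2_neq0 _ _ _ pi); rewrite -mon2; apply: (@mon_subl _ _ _ pi _ m).
  have vw : v = w2 by apply: (nakayama_merge_out w12) => //; rewrite -sv.
  subst v; exists m; first by apply: contraNneq ll => ->.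
  by rewrite -mon_cat.
pose S : diagram K Q := Diagram 4 (nth (src u) [:: src w1; src u; tgt u; tgt w1])
  [:: (0%N, w1, 1, 3); (1%N, u, 1, 2); (2, w2, 1, 3)].
have wf : wf_diagram S.
  by move=> t; rewrite !inE => /or3P[]/eqP->; rewrite /lsrc /larr /ltgt /=; split.
have [||M [b [c Sbc]]] := @diagram_module _ _ _ _ pi adm bqa S wf.
- by move=> t t'; rewrite !inE => /or3P[]/eqP-> /or3P[]/eqP->.
- by move=> t t' t''; rewrite !inE => /or3P[]/eqP-> /or3P[]/eqP-> // /or3P[]/eqP->.
have src0 : source_index S 0 by move=> t; rewrite !inE => /or3P[]/eqP->.
have src1 : source_index S 1 by move=> t; rewrite !inE => /or3P[]/eqP->.
suff ind : indecomposable M.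
  suff : (4 <= 3)%N by [].
  by apply: (shaped_top_dim (i := 0%N) (j := 1%N) Sbc ind).
have Ew2 (v : kmod M) : c 1%N v = 0 -> v <* ar w2 = c 2 v *: b 3.
  move=> c1; rewrite (shaped_act Sbc) //; links; rewrite c1 mulr0 scale0r eqxx (negPf w12) mul1r.
  by case: (u == w2); rewrite ?add0r ?addr0.
have Eu (v : kmod M) : v <* (ar u * ar w2) = c 1%N v *: b 3.
  rewrite -ractM Ew2; last exact: (source_form Sbc).
  by congr (_ *: _); rewrite (shaped_ar Sbc) //; links; rewrite eqxx ?addr0 mul1r.
have Ew1 (v : kmod M) : c 1%N v = 0 -> c 2 v = 0 -> v <* ar w1 = c 0%N v *: b 3.
  move=> c1 c2; rewrite (shaped_act Sbc) //; links; rewrite c1 c2 !mulr0 !scale0r eqxx mul1r.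
  by case: (u == w1); rewrite (negPf w21) ?add0r ?addr0.
apply: (socle_indecomposable bqa Sbc (s := 3)) => // v v0.
have [c1|c1] := eqVneq (c 1%N v) 0; last by exists (ar u * ar w2), (c 1%N v); rewrite Eu.
have [c2|c2] := eqVneq (c 2 v) 0; last by exists (ar w2), (c 2 v); rewrite Ew2.
have [c0|c0] := eqVneq (c 0%N v) 0; last by exists (ar w1), (c 0%N v); rewrite Ew1.
have vE : v = c 3 v *: b 3.
  by rewrite [LHS](shaped_sum Sbc) /= !big_ord_recr big_ord0 /= c0 c1 c2 !scale0r !add0r.
exists 1, (c 3 v); rewrite ract1; split=> //.
by apply: contraNneq v0 => c30; rewrite vE c30 scale0r eqxx.
Qed.

Lemma nakayama_special_biserial : special_biserial I.
Proof.
split=> [a|a|x y y' xy xy'|x z z' zx z'x].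
- rewrite leqNgt; apply/negP => /card_gt2P[x [y [z [[+ + +] [xy yz zx]]]]].
  rewrite !inE => /eqP xa /eqP ya /eqP za.
  by apply: (no_three_out xy yz zx); rewrite xa ?ya ?za.
- rewrite leqNgt; apply/negP => /card_gt2P[x [y [z [[+ + +] [xy yz zx]]]]].
  rewrite !inE => /eqP xa /eqP ya /eqP za.
  by apply: (no_three_in xy yz zx); rewrite xa ?ya ?za.
- by apply: (nakayama_next_unique (x := x)); apply/eqP => /(I_arrows bqa).
- by apply: (nakayama_prev_unique (z := x)); apply/eqP => /(I_arrows bqa).
Qed.

(** A further edge beside the merge is excluded by [nakayama_merge_out] if it points away from the
    merge, and by [nakayama_merge_unrelated] if it points towards it. *)
Lemma nakayama_condition_i : condition_i I.
Proof.
move=> w w1 w2 sw w12 tw /infixP[l [r E]]; have w21 : w2 != w1 by rewrite eq_sym.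
have r0 : r = [::].
  case: r E => [//|[x d] r] E.
  have [] := walk_adjacent sw (l := rcons l (fwd w1)) (c := bwd w2) (d := (x, d)) (r := r) _.
    by rewrite E cat_rcons.
  case: d E => E /= sx wx.
    have xw : x = w2 by apply: (nakayama_merge_out w12).
    by rewrite xw /fwd eqxx in wx.
  case: (nakayama_merge_unrelated w12 tw (esym sx)).
  by apply: (bwd_subwalk sw (l := rcons l (fwd w1)) (r := r)); rewrite E cat_rcons.
have l0 : l = [::].
  case/lastP: l E => [//|l [x d]] E.
  have [] := walk_adjacent sw (l := l) (c := (x, d)) (d := fwd w1) (r := bwd w2 :: r) _.
    by rewrite E cat_rcons.
  case: d E => E /= sx wx; last first.
    have xw : x = w1 by apply: (nakayama_merge_out w21).
    by rewrite xw /fwd eqxx in wx.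
  case: (nakayama_merge_unrelated w21 (esym tw) sx).
  by apply: (fwd_subwalk sw (l := l) (r := bwd w2 :: r)); rewrite E cat_rcons.
by rewrite E l0 r0.
Qed.

(** In a walk longer than two, condition (i) excludes every turn [x y^{-1}], so both sides keep
    their direction. [split_len3] allows one more edge on each side, and [split_paths] would relate
    the two resulting paths, so only one side is prolonged. *)
Lemma nakayama_condition_ii : condition_ii I.
Proof.
move=> w w1 w2 sw w12 sw12 /infixP[l [r E]]; have w21 : w2 != w1 by rewrite eq_sym.
rewrite /walk_length /plength -/(edges w).
have noturn (l' r' : seq (edge Q)) x y : (2 < size (edges w))%N -> edges w = l' ++ fwd x :: bwd y :: r' -> False.
  move=> w3 E'; have [/= txy yx] := walk_adjacent sw E'.
  have xy : x != y by apply: contraNneq yx => ->.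
  have := nakayama_condition_i sw xy txy _; rewrite /has_subwalk => E2.
  by move: w3; rewrite E2 // E'; apply/infixP; exists l', r'.
have long x1 x2 x3 : src x1 = src w1 -> tgt x1 = src x2 -> tgt x2 = src x3 ->
    unrelated_arrows I [:: x1; x2; x3] -> False.
  move=> s1 s2 s3 rel; have : mon [:: x1; x2; x3] != 0.
    by apply: (unrelated_nz bqa) rel; rewrite /= s2 s3 !eqxx.
  by rewrite (split_len3 w12 sw12 s1) ?eqxx.
have rP : r = [::] \/ exists x, [/\ r = [:: fwd x], tgt w2 = src x & unrelated_arrows I [:: w2; x]].
  case: r E => [|[x d] r] E; first by left.
  have w3 : (2 < size (edges w))%N by rewrite E size_cat /= !addnS.
  have E1 : edges w = rcons l (bwd w1) ++ fwd w2 :: (x, d) :: r by rewrite E cat_rcons.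
  case: d E E1 => E E1; last by case: (noturn _ _ _ _ w3 E1).
  have [/= tx _] := walk_adjacent sw E1.
  right; exists x; split=> //; last exact: (fwd_subwalk sw (s := [:: w2; x]) (r := r) E1).
  case: r E E1 => [//|[x' d'] r] E E1; exfalso.
  have E2 : edges w = rcons (rcons l (bwd w1)) (fwd w2) ++ fwd x :: (x', d') :: r.
    by rewrite [RHS]cat_rcons.
  case: d' E E1 E2 => E E1 E2; last by apply: (noturn _ _ _ _ w3 E2).
  have [/= tx' _] := walk_adjacent sw E2.
  by apply: (long w2 x x') => //; apply: (fwd_subwalk sw (s := [:: w2; x; x']) (r := r) E1).
have lP : l = [::] \/ exists x, [/\ l = [:: bwd x], tgt w1 = src x & unrelated_arrows I [:: w1; x]].
  case/lastP: l E {rP} => [|l [x d]] E; first by left.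
  have w3 : (2 < size (edges w))%N by rewrite E size_cat size_rcons /= !addnS.
  have E1 : edges w = l ++ (x, d) :: bwd w1 :: fwd w2 :: r by rewrite E cat_rcons.
  case: d E E1 => E E1; first by case: (noturn _ _ _ _ w3 E1).
  have [/= tx _] := walk_adjacent sw E1.
  right; exists x; split=> //; last exact: (bwd_subwalk sw (s := [:: w1; x]) (r := fwd w2 :: r) E1).
  case/lastP: l E E1 => [//|l [x' d']] E E1; exfalso.
  have E2 : edges w = l ++ (x', d') :: bwd x :: bwd w1 :: fwd w2 :: r.
    by rewrite E1 cat_rcons.
  case: d' E E1 E2 => E E1 E2; first by apply: (noturn _ _ _ _ w3 E2).
  have [/= tx' _] := walk_adjacent sw E2.
  by apply: (long w1 x x') => //; apply: (bwd_subwalk sw (s := [:: w1; x; x']) (r := fwd w2 :: r) E2).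
rewrite E !size_cat /=; case: lP => [->|[x [-> tx relx]]]; case: rP => [->|[y [-> ty rely]]] //.
have nz1 : mon [:: w1; x] != 0 by apply: (unrelated_nz bqa) relx; rewrite /= tx !eqxx.
have nz2 : mon [:: w2; y] != 0 by apply: (unrelated_nz bqa) rely; rewrite /= ty !eqxx.
have [k Ek] := split_paths w12 sw12 (z := w1) (z' := w2) (l := [:: x]) (l' := [:: y])
  erefl (esym sw12) isT isT nz2.
have [w21' _] := unrelated_neq bqa relx nz1 Ek isT.
by rewrite w21' eqxx in w12.
Qed.

(** By [related_heads] the paths have different first arrows. So two arrows start at their source,
    and [split_len3] bounds both lengths by two. *)
Lemma nakayama_condition_iii : condition_iii I.
Proof.
move=> p q [spq tpq pq [nIp nIq Ipq]].
have two (p1 p2 : qpath Q) : p1 != p2 -> I (path_elt K p1 - path_elt K p2) ->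
    (2 <= plength p1)%N /\ (2 <= plength p2)%N.
  move=> p12 I12; split; rewrite leqNgt; apply/negP => /(short_coef adm) /(_ I12) /eqP;
  rewrite mcoeffB path_elt.unlock mcoeffUU mcoeffU.
    by rewrite [p2 == p1]eq_sym (negPf p12) mulr0n subr0 oner_eq0.
  by rewrite (negPf p12) mulr0n sub0r oppr_eq0 oner_eq0.
have [p2 q2] := two _ _ pq Ipq.
have Epq : pi (path_elt K p) = 1 *: pi (path_elt K q).
  by apply/(piPE bqa); rewrite scale1r.
have nz : pi (path_elt K p) != 0 by apply: contra_notN nIp => /eqP/(piI bqa).
have nzq : pi (path_elt K q) != 0 by apply: contraNneq nz => q0; rewrite Epq q0 scaler0.
move: p2 q2; rewrite /plength.
case pl : (parr p) => [//|x l]; case ql : (parr q) => [//|y l'] /= l2 l'2.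
have sx : psrc p = src x by have := qpathP p; rewrite pl /= => /andP[/eqP].
have sy : psrc q = src y by have := qpathP q; rewrite ql /= => /andP[/eqP].
rewrite (path_mon pi pl) (path_mon pi ql) in Epq; rewrite (path_mon pi pl) in nz.
rewrite (path_mon pi ql) in nzq.
have [xy|xy] := eqVneq x y.
  subst y; case: (related_heads adm bqa nakayama_special_biserial Epq _ nz).
  apply: contraNneq pq => ll; apply/eqP/val_inj.
  rewrite [LHS]surjective_pairing [RHS]surjective_pairing.
  by rewrite -/(psrc p) -/(psrc q) -/(parr p) -/(parr q) pl ql spq ll.
have sxy : src x = src y by rewrite -sx spq.
have len z m : src z = src x -> (1 < (size m).+1)%N -> mon (z :: m) != 0 -> (size m).+1 = 2%N.
  move=> sz m1 nzm; apply/eqP; rewrite eqn_leq m1 andbT ltnS leqNgt.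
  apply: contraNN nzm => m2; apply/eqP; exact: (split_len3 xy sxy sz).
by split; [apply: (len x)|apply: (len y)].
Qed.

Lemma merge_iv_a (y y' : arr Q) : y != y' -> tgt y = tgt y' -> condition_iv_a Q.
Proof.
move=> yy ty; exists (tgt y); apply/eqP; rewrite eqn_leq.
have [_ -> _ _] := nakayama_special_biserial.
by apply/card_gt1P; exists y, y'; split; rewrite ?inE ?ty.
Qed.

Lemma nakayama_condition_iv (M : lmodType A^c) : indecomposable M -> factor_serial M 3 ->
  condition_iv_a Q \/ condition_iv_b I.
Proof.
move=> indM fs; have sb := nakayama_special_biserial.
have ci := nakayama_condition_i; have cii := nakayama_condition_ii.
have [S [lS hS]] := classification adm bqa sb ci cii indM.
move: lS (listed_wf lS) hS.
case=> [w1 y w2 y' k w12 sw k0 nz E|w1 w2 w12 tw|w1 y w2 w12 sw nz w2x|w1 w2 w12 sw|a l lc nz] wf hS.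
- by left; apply: (merge_iv_a (square_neq adm ci w12 sw nz E) (square_tgt nz E)).
- by left; apply: (merge_iv_a w12 tw).
(* A relation for [w1 y] would continue [w2], which the hook excludes; so [y^{-1} w1^{-1} w2] is a
   string of length three. *)
- right; have rel : unrelated_arrows I [:: w1; y].
    apply: contrapT => /(related_split adm bqa sb ci w12 sw nz)[k [y' [_ E]]].
    by move: nz; rewrite E w2x scaler0 eqxx.
  have [|||w we st] := make_string adm (a := tgt y) (es := [:: bwd y; bwd w1; fwd w2]).
  + by rewrite /= (ar2_neq0 nz) sw !eqxx.
  + by rewrite /= !edge_eqE eq_sym w12.
  + move=> [|x1 [|x2 l]] //= _; rewrite /rev /= !edge_eqE !(andbF, andFb, orbF).
    case=> // /and3P[/eqP-> /eqP->]; by case: l => [|? ?] //=; rewrite ?bwd_fwd_eq.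
  exists w, w1, w2; split=> //; first by rewrite /walk_length /plength -/(edges w) we.
  by rewrite /has_subwalk we /= !edge_eqE !eqxx ?orbT.
(* A fork has length three, and type three would require the quotient by [rad^(3-3+1)] not to be
   uniserial. *)
- have uni := fork_radical adm bqa w12 wf hS.
  have [b [c Sbc]] := hS; have [_ [l [len _ _]]] := fs.
  by rewrite (shaped_length adm bqa Sbc len).
by have [nu _] := fs; case: nu; exact: (path_uniserial adm bqa hS).
Qed.

End NakayamaNecessity.

Theorem theorem3p3 (K : closedFieldType) (Q : quiver)
    (I : set (path_algebra K Q)) (A : falgType K)
    (pi : {rmorphism path_algebra K Q -> A}) :
  admissible I -> is_bound_quiver_algebra I pi ->
  basic_algebra A -> connected_algebra A ->
  (right_nakayama A 3 <->
   [/\ special_biserial I, finite_type A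
     & [/\ condition_i I, condition_ii I, condition_iii I
         & condition_iv_a Q \/ condition_iv_b I \/ condition_iv_c I]]).
Proof.
move=> adm bqa _ _; split=> [[H [M [_ indM fs]]]|[sb _ [ci cii _ iv]]]; last first.
  exact: (conditions_right_nakayama adm bqa sb ci cii iv).
have sb := nakayama_special_biserial adm bqa H.
have ci := nakayama_condition_i adm bqa H; have cii := nakayama_condition_ii adm bqa H.
split=> //; first exact: (listed_finite_type adm bqa sb ci cii).
split=> //; first exact: (nakayama_condition_iii adm bqa H).
by case: (nakayama_condition_iv adm bqa H indM fs); [left|right; left].
Qed.
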